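(* Let $A$ be a Hermitian unital Banach $\ast$-algebra and $\psi:A\to\mathbb{C}$ a positive normalized linear functional. Let $f$ be analytic in an open subset $G$ of $\mathbb{C}$, let $I\subset G$ be a real interval, and let $m<M$ be real numbers with $[m,M]\subset I$. Suppose there exist constants $K>k\ge0$ such that $K\ge f''(z)\ge k$ for every $z\in[m,M]$. Let $c\in A$ be a selfadjoint element with $\sigma(c)\subseteq[m,M]$, and suppose in addition that $\psi(f'(c))\ne0$ and $$\frac{\psi(cf'(c))}{\psi(f'(c))}\in[m,M].$$ Then $$\frac12K\,\psi\left[\left(c-\frac{\psi(cf'(c))}{\psi(f'(c))}\right)^2\right]\ge f\left(\frac{\psi(cf'(c))}{\psi(f'(c))}\right)-\psi(f(c))\ge\frac12k\,\psi\left[\left(c-\frac{\psi(cf'(c))}{\psi(f'(c))}\right)^2\right]$$ and $$\begin{aligned}\frac12K\,\psi\left[\left(c-\frac{\psi(cf'(c))}{\psi(f'(c))}\right)^2\right]&\ge f'\left(\frac{\psi(cf'(c))}{\psi(f'(c))}\right)\frac{\psi(cf'(c))}{\psi(f'(c))}-\psi(c)f'\left(\frac{\psi(cf'(c))}{\psi(f'(c))}\right)\\&\quad-f\left(\frac{\psi(cf'(c))}{\psi(f'(c))}\right)+\psi(f(c))\\&\ge\frac12k\,\psi\left[\left(c-\frac{\psi(cf'(c))}{\psi(f'(c))}\right)^2\right].\end{aligned}$$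
   Context: A unital Banach $\ast$-algebra $A$ (complex, with unit $1$) is called Hermitian if every selfadjoint element $a$ ($a^\ast=a$) has real spectrum $\sigma(a)\subset\mathbb{R}$. An element $a\in A$ is nonnegative, written $a\ge 0$, if $a^\ast=a$ and $\sigma(a)\subset[0,\infty)$. A linear functional $\psi:A\to\mathbb{C}$ is positive if $\psi(a)\ge0$ whenever $a\ge0$, and normalized if $\psi(1)=1$. For $g$ analytic on an open set $G\supset\sigma(c)$, $g(c)\in A$ is defined by the holomorphic functional calculus, $g(c)=\frac{1}{2\pi i}\int_\gamma g(z)(z-c)^{-1}dz$, where $\gamma$ is a closed rectifiable curve in $G$ with $\sigma(c)$ in its inside; the result does not depend on the choice of $\gamma$. Here $f'$ and $f''$ are the complex derivatives of $f$, and for a scalar $t$, $c-t$ means $c-t\cdot1$. An inequality between scalars includes the assertion that they are real. *)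

(* Defs.v *)
From HB Require Import structures.
From mathcomp Require Import all_boot all_order all_algebra.
From mathcomp Require Import complex.
From mathcomp Require Import all_classical all_reals all_analysis.
Set Implicit Arguments.
Unset Strict Implicit.
Unset Printing Implicit Defensive.
Import Order.TTheory GRing.Theory Num.Theory.
Import numFieldNormedType.Exports.

Local Open Scope classical_set_scope.
Local Open Scope ring_scope.
Local Open Scope complex_scope.

(* The topology and norm of R[i] are those of the numeric field R[i]; the
   library only provides them on the alias R[i]^o. *)
HB.instance Definition _ (R : realType) := NormedModule.copy R[i] R[i]^o.

HB.mixin Record Algebra_isNormedAlgebra (R : realType) A
    & GRing.UnitAlgebra R[i] A := {
  anorm : A -> R[i] ;
  anormD : forall x y : A, anorm (x + y) <= anorm x + anorm y ;
  anormZ : forall (l : R[i]) (x : A), anorm (l *: x) = `|l| * anorm x ;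
  anorm0_eq0 : forall x : A, anorm x = 0 -> x = 0 ;
  anormM : forall x y : A, anorm (x * y) <= anorm x * anorm y }.

#[short(type="normedAlgType")]
HB.structure Definition NormedAlgebra (R : realType) :=
  {A of GRing.UnitAlgebra R[i] A & Algebra_isNormedAlgebra R A}.

(* The normed space underlying A. It is a separate alias because the library
   has no common ancestor for normed modules and rings other than numDomainType,
   so that one type cannot canonically be both. *)
Definition nspace (R : realType) (A : normedAlgType R) : Type := A.

HB.instance Definition _ (R : realType) (A : normedAlgType R) :=
  GRing.Lmodule.copy (nspace A) A.
HB.instance Definition _ (R : realType) (A : normedAlgType R) :=
  @Lmodule_isNormed.Build R[i] (nspace A) (@anorm R A) (@anormD R A)
    (@anormZ R A) (@anorm0_eq0 R A).

(* The involution is only required to be continuous, and the norm of the unit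
   is not fixed: the conventions |x^*| = |x| and |1| = 1 are special cases. *)
HB.mixin Record NormedAlgebra_isBanachStar (R : realType) A
    & NormedAlgebra R A := {
  nspace_complete : forall F : set_system (nspace A),
    ProperFilter F -> cauchy F -> cvg F ;
  star : A -> A ;
  starD : forall x y : A, star (x + y) = star x + star y ;
  starZ : forall (l : R[i]) (x : A), star (l *: x) = conjc l *: star x ;
  starM : forall x y : A, star (x * y) = star y * star x ;
  starK : involutive star ;
  star_continuous : continuous (star : nspace A -> nspace A) }.

#[short(type="banachStarAlgType")]
HB.structure Definition BanachStarAlgebra (R : realType) :=
  {A of NormedAlgebra R A & NormedAlgebra_isBanachStar R A}.

HB.instance Definition _ (R : realType) (A : banachStarAlgType R) :=
  Uniform_isComplete.Build (nspace A) (@nspace_complete R A).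

Section BanachStarAlgebraTheory.
Context (R : realType) (A : banachStarAlgType R).
Implicit Types (a c : A) (psi : {scalar A}).

Definition spectrum a : set R[i] := [set z | a - z%:A \isn't a GRing.unit].

Definition selfadjoint a : Prop := star a = a.

(* In the partial order of R[i], 0 <= z means that z is real and nonnegative. *)
Definition nonneg_elt a : Prop :=
  selfadjoint a /\ (forall z, spectrum a z -> 0 <= z).

Definition hermitian_algebra : Prop :=
  forall a, selfadjoint a -> forall z, spectrum a z -> z \is Num.real.

Definition positive_functional psi : Prop :=
  forall a, nonneg_elt a -> 0 <= psi a.

End BanachStarAlgebraTheory.

Arguments hermitian_algebra {R} A.

Definition analytic_on (R : realType) (G : set R[i]) (f : R[i] -> R[i]) : Prop :=
  forall z, G z -> derivable f z 1.

Section Curves.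
Context (R : realType).
Implicit Types (gamma : R -> R[i]) (s : seq R).

(* A subdivision 0 = t_0 < ... < t_(size s) = 1 of [0, 1] is represented, as in
   itv_partition, by the sequence s of its points t_1, ..., t_(size s). *)
Definition subdiv_pt s (i : nat) : R := nth 1 (0 :: s) i.

Definition rectifiable gamma : Prop :=
  exists L : R, forall s, itv_partition 0 1 s ->
    \sum_(0 <= i < size s)
      `|gamma (subdiv_pt s i.+1) - gamma (subdiv_pt s i)| <= L%:C.

Definition closed_rectifiable_curve gamma : Prop :=
  [/\ {within `[0, 1], continuous gamma}, gamma 0 = gamma 1
    & rectifiable gamma].

(* Riemann-Stieltjes integral of F along gamma : x is the limit of the tagged
   sums as the mesh of the subdivision tends to 0. *)
Definition is_curve_integral (V : normedModType R[i]) gamma (F : R[i] -> V)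
    (x : V) : Prop :=
  forall e : R, 0 < e -> exists2 d : R, 0 < d &
    forall s (tau : nat -> R), itv_partition 0 1 s ->
      (forall i, (i < size s)%N ->
         [/\ subdiv_pt s i <= tau i, tau i <= subdiv_pt s i.+1
           & subdiv_pt s i.+1 - subdiv_pt s i < d]) ->
      `|x - \sum_(0 <= i < size s)
              (gamma (subdiv_pt s i.+1) - gamma (subdiv_pt s i))
                *: F (gamma (tau i))| < e%:C.

Definition two_pi_i : R[i] := 0 +i* (2 * pi).

Definition winding_number gamma (z : R[i]) (n : int) : Prop :=
  ~ (gamma @` `[0, 1]) z /\
  is_curve_integral gamma (fun w => (w - z)^-1) (two_pi_i * n%:~R).

Definition curve_inside gamma : set R[i] :=
  [set z | winding_number gamma z 1].

Definition curve_outside gamma : set R[i] :=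
  [set z | winding_number gamma z 0].

(* When G has holes, the requirement that gamma does not wind around any point
   outside G is what makes the integral below independent of gamma. *)
Definition encloses gamma (G S : set R[i]) : Prop :=
  [/\ closed_rectifiable_curve gamma, gamma @` `[0, 1] `<=` G,
      S `<=` curve_inside gamma & ~` G `<=` curve_outside gamma].

End Curves.

(* g(c) *)
Definition hol_calc (R : realType) (A : banachStarAlgType R) (G : set R[i])
    (g : R[i] -> R[i]) (c : A) : A :=
  xget 0 [set x : A | exists gamma : R -> R[i], exists2 y : nspace A,
    encloses gamma G (spectrum c) /\
      is_curve_integral gamma (fun z => g z *: (z%:A - c)^-1 : nspace A) y
    & x = (two_pi_i R)^-1 *: y].

(* The order of R[i] only makes the difference y - x real and nonnegative;
   an inequality between scalars also asserts that both sides are real. *)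
Definition real_le (R : realType) (x y : R[i]) : Prop :=
  [/\ x \is Num.real, y \is Num.real & x <= y].

(* Main.v *)
Require Import Defs.
From mathcomp Require Import all_boot all_order all_algebra.
From mathcomp Require Import complex.
From mathcomp Require Import all_classical all_reals all_analysis.
From mathcomp Require Import ring lra.
Set Implicit Arguments.
Unset Strict Implicit.
Unset Printing Implicit Defensive.
Import Order.TTheory GRing.Theory Num.Theory.
Import numFieldNormedType.Exports.

Local Open Scope classical_set_scope.
Local Open Scope ring_scope.
Local Open Scope complex_scope.

(** The idea. For s and t in [m, M], Taylor's formula puts
      f s - f t - f' t (s - t)
    between k/2 (s - t)^2 and K/2 (s - t)^2. Put x0 for one of s and t, substitute c
    for the other, and apply psi. When s = x0, the linear term becomes
    x0 psi(f'(c)) - psi(c f'(c)), which is zero by the choice of x0, and the first chain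
    of inequalities results; when t = x0, the second one does. The values of f itself
    need not be real: only f'' is, and the order of R[i] takes care of the imaginary
    parts (complex_taylor_ge0).

    What has to be shown is therefore that an inequality between functions on the
    spectrum of c survives the substitution of c followed by psi. For rational
    functions of c this is spectral mapping: a selfadjoint rational function of c with
    nonnegative values on the spectrum is a nonnegative element of A (rational_pos), and
    taking selfadjoint parts gives a version for arbitrary rational functions, with an
    error term (rational_near_pos). Because A is Hermitian, psi is bounded (psi_bounded),
    so positivity passes to limits (approx_pos). Finally h(c) is such a limit
    (hol_approx): the Riemann sums of the integral of h z (z - c)^-1 are rational
    functions of c, and their symbols, the Riemann sums of the Cauchy integral of h at
    the points t of the spectrum, converge to h t uniformly in t. The value of psi on
    expressions in f(c) and f'(c) is thus controlled by the values of f and f' on the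
    spectrum, whichever enclosing curves were used to define f(c) and f'(c).

    The analytic input is Cauchy's formula for a closed rectifiable curve that winds once
    around t and does not wind around any point outside G (curve_Cauchy). It follows from
    Runge's theorem: h is a uniform limit of sums of simple fractions with poles off
    the compact set formed by the curve and the points around which it winds, and for
    a simple fraction the formula is a statement about winding numbers. Runge's
    theorem is proved with a fine grid, by cancelling the integrals along the edges
    shared by two adjacent cells. This rests on Cauchy's formula for rectangles, and that
    on Goursat's theorem, since analyticity only means differentiability here. The
    formula for rectangles also shows that f' is analytic (analytic_deriv), so that
    f'(c) and f'' are meaningful.

    An enclosing curve exists because psi(f'(c)) is not zero, the holomorphic functional
    calculus having the default value zero. *)

(** * The real-valued norm of a complex normed space *)

Section Nrm.
Context (R : realType).

(** The norm of a complex normed space takes its values in R[i]; it is always a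
    nonnegative real, and reading it in R gives access to real arithmetic. *)
Definition nrm (V : normedModType R[i]) (x : V) : R := complex.Re `|x|.

Section V.
Context (V : normedModType R[i]).
Implicit Types x y : V.

Lemma nrmE x : `|x| = (nrm x)%:C.
Proof.
rewrite /nrm; have := normr_ge0 x; case: (`|x|) => a b /=.
by rewrite lecE /= => /andP[/eqP -> _].
Qed.

Lemma nrm_lt x (e : R) : (`|x| < e%:C) = (nrm x < e).
Proof. by rewrite nrmE ltcR. Qed.

Lemma nrm_ge0 x : 0 <= nrm x.
Proof. by have := normr_ge0 x; rewrite nrmE ler0c. Qed.

Lemma nrm0 : nrm (0 : V) = 0.
Proof. by rewrite /nrm normr0. Qed.

Lemma nrmN x : nrm (- x) = nrm x.
Proof. by rewrite /nrm normrN. Qed.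

Lemma nrmC x y : nrm (x - y) = nrm (y - x).
Proof. by rewrite -nrmN opprB. Qed.

Lemma nrmD x y : nrm (x + y) <= nrm x + nrm y.
Proof. by have := ler_normD x y; rewrite !nrmE -rmorphD lecR. Qed.

Lemma nrmB x y : nrm (x - y) <= nrm x + nrm y.
Proof. by rewrite -(nrmN y) nrmD. Qed.

Lemma nrm_trans y x z : nrm (x - z) <= nrm (x - y) + nrm (y - z).
Proof. by rewrite -[x - z](subrKA y) nrmD. Qed.

Lemma nrm_subl x y : nrm x - nrm y <= nrm (x - y).
Proof. by rewrite lerBlDr -{1}(subrK y x) nrmD. Qed.

Lemma nrmZ (l : R[i]) x : nrm (l *: x) = nrm l * nrm x.
Proof.
apply: complexI; rewrite rmorphM /= -!nrmE; exact: normrZ.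
Qed.

Lemma nrm_eq0 x : nrm x = 0 -> x = 0.
Proof. by move=> h; apply/eqP; rewrite -normr_eq0 nrmE h. Qed.

Lemma nrm_gt0 x : x != 0 -> 0 < nrm x.
Proof.
by move=> x0; rewrite lt_neqAle nrm_ge0 andbT eq_sym; apply: contra x0 => /eqP/nrm_eq0 ->.
Qed.

Lemma nrm_sum (I : Type) (r : seq I) (P : pred I) (F : I -> V) :
  nrm (\sum_(i <- r | P i) F i) <= \sum_(i <- r | P i) nrm (F i).
Proof.
elim/big_ind2 : _ => //; first by rewrite nrm0.
by move=> x a y b xa yb; rewrite (le_trans (nrmD _ _)) ?lerD.
Qed.

Lemma nrm_le0 x : (forall e : R, 0 < e -> nrm x <= e) -> x = 0.
Proof.
move=> h; apply: nrm_eq0; apply/eqP; rewrite eq_le nrm_ge0 andbT.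
by apply/ler_addgt0Pr => e e0; rewrite add0r h.
Qed.

Lemma nrm_eq_eps x y : (forall e : R, 0 < e -> nrm (x - y) <= e) -> x = y.
Proof. by move=> /nrm_le0/eqP; rewrite subr_eq0 => /eqP. Qed.

Lemma nbhs_nrmP x (P : set V) :
  nbhs x P <-> exists2 e : R, 0 < e & forall y, nrm (y - x) < e -> P y.
Proof.
split.
  move=> /nbhs_ballP[e /= e0 h].
  have eE : e = (complex.Re e)%:C.
    by move: e0; case: e {h} => a b /=; rewrite ltcE /= => /andP[/eqP ->].
  exists (complex.Re e); first by move: e0; rewrite eE ltcR.
  move=> y yx; apply: h; rewrite -ball_normE /ball_ /=.
  by rewrite eE nrm_lt nrmC.
move=> [e e0 h]; apply/nbhs_ballP; exists e%:C; first by rewrite /= ltcR.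
by move=> y; rewrite -ball_normE /ball_ /= nrm_lt nrmC; exact: h.
Qed.

End V.

Lemma nrmM (x y : R[i]) : nrm (x * y) = nrm x * nrm y.
Proof. by apply: complexI; rewrite rmorphM /= -!nrmE normrM. Qed.

Lemma cnrmC (x y : R[i]) : nrm (x - y) = nrm (y - x).
Proof. exact: nrmC. Qed.

Lemma nrmV (x : R[i]) : nrm x^-1 = (nrm x)^-1.
Proof. by apply: complexI; rewrite fmorphV /= -!nrmE normfV. Qed.

Lemma nrm1 : nrm (1 : R[i]) = 1.
Proof. by apply: complexI; rewrite -!nrmE normr1. Qed.

Lemma nrm_real (x : R) : nrm (x%:C) = `|x|.
Proof. by apply: complexI; rewrite -!nrmE normc_def /= expr0n addr0 sqrtr_sqr. Qed.

Lemma nrm_i : nrm ('i : R[i]) = 1.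
Proof. by apply: complexI; rewrite -!nrmE normc_def /= expr0n add0r expr1n sqrtr1. Qed.

Lemma nrm_Re (x : R[i]) : `|complex.Re x| <= nrm x.
Proof. by rewrite -lecR -nrmE normc_ge_Re. Qed.

Lemma nrm_Im (x : R[i]) : `|complex.Im x| <= nrm x.
Proof.
have := nrm_Re (x * 'i); rewrite ReiNIm normrN => /le_trans; apply.
by rewrite nrmM nrm_i mulr1.
Qed.

Lemma nrm_ReIm (x : R[i]) : nrm x <= `|complex.Re x| + `|complex.Im x|.
Proof.
rewrite {1}[x]complexE (le_trans (nrmD _ _)) // lerD ?nrm_real //.
by rewrite nrmM nrm_i mul1r nrm_real.
Qed.

Lemma nrmX (x : R[i]) n : nrm (x ^+ n) = nrm x ^+ n.
Proof. by elim: n => [|n IH]; rewrite ?expr0 ?nrm1 // !exprS nrmM IH. Qed.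

Lemma nrm_nat n : nrm (n%:R : R[i]) = n%:R.
Proof. by rewrite -[n%:R](rmorph_nat (real_complex R)) nrm_real normr_nat. Qed.

(** Used to choose e / (c + 1) as the accuracy of a quantity that is later
    multiplied by c, which may vanish. *)
Lemma mul_div_succ_le (c e : R) : 0 < e -> 0 < c + 1 -> c * (e / (c + 1)) <= e.
Proof. by move=> e0 c1; rewrite mulrCA ger_pMr // ler_pdivrMr // mul1r lerDl. Qed.

Lemma complex_ReIm_inj (x y : R[i]) : complex.Re x = complex.Re y ->
  complex.Im x = complex.Im y -> x = y.
Proof. by case: x => a b; case: y => c d /= -> ->. Qed.

(** Both R[i] and the underlying space of the algebra have this property, so that
    one existence theorem for curve integrals covers scalar and vector integrands. *)
Definition seq_complete (V : normedModType R[i]) := forall u : nat -> V,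
  (forall e : R, 0 < e -> exists N, forall n m, (N <= n)%N -> (N <= m)%N -> nrm (u n - u m) <= e) ->
  exists l, forall e : R, 0 < e -> exists N, forall n, (N <= n)%N -> nrm (u n - l) <= e.

End Nrm.

Section Complete.
Context (R : realType).

Lemma cauchy_image (K : numFieldType) (V : pseudoMetricNormedZmodType K) (u : nat -> V) :
  (forall e : K, 0 < e ->
    exists N, forall n m, (N <= n)%N -> (N <= m)%N -> `|u n - u m| < e) ->
  cauchy (u @ \oo).
Proof.
move=> hu; apply/cauchy_ballP => e e0; have [N hN] := hu e e0.
near=> x.
rewrite -ball_normE /ball_ /=.
have [[n m] /= [nN mN] <-] : ((fun p : nat * nat => (u p.1, u p.2)) @`
   ([set n | (N <= n)%N] `*` [set n | (N <= n)%N])) x.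
  near: x; exists (u @` [set n | (N <= n)%N], u @` [set n | (N <= n)%N]).
    by split => /=; exists N => // n Nn; exists n.
  by move=> [a b] /= [[n nN <-] [m mN <-]]; exists (n, m).
exact: hN.
Unshelve. all: end_near. Qed.

Lemma nspace_seq_complete (A : banachStarAlgType R) : seq_complete (nspace A).
Proof.
move=> u hu.
have /cvg_ex[l ul] : cvg (u @ \oo).
  apply: nspace_complete; apply: cauchy_image => e e0.
  have eE : e = (complex.Re e)%:C.
    by move: e0; case: e => a b /=; rewrite ltcE /= => /andP[/eqP ->].
  have e0' : 0 < complex.Re e by move: e0; rewrite eE ltcR.
  have [N hN] := hu (complex.Re e / 2) (divr_gt0 e0' (ltr0Sn _ 1)).
  exists N => n m nN mN; rewrite eE nrm_lt.
  by apply: (le_lt_trans (hN _ _ nN mN)); rewrite ltr_pdivrMr // ltr_pMr // ltr1n.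
exists l => e e0.
have := ul _ (proj2 (nbhs_nrmP l [set y | nrm (y - l) < e]) (ex_intro2 _ _ e e0 (fun y h => h))).
by move=> [N _ hN]; exists N => n Nn; apply/ltW/(hN n).
Qed.

Lemma real_seq_complete (u : nat -> R) :
  (forall e : R, 0 < e ->
    exists N, forall n m, (N <= n)%N -> (N <= m)%N -> `|u n - u m| <= e) ->
  exists l, forall e : R, 0 < e -> exists N, forall n, (N <= n)%N -> `|u n - l| <= e.
Proof.
move=> hu.
have /cvg_ex[l ul] : cvg (u @ \oo).
  apply/cauchy_cvgP/cauchy_image => e e0.
  have [N hN] := hu (e / 2) (divr_gt0 e0 (ltr0Sn _ 1)).
  exists N => n m nN mN.
  by apply: (le_lt_trans (hN _ _ nN mN)); rewrite ltr_pdivrMr // ltr_pMr // ltr1n.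
exists l => e e0.
have /cvgrPdist_le/(_ e e0) := ul.
by move=> [N _ hN]; exists N => n Nn; rewrite distrC; apply: (hN n).
Qed.

Lemma complex_seq_complete : @seq_complete R R[i].
Proof.
move=> u hu.
have [a ha] : exists l, forall e : R, 0 < e ->
    exists N, forall n, (N <= n)%N -> `|complex.Re (u n) - l| <= e.
  apply: real_seq_complete => e /hu[N hN]; exists N => n m nN mN.
  by have := hN _ _ nN mN; apply: le_trans; rewrite -raddfB /=; exact: nrm_Re.
have [b hb] : exists l, forall e : R, 0 < e ->
    exists N, forall n, (N <= n)%N -> `|complex.Im (u n) - l| <= e.
  apply: real_seq_complete => e /hu[N hN]; exists N => n m nN mN.
  by have := hN _ _ nN mN; apply: le_trans; rewrite -raddfB /=; exact: nrm_Im.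
exists (a +i* b) => e e0.
have e2 : 0 < e / 2 by rewrite divr_gt0.
have [N1 h1] := ha _ e2; have [N2 h2] := hb _ e2.
exists (maxn N1 N2) => n; rewrite geq_max => /andP[n1 n2].
rewrite (le_trans (nrm_ReIm _)) // [leRHS](splitr e) lerD //.
  by have := h1 _ n1; case: (u n).
by have := h2 _ n2; case: (u n).
Qed.

End Complete.

Section Compact.
Context (R : realType).

(** The form in which compactness is used: a radius d that can be chosen near each
    point of a compact set can be chosen uniformly, provided that smaller radii are
    also admissible. *)
Lemma compact_uniform (T : topologicalType) (K : set T) (U : R -> T -> Prop) :
  compact K -> (forall d d' y, d' <= d -> U d y -> U d' y) ->
  (forall x, K x -> exists2 d : R, 0 < d & nbhs x (U d)) ->
  exists2 d : R, 0 < d & forall y, K y -> U d y.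
Proof.
move=> /compact_near_coveringP cK Umono hU.
suff : \forall d \near (0 : R)^'+, K `<=` U d.
  move=> [e /= e0 h]; exists (e / 2); first by rewrite divr_gt0.
  apply: h => /=; last by rewrite divr_gt0.
  by rewrite sub0r normrN gtr0_norm ?divr_gt0 // ltr_pdivrMr // ltr_pMr // ltr1n.
apply: cK => x /hU[d d0 hd]; exists (U d, [set d' | d' <= d]).
  split => //=; exists d => //= d'; rewrite /ball_ /= sub0r normrN => /ltW h _.
  by rewrite (le_trans (ler_norm _)).
by move=> [y d'] /= [Uy dd']; apply: Umono Uy.
Qed.

Definition unif_cont01 (V : normedModType R[i]) (G : R -> V) :=
  forall e : R, 0 < e -> exists2 d : R, 0 < d &
    forall x y, 0 <= x <= 1 -> 0 <= y <= 1 -> `|x - y| < d -> nrm (G x - G y) <= e.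

Lemma unif_cont01P (V : normedModType R[i]) (G : R -> V) :
  (forall x, 0 <= x <= 1 -> forall e : R, 0 < e -> exists2 d : R, 0 < d &
    forall y, 0 <= y <= 1 -> `|y - x| < d -> nrm (G y - G x) <= e) ->
  unif_cont01 G.
Proof.
move=> hG e e0.
suff [d d0 hd] : exists2 d : R, 0 < d & forall y, `[0, 1]%classic y ->
    0 <= y <= 1 -> forall x, 0 <= x <= 1 -> `|x - y| < d -> nrm (G x - G y) <= e.
  by exists d => // x y x01 y01; apply: (hd y _ y01 x x01); rewrite /= in_itv.
apply: compact_uniform; first exact: segment_compact.
  by move=> d d' y dd' h y01 x x01 xy; exact: h y01 x x01 (lt_le_trans xy dd').
move=> x /=; rewrite in_itv /= => x01.
have [d d0 hd] := hG x x01 (e / 2) (divr_gt0 e0 (ltr0Sn _ 1)).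
exists (d / 2); first by rewrite divr_gt0.
apply/nbhs_ballP; exists (d / 2); first by rewrite /= divr_gt0.
move=> y; rewrite -ball_normE /ball_ /= => xy y01 z z01 zy.
rewrite (le_trans (nrm_trans (G x) _ _)) // [leRHS]splitr lerD //.
  apply: hd => //; rewrite (le_lt_trans (ler_distD y _ _)) // [ltRHS]splitr ltrD //.
  by rewrite distrC.
rewrite nrmC; apply: hd => //; rewrite distrC (lt_le_trans xy) // ler_pdivrMr //.
by rewrite ler_pMr // ler1n.
Qed.
End Compact.

(** * Riemann-Stieltjes sums along a curve of finite length *)

Section RS.
Context (R : realType) (gamma : R -> R[i]).

(** A curve is rectifiable when some real function W dominates it in this sense
    (for instance its variation on [0, t]). Estimates of Riemann sums then telescope
    into W 1 - W 0. *)
Definition dominates (W : R -> R) := forall a b, 0 <= a -> a <= b -> b <= 1 ->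
  nrm (gamma b - gamma a) <= W b - W a.

Section Compare.
Context (W : R -> R) (hW : dominates W).
Context (V : normedModType R[i]) (G : R -> V).

Definition subdivision (n : nat) (p : nat -> R) :=
  [/\ p 0%N = 0, p n = 1 & forall i, (i < n)%N -> p i <= p i.+1].

Definition rs_sum (n : nat) (p tau : nat -> R) : V :=
  \sum_(0 <= i < n) (gamma (p i.+1) - gamma (p i)) *: G (tau i).

Lemma subdivision_ge0 n p : subdivision n p -> forall i, (i <= n)%N -> 0 <= p i.
Proof.
move=> [p0 pn hp]; elim => [|i IH] lin; first by rewrite p0.
by rewrite (le_trans (IH (ltnW lin))) // hp.
Qed.

Lemma subdivision_le1 n p : subdivision n p -> forall i, (i <= n)%N -> p i <= 1.
Proof.
move=> [p0 pn hp] i lin.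
have H k : (i + k <= n)%N -> p i <= p (i + k)%N.
  elim: k => [|k IH] h; first by rewrite addn0.
  have h' : (i + k < n)%N by rewrite addnS in h.
  by rewrite addnS (le_trans (IH (ltnW h'))) // hp.
by rewrite -pn -[n](subnKC lin) H // subnKC.
Qed.

(** For two intervals [a, b] and [c, d] the second difference of gamma (min . .) is
    the increment of gamma over their intersection, and it vanishes when they are
    disjoint. *)
Lemma overlap_bound (a b c d : R) (x y : V) (e : R) : 0 <= e ->
  0 <= a -> a <= b -> b <= 1 -> 0 <= c -> c <= d -> d <= 1 ->
  (a <= d -> c <= b -> nrm (x - y) <= e) ->
  nrm ((gamma (Num.min b d) - gamma (Num.min b c) - (gamma (Num.min a d) - gamma (Num.min a c)))
     *: (x - y)) <=
  (W (Num.min b d) - W (Num.min b c) - (W (Num.min a d) - W (Num.min a c))) * e.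
Proof.
move=> e0 a0 ab b1 c0 cd d1 hxy; rewrite nrmZ.
case: (leP b c) => bc.
  rewrite (min_l (le_trans bc cd)) (min_l (le_trans ab bc)) (min_l (le_trans (le_trans ab bc) cd)).
  by rewrite !subrr nrm0 !mul0r.
case: (leP d a) => da.
  rewrite (min_r (le_trans da ab)) (min_r (le_trans cd da)).
  by rewrite !subrr nrm0 !mul0r.
apply: ler_pM; rewrite ?nrm_ge0 //; last by apply: hxy; exact: ltW.
have -> : gamma (Num.min b d) - gamma c - (gamma a - gamma (Num.min a c)) =
     gamma (Num.min b d) - gamma (Num.max a c).
  by case: (leP a c) => _; ring.
have -> : W (Num.min b d) - W c - (W a - W (Num.min a c)) =
     W (Num.min b d) - W (Num.max a c).
  by case: (leP a c) => _; ring.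
apply: hW.
- by rewrite le_max a0.
- by rewrite ge_max !le_min ab cd (ltW bc) (ltW da).
- by rewrite ge_min b1.
Qed.

(** Both sums are split along the common refinement of the two subdivisions. The
    increment over the cell (i, j) is a second difference of gamma (min . .), so that
    summing over i or over j telescopes and no refinement has to be constructed; only
    cells whose tags are close contribute. *)
Lemma rs_sum_compare n p tau m q sig (d1 d2 d e : R) :
  subdivision n p -> subdivision m q -> d1 + d2 <= d -> 0 <= e ->
  (forall i, (i < n)%N -> [/\ p i <= tau i, tau i <= p i.+1 & p i.+1 - p i <= d1]) ->
  (forall i, (i < m)%N -> [/\ q i <= sig i, sig i <= q i.+1 & q i.+1 - q i < d2]) ->
  (forall x y, 0 <= x <= 1 -> 0 <= y <= 1 -> `|x - y| < d -> nrm (G x - G y) <= e) ->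
  nrm (rs_sum n p tau - rs_sum m q sig) <= (W 1 - W 0) * e.
Proof.
move=> hp hq dd e0 htau hsig hG.
pose D (U : comNzRingType) (g : R -> U) i j :=
  (g (Num.min (p i.+1) (q j.+1)) - g (Num.min (p i.+1) (q j))) -
  (g (Num.min (p i) (q j.+1)) - g (Num.min (p i) (q j))).
have [p0 pn pS] := hp; have [q0 qm qS] := hq.
have Di (U : comNzRingType) (g : R -> U) i : (i < n)%N ->
    \sum_(0 <= j < m) D U g i j = g (p i.+1) - g (p i).
  move=> lin; rewrite /D sumrB !telescope_sumr // qm q0.
  rewrite (min_l (subdivision_le1 hp lin)) (min_r (subdivision_ge0 hp lin)).
  rewrite (min_l (subdivision_le1 hp (ltnW lin))) (min_r (subdivision_ge0 hp (ltnW lin))).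
  by ring.
have Dj (U : comNzRingType) (g : R -> U) j : (j < m)%N ->
    \sum_(0 <= i < n) D U g i j = g (q j.+1) - g (q j).
  move=> ljm.
  rewrite (eq_bigr (fun i => (g (Num.min (p i.+1) (q j.+1)) - g (Num.min (p i) (q j.+1)))
     - (g (Num.min (p i.+1) (q j)) - g (Num.min (p i) (q j))))); last first.
    by move=> i _; rewrite /D; ring.
  rewrite sumrB (telescope_sumr (fun i => g (Num.min (p i) (q j.+1)))) //.
  rewrite (telescope_sumr (fun i => g (Num.min (p i) (q j)))) // pn p0.
  rewrite (min_r (subdivision_le1 hq ljm)) (min_l (subdivision_ge0 hq ljm)).
  rewrite (min_r (subdivision_le1 hq (ltnW ljm))) (min_l (subdivision_ge0 hq (ltnW ljm))).
  by ring.
have -> : rs_sum n p tau = \sum_(0 <= i < n) \sum_(0 <= j < m) D _ gamma i j *: G (tau i).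
  by apply: eq_big_nat => i /andP[_ lin]; rewrite -scaler_suml Di.
have -> : rs_sum m q sig = \sum_(0 <= i < n) \sum_(0 <= j < m) D _ gamma i j *: G (sig j).
  rewrite exchange_big /=.
  by apply: eq_big_nat => i /andP[_ lin]; rewrite -scaler_suml Dj.
rewrite -sumrB; apply: (le_trans (nrm_sum _ _ _)).
have -> : (W 1 - W 0) * e = \sum_(0 <= i < n) \sum_(0 <= j < m) D _ W i j * e.
  transitivity (\sum_(0 <= i < n) (W (p i.+1) - W (p i)) * e).
    by rewrite -mulr_suml telescope_sumr // pn p0.
  by apply: eq_big_nat => i /andP[_ lin]; rewrite -mulr_suml Di.
rewrite big_nat [leRHS]big_nat; apply: ler_sum => i /andP[_ lin].
rewrite -sumrB; apply: (le_trans (nrm_sum _ _ _)).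
rewrite big_nat [leRHS]big_nat; apply: ler_sum => j /andP[_ ljm].
rewrite -scalerBr; apply: overlap_bound => //.
- exact: (subdivision_ge0 hp (ltnW lin)).
- exact: pS.
- exact: (subdivision_le1 hp lin).
- exact: (subdivision_ge0 hq (ltnW ljm)).
- exact: qS.
- exact: (subdivision_le1 hq ljm).
have [t1 t2 t3] := htau _ lin; have [s1 s2 s3] := hsig _ ljm.
have b1 := subdivision_ge0 hp (ltnW lin); have b2 := subdivision_le1 hp lin.
have b3 := subdivision_ge0 hq (ltnW ljm); have b4 := subdivision_le1 hq ljm.
move=> h1 h2; apply: hG.
- by apply/andP; split; lra.
- by apply/andP; split; lra.
- by rewrite ltr_norml; apply/andP; split; lra.
Qed.

Lemma rs_sum_bound n p tau (B : R) : subdivision n p -> 0 <= B ->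
  (forall i, (i < n)%N -> p i <= tau i <= p i.+1) ->
  (forall t, 0 <= t <= 1 -> nrm (G t) <= B) ->
  nrm (rs_sum n p tau) <= (W 1 - W 0) * B.
Proof.
move=> hp B0 htau hG; have [p0 pn pS] := hp.
apply: (le_trans (nrm_sum _ _ _)).
have -> : (W 1 - W 0) * B = \sum_(0 <= i < n) (W (p i.+1) - W (p i)) * B.
  by rewrite -mulr_suml telescope_sumr // pn p0.
rewrite big_nat [leRHS]big_nat; apply: ler_sum => i /andP[_ lin].
have b1 := subdivision_ge0 hp (ltnW lin); have b2 := subdivision_le1 hp lin.
have /andP[t1 t2] := htau _ lin.
rewrite nrmZ ler_pM ?nrm_ge0 // ?hG ?(le_trans b1 t1) ?(le_trans t2 b2) //.
by apply: hW => //; exact: pS.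
Qed.

End Compare.
End RS.

Section CurveIntegral.
Context (R : realType).
Implicit Types (gamma W : R -> R) (s : seq R).

Lemma subdivision_pt s : itv_partition 0 1 s ->
  subdivision (size s) (subdiv_pt s).
Proof.
move=> [hp hl]; split=> //.
  by rewrite /subdiv_pt -[size s]/(size (0 :: s)).-1 nth_last; exact/eqP.
move=> i lis; rewrite /subdiv_pt /= ltW //.
by have /(pathP 1) := hp; apply.
Qed.

Definition unif_part (n : nat) : seq R := mkseq (fun i => i.+1%:R / n.+1%:R) n.+1.

Lemma subdiv_unif n i : (i <= n.+1)%N -> subdiv_pt (unif_part n) i = i%:R / n.+1%:R.
Proof.
case: i => [|i] lin; first by rewrite /subdiv_pt /= mul0r.
by rewrite /subdiv_pt /= nth_mkseq.
Qed.

Lemma size_unif n : size (unif_part n) = n.+1.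
Proof. exact: size_mkseq. Qed.

Lemma itv_partition_unif n : itv_partition 0 1 (unif_part n).
Proof.
split.
  apply/(pathP 1) => i; rewrite size_unif => lin.
  have := @subdiv_unif n i (ltnW lin); have := @subdiv_unif n i.+1 lin.
  rewrite /subdiv_pt /= => -> ->.
  by rewrite ltr_pM2r ?invr_gt0 // ltr_nat.
have -> : last 0 (unif_part n) = subdiv_pt (unif_part n) n.+1.
  by rewrite /subdiv_pt (last_nth 1) size_unif.
by rewrite subdiv_unif // divff ?pnatr_eq0.
Qed.

Lemma archi_inv (d : R) : 0 < d -> exists N, forall n, (N <= n)%N -> n.+1%:R^-1 < d.
Proof.
move=> d0; exists (Num.bound d^-1) => n hn.
rewrite invf_plt ?posrE //; apply: (lt_le_trans (archi_boundP _)).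
  by rewrite invr_ge0 ltW.
by rewrite ler_nat (leq_trans hn).
Qed.

Lemma unif_step n i : (i < n.+1)%N ->
  subdiv_pt (unif_part n) i.+1 - subdiv_pt (unif_part n) i = n.+1%:R^-1.
Proof.
move=> lin; rewrite !subdiv_unif // ?(ltnW lin) //.
by rewrite -mulrBl -natr1 addrAC subrr add0r mul1r.
Qed.

Lemma unif_fine n (d : R) : n.+1%:R^-1 < d -> forall i, (i < size (unif_part n))%N ->
  [/\ subdiv_pt (unif_part n) i <= subdiv_pt (unif_part n) i,
      subdiv_pt (unif_part n) i <= subdiv_pt (unif_part n) i.+1 &
      subdiv_pt (unif_part n) i.+1 - subdiv_pt (unif_part n) i < d].
Proof.
move=> nd i; rewrite size_unif => lin; rewrite unif_step //; split => //.
by have [_ _ /(_ i)] := subdivision_pt (itv_partition_unif n); apply; rewrite size_unif.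
Qed.

Context (gamma : R -> R[i]).
Implicit Types V : normedModType R[i].

Lemma curve_integral_unique V (F : R[i] -> V) x y :
  is_curve_integral gamma F x -> is_curve_integral gamma F y -> x = y.
Proof.
move=> hx hy; apply: nrm_eq_eps => e e0.
have e2 : 0 < e / 2 by rewrite divr_gt0.
have [d1 d10 h1] := hx _ e2; have [d2 d20 h2] := hy _ e2.
have [N hN] : exists N, forall n, (N <= n)%N -> n.+1%:R^-1 < Num.min d1 d2.
  by apply: archi_inv; rewrite lt_min d10.
have := hN N (leqnn _); rewrite lt_min => /andP[n1 n2].
have := h1 _ _ (itv_partition_unif N) (unif_fine n1).
have := h2 _ _ (itv_partition_unif N) (unif_fine n2).
set S := \sum_(_ <= _ < _) _; rewrite !nrm_lt nrmC => b a.
apply: (le_trans (nrm_trans S _ _)); rewrite [leRHS]splitr; apply: lerD; first exact: ltW.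
by rewrite nrmC ltW.
Qed.

Lemma curve_integralD V (F G : R[i] -> V) x y :
  is_curve_integral gamma F x -> is_curve_integral gamma G y ->
  is_curve_integral gamma (fun z => F z + G z) (x + y).
Proof.
move=> hx hy e e0.
have e2 : 0 < e / 2 by rewrite divr_gt0.
have [d1 d10 h1] := hx _ e2; have [d2 d20 h2] := hy _ e2.
exists (Num.min d1 d2); first by rewrite lt_min d10.
move=> s tau hs ht.
have t1 i : (i < size s)%N -> [/\ subdiv_pt s i <= tau i, tau i <= subdiv_pt s i.+1
           & subdiv_pt s i.+1 - subdiv_pt s i < d1].
  by move=> /ht[a b]; rewrite lt_min => /andP[c _].
have t2 i : (i < size s)%N -> [/\ subdiv_pt s i <= tau i, tau i <= subdiv_pt s i.+1
           & subdiv_pt s i.+1 - subdiv_pt s i < d2].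
  by move=> /ht[a b]; rewrite lt_min => /andP[_ c].
have := h1 _ _ hs t1; have := h2 _ _ hs t2; rewrite !nrm_lt => a b.
under eq_bigr do rewrite scalerDr.
rewrite big_split /= opprD addrACA (le_lt_trans (nrmD _ _)) // [ltRHS]splitr ltrD //.
Qed.

Lemma curve_integralZ V (F : R[i] -> V) x c :
  is_curve_integral gamma F x ->
  is_curve_integral gamma (fun z => c *: F z) (c *: x).
Proof.
move=> hx e e0.
have c1 : 0 < nrm c + 1 by rewrite ltr_wpDl // nrm_ge0.
have [d d0 h] := hx _ (divr_gt0 e0 c1).
exists d => // s tau hs ht; have := h _ _ hs ht; rewrite !nrm_lt => a.
under eq_bigr do rewrite scalerA mulrC -scalerA.
rewrite -scaler_sumr -scalerBr nrmZ.
apply: (@le_lt_trans _ _ (nrm c * (e / (nrm c + 1)))).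
  by apply: ler_wpM2l; rewrite ?nrm_ge0 // ltW.
rewrite mulrA ltr_pdivrMr // mulrC ltr_pM2l //.
by rewrite ltrDl.
Qed.

Lemma curve_integral0 V : is_curve_integral gamma (fun=> 0 : V) 0.
Proof.
move=> e e0; exists 1 => // s tau _ _; rewrite nrm_lt.
by under eq_bigr do rewrite scaler0; rewrite big1 // subrr nrm0.
Qed.

Lemma tag01 s (tau : nat -> R) (d : R) : itv_partition 0 1 s ->
  (forall i, (i < size s)%N -> [/\ subdiv_pt s i <= tau i, tau i <= subdiv_pt s i.+1
           & subdiv_pt s i.+1 - subdiv_pt s i < d]) ->
  forall i, (i < size s)%N -> 0 <= tau i <= 1.
Proof.
move=> hs ht i lis; have [a b c] := ht i lis.
have hp := subdivision_pt hs.
by rewrite (le_trans (subdivision_ge0 hp (ltnW lis)) a) (le_trans b (subdivision_le1 hp lis)).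
Qed.

Lemma curve_integral_ext V (F G : R[i] -> V) x :
  (forall t, 0 <= t <= 1 -> F (gamma t) = G (gamma t)) ->
  is_curve_integral gamma F x -> is_curve_integral gamma G x.
Proof.
move=> FG hx e e0; have [d d0 h] := hx e e0.
exists d => // s tau hs ht; have := h _ _ hs ht.
congr (`|x - _| < _); apply: eq_big_nat => i /andP[_ lis].
by rewrite FG // (tag01 hs ht).
Qed.

Section Dom.
Context (W : R -> R) (hW : dominates gamma W).

Lemma dominates_ge0 : 0 <= W 1 - W 0.
Proof. by apply: le_trans (hW _ _ _); rewrite ?nrm_ge0 ?ler01. Qed.

Lemma curve_integral_bound V (F : R[i] -> V) x (B : R) : 0 <= B ->
  is_curve_integral gamma F x ->
  (forall t, 0 <= t <= 1 -> nrm (F (gamma t)) <= B) -> nrm x <= (W 1 - W 0) * B.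
Proof.
move=> B0 hx hF; apply/ler_addgt0Pr => e e0.
have [d d0 h] := hx _ e0.
have [N hN] := archi_inv d0; have n1 := hN N (leqnn _).
have := h _ _ (itv_partition_unif N) (unif_fine n1).
set S := \sum_(_ <= _ < _) _; rewrite nrm_lt => xS.
have SE : nrm S <= (W 1 - W 0) * B.
  apply: (rs_sum_bound (G := F \o gamma) hW (subdivision_pt (itv_partition_unif N))) => //.
  by move=> i /(unif_fine n1)[-> ->].
by rewrite -[x](subrK S) (le_trans (nrmD _ _)) // addrC lerD // ltW.
Qed.

(** The Riemann sums over the uniform subdivisions form a Cauchy sequence by
    rs_sum_compare, and every fine tagged sum is close to them. *)
Lemma curve_integral_exists V (F : R[i] -> V) : seq_complete V ->
  unif_cont01 (F \o gamma) -> exists x, is_curve_integral gamma F x.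
Proof.
move=> cV cF.
pose S n := rs_sum gamma (F \o gamma) (size (unif_part n)) (subdiv_pt (unif_part n)) (subdiv_pt (unif_part n)).
have W0 := dominates_ge0.
have K0 : 0 < W 1 - W 0 + 1 by rewrite ltr_wpDl.
(* tags of a fine sum and of a fine uniform sum that share a point are close, and
   there the integrand varies little *)
have cmp (e : R) : 0 < e -> exists2 d : R, 0 < d & forall n s tau, n.+1%:R^-1 < d ->
   itv_partition 0 1 s ->
      (forall i, (i < size s)%N ->
         [/\ subdiv_pt s i <= tau i, tau i <= subdiv_pt s i.+1
           & subdiv_pt s i.+1 - subdiv_pt s i < d]) ->
   nrm (S n - rs_sum gamma (F \o gamma) (size s) (subdiv_pt s) tau) <= e.
  move=> e0.
  have [d d0 hd] := cF (e / (W 1 - W 0 + 1)) (divr_gt0 e0 K0).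
  exists (d / 2); first by rewrite divr_gt0.
  move=> n s tau nd hs ht.
  apply: (@le_trans _ _ ((W 1 - W 0) * (e / (W 1 - W 0 + 1)))); last first.
    rewrite mulrCA ger_pMr // ler_pdivrMr // mul1r; lra.
  apply: (@rs_sum_compare _ _ _ hW _ _ _ _ _ _ _ _ (d / 2) (d / 2) d
    _ (subdivision_pt (itv_partition_unif n)) (subdivision_pt hs) _ _ _ ht hd).
  - by rewrite -splitr.
  - by rewrite divr_ge0 ?ltW.
  - by move=> i /(unif_fine nd)[-> -> /ltW ->].
have [x hx] : exists l, forall e : R, 0 < e -> exists N, forall n, (N <= n)%N -> nrm (S n - l) <= e.
  apply: cV => e /cmp[d d0 hd]; have [N hN] := archi_inv d0.
  exists N => n m /hN nN /hN mN.
  exact: (hd n _ _ nN (itv_partition_unif m) (unif_fine mN)).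
exists x => e e0.
have e4 : 0 < e / 4 by rewrite divr_gt0.
have [d d0 hd] := cmp _ e4.
exists d => // s tau hs ht; rewrite nrm_lt.
have [N hN] := archi_inv d0; have [M hM] := hx _ e4.
have := hd (maxn N M) _ _ (hN _ (leq_maxl _ _)) hs ht.
have := hM (maxn N M) (leq_maxr _ _).
rewrite /rs_sum /=; set T := \sum_(_ <= _ < _) _ => a b.
rewrite (le_lt_trans (nrm_trans (S (maxn N M)) _ _)) // nrmC.
by rewrite (le_lt_trans (lerD a b)) //; lra.
Qed.

End Dom.

(** The sum of the variations of the real and imaginary parts on [0, t] dominates
    the curve. *)
Lemma rectifiable_dominates : rectifiable gamma -> exists W, dominates gamma W.
Proof.
move=> [L hL].
have BV (f : R -> R) : (forall a b, `|f a - f b| <= nrm (gamma a - gamma b)) -> 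
    exists W : R -> R, forall a b, 0 <= a -> a <= b -> b <= 1 -> `|f b - f a| <= W b - W a.
  move=> hf.
  have bv : bounded_variation 0 1 f.
    exists L => _ [s hs <-].
    have := hL s hs; under eq_bigr do rewrite nrmE.
    rewrite -raddf_sum /= lecR; apply: le_trans.
    rewrite /variation [leLHS]big_nat [leRHS]big_nat; apply: ler_sum => i /andP[_ lis].
    exact: hf.
  exists (fun t => fine (total_variation 0 t f)) => a b a0 ab b1.
  have a1 := le_trans ab b1; have b0 := le_trans a0 ab.
  have := total_variationD f a0 ab.
  have /fineK <- : total_variation 0 a f \is a fin_num.
    by apply/bounded_variationP => //; exact: bounded_variationl a0 a1 bv.
  have /fineK <- : total_variation 0 b f \is a fin_num.
    by apply/bounded_variationP => //; exact: bounded_variationl b0 b1 bv.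
  have := total_variation_ge f ab.
  have /fineK <- : total_variation a b f \is a fin_num.
    apply/bounded_variationP => //.
    exact: bounded_variationr a0 ab (bounded_variationl b0 b1 bv).
  by rewrite /= lee_fin -EFinD => h [] ->; rewrite addrAC subrr add0r.
have [W1 h1] : exists W : R -> R, forall a b, 0 <= a -> a <= b -> b <= 1 ->
    `|complex.Re (gamma b) - complex.Re (gamma a)| <= W b - W a.
  by apply: BV => a b; rewrite -raddfB nrm_Re.
have [W2 h2] : exists W : R -> R, forall a b, 0 <= a -> a <= b -> b <= 1 ->
    `|complex.Im (gamma b) - complex.Im (gamma a)| <= W b - W a.
  by apply: BV => a b; rewrite -raddfB nrm_Im.
exists (fun t => W1 t + W2 t) => a b a0 ab b1.
rewrite (le_trans (nrm_ReIm _)) // !raddfB /=.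
by have := h1 _ _ a0 ab b1; have := h2 _ _ a0 ab b1; lra.
Qed.

End CurveIntegral.

(** * Integrals of complex functions of a real variable *)

Section Cint.
Context (R : realType).
Notation mu := (@lebesgue_measure R).
Implicit Types (u v : R -> R[i]) (a b c : R).

Definition cint u a b : R[i] :=
  (\int[mu]_(x in `[a, b]) complex.Re (u x)) +i*
  (\int[mu]_(x in `[a, b]) complex.Im (u x)).

(** Continuity at the points of [a, b], in the two-sided sense: the integrands below
    are restrictions of functions continuous near the path. *)
Definition cont_on u a b := forall x, a <= x <= b -> forall e : R, 0 < e ->
  exists2 d : R, 0 < d & forall y, `|y - x| < d -> nrm (u y - u x) <= e.

Lemma cont_onS u a b c d : a <= c -> d <= b -> cont_on u a b -> cont_on u c d.
Proof.
by move=> ac db h x /andP[cx xd]; apply: h; rewrite (le_trans ac cx) (le_trans xd db).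
Qed.

Let integrable_real (f : R -> R) u a b : (forall x y, `|f x - f y| <= nrm (u x - u y)) ->
  cont_on u a b -> mu.-integrable `[a, b] (EFin \o f).
Proof.
move=> fu h; apply: continuous_compact_integrable; first exact: segment_compact.
apply: continuous_in_subspaceT => x; rewrite inE /= in_itv /= => xab.
apply/cvgrPdist_le => e e0; have [d d0 hd] := h x xab e e0.
near=> y; rewrite distrC; apply: le_trans (fu _ _) (hd _ _).
rewrite distrC; near: y; apply/nbhs_ballP; exists d => // z; rewrite -ball_normE.
Unshelve. all: end_near. Qed.

Lemma integrable_Re u a b : cont_on u a b ->
  mu.-integrable `[a, b] (EFin \o (fun x => complex.Re (u x))).
Proof. by apply: integrable_real => x y; rewrite -raddfB nrm_Re. Qed.

Lemma integrable_Im u a b : cont_on u a b ->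
  mu.-integrable `[a, b] (EFin \o (fun x => complex.Im (u x))).
Proof. by apply: integrable_real => x y; rewrite -raddfB nrm_Im. Qed.

Let Rint_cat (f : R -> R) a b c : a <= b -> b <= c ->
  mu.-integrable `[a, c] (EFin \o f) ->
  \int[mu]_(x in `[a, c]) f x = \int[mu]_(x in `[a, b]) f x + \int[mu]_(x in `[b, c]) f x.
Proof.
move=> ab bc hf.
have := @Rintegral_itvB R f (BLeft a) (BRight c) b hf; rewrite !bnd_simp => /(_ ab bc).
rewrite Rintegral_itv_obnd_cbnd; first by move=> <-; ring.
apply: integrableS hf => //; apply: subset_itvr; rewrite bnd_simp //.
Qed.

Lemma cint_cat u a b c : a <= b -> b <= c -> cont_on u a c ->
  cint u a c = cint u a b + cint u b c.
Proof.
move=> ab bc h; rewrite /cint (Rint_cat ab bc (integrable_Re h)).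
by rewrite (Rint_cat ab bc (integrable_Im h)).
Qed.

Lemma cintxx u a : cint u a a = 0.
Proof. by rewrite /cint set_itv1 !Rintegral_set1. Qed.

Lemma cint_ext u v a b : (forall x, a <= x <= b -> u x = v x) ->
  cint u a b = cint v a b.
Proof.
move=> h; rewrite /cint; congr (_ +i* _); apply: eq_Rintegral => x;
  by rewrite inE /= in_itv /= => /h ->.
Qed.

Lemma cintD u v a b : cont_on u a b -> cont_on v a b ->
  cint (fun x => u x + v x) a b = cint u a b + cint v a b.
Proof.
move=> hu hv; rewrite /cint.
under eq_Rintegral do rewrite raddfD.
rewrite RintegralD //; [|exact: integrable_Re|exact: integrable_Re].
under [X in _ +i* X = _]eq_Rintegral do rewrite raddfD.
by rewrite RintegralD //; exact: integrable_Im.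
Qed.

Lemma cintZ (k : R[i]) u a b : cont_on u a b ->
  cint (fun x => k * u x) a b = k * cint u a b.
Proof.
move=> hu; have hR := integrable_Re hu; have hI := integrable_Im hu.
rewrite /cint; case: k => k l.
have E1 x : complex.Re ((k +i* l) * u x) = k * complex.Re (u x) - l * complex.Im (u x).
  by case: (u x).
have E2 x : complex.Im ((k +i* l) * u x) = k * complex.Im (u x) + l * complex.Re (u x).
  by case: (u x).
under eq_Rintegral do rewrite E1.
under [X in _ +i* X = _]eq_Rintegral do rewrite E2.
have Z (f : R -> R) c : mu.-integrable `[a, b] (EFin \o f) ->
   mu.-integrable `[a, b] (EFin \o (fun x => c * f x)).
  move=> hf; have := @integrableZl _ _ _ mu `[a, b] (measurable_itv _) c _ hf.
  by apply: eq_integrable => // x _; rewrite /= EFinM.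
rewrite RintegralB ?RintegralD ?RintegralZl //; try exact: Z.
Qed.

Lemma cont_onZ (k : R[i]) u a b : cont_on u a b -> cont_on (fun x => k * u x) a b.
Proof.
move=> h x xab e e0.
have c1 : 0 < nrm k + 1 by rewrite ltr_wpDl // nrm_ge0.
have [d d0 hd] := h x xab _ (divr_gt0 e0 c1).
exists d => // y /hd; rewrite -mulrBr nrmM => hy.
apply: (@le_trans _ _ (nrm k * (e / (nrm k + 1)))).
  by apply: ler_wpM2l; rewrite ?nrm_ge0.
by rewrite mulrA ler_pdivrMr // mulrC ler_pM2l // lerDl.
Qed.

Lemma cont_onD u v a b : cont_on u a b -> cont_on v a b -> cont_on (fun x => u x + v x) a b.
Proof.
move=> hu hv x xab e e0.
have e2 : 0 < e / 2 by rewrite divr_gt0.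
have [d1 d10 h1] := hu x xab _ e2; have [d2 d20 h2] := hv x xab _ e2.
exists (Num.min d1 d2); first by rewrite lt_min d10.
move=> y; rewrite lt_min => /andP[/h1 a1 /h2 a2].
by rewrite opprD addrACA (le_trans (nrmD _ _)) // [leRHS]splitr lerD.
Qed.

Let Rint_le (f : R -> R) a b (B : R) : a <= b -> mu.-integrable `[a, b] (EFin \o f) ->
  (forall x, a <= x <= b -> f x <= B) -> \int[mu]_(x in `[a, b]) f x <= B * (b - a).
Proof.
move=> ab hf hB.
have -> : B * (b - a) = \int[mu]_(x in `[a, b]) B.
  by rewrite Rintegral_cst //= lebesgue_measure_itv /= lte_fin;
   case: ltgtP ab => // -> _; rewrite subrr.
apply: le_Rintegral => //.
  apply: continuous_compact_integrable; first exact: segment_compact.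
  by apply: continuous_subspaceT => x; exact: cvg_cst.
Qed.

Let Rint_ge (f : R -> R) a b (B : R) : a <= b -> mu.-integrable `[a, b] (EFin \o f) ->
  (forall x, a <= x <= b -> B <= f x) -> B * (b - a) <= \int[mu]_(x in `[a, b]) f x.
Proof.
move=> ab hf hB.
have -> : B * (b - a) = \int[mu]_(x in `[a, b]) B.
  by rewrite Rintegral_cst //= lebesgue_measure_itv /= lte_fin;
   case: ltgtP ab => // -> _; rewrite subrr.
apply: le_Rintegral => //.
  apply: continuous_compact_integrable; first exact: segment_compact.
  by apply: continuous_subspaceT => x; exact: cvg_cst.
Qed.

Lemma cint_Re_ge u a b (B : R) : a <= b -> cont_on u a b ->
  (forall x, a <= x <= b -> B <= complex.Re (u x)) -> B * (b - a) <= complex.Re (cint u a b).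
Proof. by move=> ab /integrable_Re hu; exact: Rint_ge. Qed.

Lemma cint_Im_ge u a b (B : R) : a <= b -> cont_on u a b ->
  (forall x, a <= x <= b -> B <= complex.Im (u x)) -> B * (b - a) <= complex.Im (cint u a b).
Proof. by move=> ab /integrable_Im hu; exact: Rint_ge. Qed.

(** The factor 2 comes from bounding the real and imaginary parts separately; no
    estimate below is sensitive to constants. *)
Lemma cint_bound u a b (B : R) : a <= b -> cont_on u a b ->
  (forall x, a <= x <= b -> nrm (u x) <= B) -> nrm (cint u a b) <= 2 * B * (b - a).
Proof.
move=> ab hu hB.
have hr x : a <= x <= b -> - B <= complex.Re (u x) <= B.
  by move=> /hB h; rewrite -ler_norml (le_trans (nrm_Re _)).
have hi x : a <= x <= b -> - B <= complex.Im (u x) <= B.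
  by move=> /hB h; rewrite -ler_norml (le_trans (nrm_Im _)).
have hR := integrable_Re hu; have hI := integrable_Im hu.
rewrite (le_trans (nrm_ReIm _)) //=.
rewrite -mulrA (_ : 2 * (B * (b - a)) = B * (b - a) + B * (b - a)); last ring.
apply: lerD; rewrite ler_norml -mulNr; apply/andP; split.
- by apply: Rint_ge => // x /hr /andP[].
- by apply: Rint_le => // x /hr /andP[].
- by apply: Rint_ge => // x /hi /andP[].
- by apply: Rint_le => // x /hi /andP[].
Qed.

Definition rdiff (U : R -> R[i]) x (l : R[i]) := forall e : R, 0 < e ->
  exists2 d : R, 0 < d & forall h : R, `|h| < d -> nrm (U (x + h) - U x - h%:C * l) <= e * `|h|.

(** Difference quotients in epsilon-delta form are easier to transport from
    complex to real functions than limits along filters. *)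
Lemma real_is_derive (f : R -> R) x l : (forall e : R, 0 < e ->
  exists2 d : R, 0 < d & forall h : R, `|h| < d -> `|f (x + h) - f x - h * l| <= e * `|h|) ->
  is_derive x 1 f l.
Proof.
move=> hf.
have H : (fun h : R => h^-1 *: ((f \o shift x) (h *: 1) - f x)) @ 0^' --> l.
  apply/cvgrPdist_le => e e0; have [d d0 hd] := hf e e0.
  exists d => //= h /=; rewrite sub0r normrN => hd' h0.
  have := hd h hd'; rewrite /GRing.scale /= mulr1 (addrC h) => H.
  have hp : 0 < `|h| by rewrite normr_gt0.
  rewrite -(ler_pM2r hp) -normrM; apply: le_trans H.
  rewrite -normrN le_eqVlt; apply/orP; left; apply/eqP; congr (`|_|).
  by field.
by split; [apply/cvg_ex; exists l|exact/cvg_lim].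
Qed.

Lemma cint_FTC U u a b : a <= b -> cont_on u a b ->
  (forall x, a <= x <= b -> rdiff U x (u x)) -> cint u a b = U b - U a.
Proof.
rewrite le_eqVlt => /orP[/eqP ->|ab] hu hU; first by rewrite cintxx subrr.
have G (p : R[i] -> R) : (forall z w, p (z - w) = p z - p w) -> (forall z, `|p z| <= nrm z) ->
  (forall (r : R) z, p (r%:C * z) = r * p z) ->
  \int[mu]_(x in `[a, b]) (p (u x)) = p (U b) - p (U a).
  move=> pB pN pZ.
  have dU x : a <= x <= b -> is_derive x 1 (fun x => p (U x)) (p (u x)).
    move=> xab; apply: real_is_derive => e e0; have [d d0 hd] := hU x xab e e0.
    by exists d => // h hd'; rewrite -pB -pZ -pB (le_trans (pN _)) // hd.
  have cU x : a <= x <= b -> {for x, continuous (fun x => p (U x))}.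
    by move=> /dU [h _]; exact/differentiable_continuous/derivable1_diffP.
  have cf x : a <= x <= b -> {for x, continuous (fun x => p (u x))}.
    move=> xab; apply/cvgrPdist_le => e e0; have [d d0 hd] := hu x xab e e0.
    near=> y; rewrite distrC -pB; apply: le_trans (pN _) (hd _ _).
    rewrite distrC; near: y; apply/nbhs_ballP; exists d => // z; rewrite -ball_normE.
  rewrite /Rintegral (@continuous_FTC2 R (fun x => p (u x)) (fun x => p (U x))) //.
  - apply: continuous_in_subspaceT => x; rewrite inE /= in_itv /=; exact: cf.
  - split.
    + by move=> x; rewrite in_itv /= => /andP[/ltW ax /ltW xb]; have [] := dU x; rewrite ?ax.
    + by apply: cvg_at_right_filter; apply: cU; rewrite lexx ltW.
    + by apply: cvg_at_left_filter; apply: cU; rewrite lexx ltW.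
  - move=> x; rewrite in_itv /= => /andP[/ltW ax /ltW xb].
    by rewrite derive1E; have := dU x; rewrite ax xb => /(_ isT) [].
have hRe : \int[mu]_(x in `[a, b]) complex.Re (u x) = complex.Re (U b) - complex.Re (U a).
  apply: G; [by move=> z w; rewrite raddfB|exact: nrm_Re|].
  by move=> r [x y] /=; rewrite mul0r subr0.
have hIm : \int[mu]_(x in `[a, b]) complex.Im (u x) = complex.Im (U b) - complex.Im (U a).
  apply: G; [by move=> z w; rewrite raddfB|exact: nrm_Im|].
  by move=> r [x y] /=; rewrite mul0r addr0.
by rewrite /cint hRe hIm; case: (U b) => ? ?; case: (U a).
Unshelve. all: end_near. Qed.

End Cint.

(** * Complex differentiability *)

Section Cdiff.
Context (R : realType).
Implicit Types (F G : R[i] -> R[i]) (z l : R[i]).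

Definition ccont F z := forall e : R, 0 < e ->
  exists2 d : R, 0 < d & forall w : R[i], nrm (w - z) < d -> nrm (F w - F z) <= e.

(** Complex differentiability with the error term written out, so that real and
    imaginary parts and restrictions to segments need no change of topology. *)
Definition cdiff F z l := forall e : R, 0 < e ->
  exists2 d : R, 0 < d & forall w : R[i], nrm (w - z) < d ->
    nrm (F w - F z - (w - z) * l) <= e * nrm (w - z).

Lemma min_gt0 (a b : R) : 0 < a -> 0 < b -> 0 < Num.min a b.
Proof. by rewrite lt_min => -> ->. Qed.

Lemma cdiff_ccont F z l : cdiff F z l -> ccont F z.
Proof.
move=> h e e0; have [d d0 hd] := h 1 ltr01.
have l1 : 0 < 1 + nrm l by rewrite ltr_pwDl // nrm_ge0.
exists (Num.min d (e / (1 + nrm l))); first by rewrite min_gt0 // divr_gt0.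
move=> w; rewrite lt_min => /andP[/hd wd we].
rewrite -[F w - F z](subrK ((w - z) * l)) (le_trans (nrmD _ _)) //.
rewrite (@le_trans _ _ (1 * nrm (w - z) + nrm (w - z) * nrm l)) ?lerD ?nrmM //.
by rewrite mulrC -mulrDr -ler_pdivlMr // ltW.
Qed.

Lemma cdiff_local F G z l (r : R) : 0 < r -> (forall w, nrm (w - z) < r -> F w = G w) ->
  cdiff F z l -> cdiff G z l.
Proof.
move=> r0 FG h e e0; have [d d0 hd] := h e e0.
exists (Num.min d r); first by rewrite min_gt0.
move=> w; rewrite lt_min => /andP[wd wr].
by rewrite -FG // -FG ?subrr ?nrm0 //; exact: hd.
Qed.

Lemma cdiff_unique F z l l' : cdiff F z l -> cdiff F z l' -> l = l'.
Proof.
move=> h h'; apply: nrm_eq_eps => e e0.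
have e2 : 0 < e / 2 by rewrite divr_gt0.
have [d d0 hd] := h _ e2; have [d' d0' hd'] := h' _ e2.
pose t := Num.min d d' / 2.
have t0 : 0 < t by rewrite divr_gt0 // min_gt0.
have tm : t < Num.min d d' by rewrite /t ltr_pdivrMr // ltr_pMr ?min_gt0 // ltr1n.
have nt : nrm (z + t%:C - z) = t by rewrite addrC addKr nrm_real gtr0_norm.
move: tm; rewrite lt_min => /andP[td td'].
have := hd (z + t%:C); have := hd' (z + t%:C); rewrite nt => /(_ td') a /(_ td) b.
have := lerD a b; rewrite -[X in _ + X <= _]nrmN => /(le_trans (nrmD _ _)).
have -> : F (z + t%:C) - F z - (z + t%:C - z) * l' - (F (z + t%:C) - F z - (z + t%:C - z) * l)
  = t%:C * (l - l') by ring.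
rewrite nrmM nrm_real gtr0_norm // -mulrDl -splitr mulrC ler_pM2r //.
Qed.

Lemma cdiff_cst (c : R[i]) z : cdiff (fun=> c) z 0.
Proof.
by move=> e e0; exists 1 => // w _; rewrite mulr0 !subrr nrm0 mulr_ge0 ?nrm_ge0 // ltW.
Qed.

Lemma cdiff_id z : cdiff id z 1.
Proof.
by move=> e e0; exists 1 => // w _; rewrite mulr1 subrr nrm0 mulr_ge0 ?nrm_ge0 // ltW.
Qed.

Lemma cdiffD F G z l m : cdiff F z l -> cdiff G z m -> cdiff (fun w => F w + G w) z (l + m).
Proof.
move=> hF hG e e0; have e2 : 0 < e / 2 by rewrite divr_gt0.
have [d1 d10 h1] := hF _ e2; have [d2 d20 h2] := hG _ e2.
exists (Num.min d1 d2); first by rewrite min_gt0.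
move=> w; rewrite lt_min => /andP[/h1 a /h2 b].
have -> : F w + G w - (F z + G z) - (w - z) * (l + m) =
  (F w - F z - (w - z) * l) + (G w - G z - (w - z) * m) by ring.
by rewrite (le_trans (nrmD _ _)) // [e]splitr [leRHS]mulrDl lerD.
Qed.

Lemma cdiffM F G z l m : cdiff F z l -> cdiff G z m ->
  cdiff (fun w => F w * G w) z (l * G z + F z * m).
Proof.
move=> hF hG e e0.
(* F w G w - F z G z - h (l G z + F z m)
   = (F w - F z - h l) G w + h l (G w - G z) + F z (G w - G z - h m) *)
have K0 : 0 < nrm (G z) + 1 by rewrite ltr_wpDl // nrm_ge0.
have L0 : 0 < nrm l + 1 by rewrite ltr_wpDl // nrm_ge0.
have M0 : 0 < nrm (F z) + 1 by rewrite ltr_wpDl // nrm_ge0.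
have e3 : 0 < e / 3 by rewrite divr_gt0.
have [d1 d10 h1] := hF _ (divr_gt0 e3 K0).
have [d2 d20 h2] := hG _ (divr_gt0 e3 M0).
have [d3 d30 h3] := cdiff_ccont hG ltr01.
have [d4 d40 h4] := cdiff_ccont hG (divr_gt0 e3 L0).
exists (Num.min (Num.min d1 d2) (Num.min d3 d4)); first by rewrite !min_gt0.
move=> w; rewrite !lt_min => /andP[/andP[/h1 a1 /h2 a2] /andP[/h3 a3 /h4 a4]].
have -> : F w * G w - F z * G z - (w - z) * (l * G z + F z * m) =
  (F w - F z - (w - z) * l) * G w + ((w - z) * (l * (G w - G z)) + F z * (G w - G z - (w - z) * m)).
  by ring.
have Gw : nrm (G w) <= nrm (G z) + 1.
  by rewrite -[G w](subrK (G z)) (le_trans (nrmD _ _)) // addrC lerD2l.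
set n := nrm (w - z).
have n0 : 0 <= n by exact: nrm_ge0.
have -> : e * n = e / 3 * n + (e / 3 * n + e / 3 * n) by field.
rewrite (le_trans (nrmD _ _)) // lerD //.
  rewrite nrmM.
  apply: (@le_trans _ _ (e / 3 / (nrm (G z) + 1) * n * (nrm (G z) + 1))).
    by apply: ler_pM; rewrite ?nrm_ge0.
  by rewrite mulrAC divfK // gt_eqF.
rewrite (le_trans (nrmD _ _)) // lerD // !nrmM.
  rewrite mulrC ler_wpM2r //.
  apply: (@le_trans _ _ ((nrm l + 1) * (e / 3 / (nrm l + 1)))).
    by apply: ler_pM; rewrite ?nrm_ge0 // lerDl.
  by rewrite mulrC divfK // gt_eqF.
apply: (@le_trans _ _ ((nrm (F z) + 1) * (e / 3 / (nrm (F z) + 1) * n))).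
  by apply: ler_pM; rewrite ?nrm_ge0 // lerDl.
by rewrite mulrA [_ * (e / 3 / _)]mulrC divfK // gt_eqF.
Qed.

Lemma cdiffZ F z l (c : R[i]) : cdiff F z l -> cdiff (fun w => c * F w) z (c * l).
Proof.
move=> h; have := cdiffM (cdiff_cst c z) h.
by rewrite mul0r add0r.
Qed.

Lemma cdiffV F z l : cdiff F z l -> F z != 0 -> cdiff (fun w => (F w)^-1) z (- l / F z ^+ 2).
Proof.
move=> h Fz e e0; set a := nrm (F z).
have a0 : 0 < a by exact: nrm_gt0.
have a2 : 0 < a / 2 by rewrite divr_gt0.
have L0 : 0 < nrm l + 1 by rewrite ltr_wpDl // nrm_ge0.
have e1 : 0 < e * (a ^+ 2 / 4) by rewrite mulr_gt0 // divr_gt0 // exprn_gt0.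
have e3 : 0 < e * (a ^+ 3 / 4) by rewrite mulr_gt0 // divr_gt0 // exprn_gt0.
have [d1 d10 h1] := h _ e1.
have [d2 d20 h2] := cdiff_ccont h a2.
have [d3 d30 h3] := cdiff_ccont h (divr_gt0 e3 L0).
exists (Num.min d1 (Num.min d2 d3)); first by rewrite !min_gt0.
move=> w; rewrite !lt_min => /andP[/h1 b1 /andP[/h2 b2 /h3 b3]].
have Fw : a / 2 <= nrm (F w).
  have := nrm_subl (F z) (F w); rewrite nrmC -/a; lra.
have Fw0 : F w != 0 by apply: contraTneq Fw => ->; rewrite nrm0 -ltNge.
have -> : (F w)^-1 - (F z)^-1 - (w - z) * (- l / F z ^+ 2) =
   - ((F w - F z - (w - z) * l) / (F w * F z)) + (w - z) * l * (F w - F z) / (F w * F z ^+ 2).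
  by field; rewrite Fz Fw0.
set n := nrm (w - z).
have n0 : 0 <= n by exact: nrm_ge0.
rewrite (le_trans (nrmD _ _)) // nrmN !nrmM !nrmV !nrmM -/a -/n.
rewrite (splitr (e * n)) lerD //.
  apply: (@le_trans _ _ (e * (a ^+ 2 / 4) * n * (a / 2 * a)^-1)).
    apply: ler_pM; rewrite ?nrm_ge0 ?invr_ge0 ?mulr_ge0 ?nrm_ge0 ?(ltW a0) //.
    by rewrite lef_pV2 ?posrE ?mulr_gt0 ?(lt_le_trans a2 Fw) // ler_pM2r.
  by rewrite le_eqVlt; apply/orP; left; apply/eqP; field; rewrite gt_eqF.
apply: (@le_trans _ _ (n * (nrm l + 1) * (e * (a ^+ 3 / 4) / (nrm l + 1)) * (a / 2 * (a * a))^-1)).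
  apply: ler_pM; rewrite ?invr_ge0 ?mulr_ge0 ?nrm_ge0 // ?(ltW a0) //.
    apply: ler_pM; rewrite ?mulr_ge0 ?nrm_ge0 //.
    by apply: ler_wpM2l => //; rewrite lerDl.
  by rewrite lef_pV2 ?posrE ?mulr_gt0 ?(lt_le_trans a2 Fw) // ler_pM2r // mulr_gt0.
by rewrite le_eqVlt; apply/orP; left; apply/eqP; field; rewrite !gt_eqF.
Qed.

Lemma ccontD F G z : ccont F z -> ccont G z -> ccont (fun w => F w + G w) z.
Proof.
move=> hF hG e e0; have e2 : 0 < e / 2 by rewrite divr_gt0.
have [d1 d10 h1] := hF _ e2; have [d2 d20 h2] := hG _ e2.
exists (Num.min d1 d2); first by rewrite min_gt0.
move=> w; rewrite lt_min => /andP[/h1 a /h2 b].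
by rewrite opprD addrACA (le_trans (nrmD _ _)) // [leRHS]splitr lerD.
Qed.

Lemma ccont_cst (c : R[i]) z : ccont (fun=> c) z.
Proof. exact: cdiff_ccont (cdiff_cst c z). Qed.

Lemma ccontM F G z : ccont F z -> ccont G z -> ccont (fun w => F w * G w) z.
Proof.
move=> hF hG e e0.
have K0 : 0 < nrm (G z) + 1 by rewrite ltr_wpDl // nrm_ge0.
have M0 : 0 < nrm (F z) + 1 by rewrite ltr_wpDl // nrm_ge0.
have e2 : 0 < e / 2 by rewrite divr_gt0.
have [d1 d10 h1] := hF _ (divr_gt0 e2 K0).
have [d2 d20 h2] := hG _ (divr_gt0 e2 M0).
have [d3 d30 h3] := hG _ ltr01.
exists (Num.min d1 (Num.min d2 d3)); first by rewrite !min_gt0.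
move=> w; rewrite !lt_min => /andP[/h1 a1 /andP[/h2 a2 /h3 a3]].
have -> : F w * G w - F z * G z = (F w - F z) * G w + F z * (G w - G z) by ring.
have Gw : nrm (G w) <= nrm (G z) + 1.
  by rewrite -[G w](subrK (G z)) (le_trans (nrmD _ _)) // addrC lerD2l.
rewrite (le_trans (nrmD _ _)) // !nrmM [leRHS]splitr lerD //.
  apply: (@le_trans _ _ (e / 2 / (nrm (G z) + 1) * (nrm (G z) + 1))).
    by apply: ler_pM; rewrite ?nrm_ge0.
  by rewrite divfK // gt_eqF.
apply: (@le_trans _ _ ((nrm (F z) + 1) * (e / 2 / (nrm (F z) + 1)))).
  by apply: ler_pM; rewrite ?nrm_ge0 // lerDl.
by rewrite mulrC divfK // gt_eqF.
Qed.

Lemma ccontZ F z (c : R[i]) : ccont F z -> ccont (fun w => c * F w) z.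
Proof. by move=> h; apply: ccontM h; exact: ccont_cst. Qed.

Lemma cdiff_inv_sub (z w : R[i]) : w != z -> cdiff (fun v => (v - z)^-1) w (- 1 / (w - z) ^+ 2).
Proof.
move=> wz; apply: (@cdiffV (fun v => v - z) w 1); last by rewrite subr_eq0.
by have := cdiffD (cdiff_id w) (cdiff_cst (- z) w); rewrite addr0.
Qed.

Lemma ccont_inv_sub (z w : R[i]) : w != z -> ccont (fun v => (v - z)^-1) w.
Proof. by move=> /cdiff_inv_sub/cdiff_ccont. Qed.

End Cdiff.

(** * Integrals along rectangles and Goursat's theorem *)

Section Rectangle.
Context (R : realType).
Implicit Types (F G P : R[i] -> R[i]) (x y : R).

Definition hor_int F y a b := cint (fun x => F (x +i* y)) a b.
Definition ver_int F x a b := 'i * cint (fun y => F (x +i* y)) a b.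
(** The integral along the boundary of [x1, x2] x [y1, y2], counterclockwise. *)
Definition rect_int F x1 x2 y1 y2 := hor_int F y1 x1 x2 + ver_int F x2 y1 y2 - hor_int F y2 x1 x2 - ver_int F x1 y1 y2.

Definition rect x1 x2 y1 y2 : set R[i] :=
  [set z | (x1 <= complex.Re z <= x2) /\ (y1 <= complex.Im z <= y2)].

Definition bdry x1 x2 y1 y2 : set R[i] :=
  [set z | rect x1 x2 y1 y2 z /\ (complex.Re z = x1 \/ complex.Re z = x2 \/
     complex.Im z = y1 \/ complex.Im z = y2)].

Lemma hcont F y a b : (forall x, a <= x <= b -> ccont F (x +i* y)) ->
  cont_on (fun x => F (x +i* y)) a b.
Proof.
move=> h x xab e e0; have [d d0 hd] := h x xab e e0.
exists d => // x' xx'; apply: hd.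
have -> : x' +i* y - x +i* y = (x' - x)%:C by rewrite /= ; apply: complex_ReIm_inj => //=; rewrite subrr.
by rewrite nrm_real.
Qed.

Lemma vcont F x a b : (forall y, a <= y <= b -> ccont F (x +i* y)) ->
  cont_on (fun y => F (x +i* y)) a b.
Proof.
move=> h y yab e e0; have [d d0 hd] := h y yab e e0.
exists d => // y' yy'; apply: hd.
have -> : x +i* y' - x +i* y = 'i * (y' - y)%:C.
  by apply: complex_ReIm_inj => /=; ring.
by rewrite nrmM nrm_i mul1r nrm_real.
Qed.

Section Fixed.
Context (x1 x2 y1 y2 : R) (xx : x1 <= x2) (yy : y1 <= y2).

Lemma bdry_h1 x : x1 <= x <= x2 -> bdry x1 x2 y1 y2 (x +i* y1).
Proof. by move=> h; do ?split => //=; rewrite ?lexx //; right; right; left. Qed.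
Lemma bdry_h2 x : x1 <= x <= x2 -> bdry x1 x2 y1 y2 (x +i* y2).
Proof. by move=> h; do ?split => //=; rewrite ?lexx ?yy //; right; right; right. Qed.
Lemma bdry_v1 y : y1 <= y <= y2 -> bdry x1 x2 y1 y2 (x1 +i* y).
Proof. by move=> h; do ?split => //=; rewrite ?lexx //; left. Qed.
Lemma bdry_v2 y : y1 <= y <= y2 -> bdry x1 x2 y1 y2 (x2 +i* y).
Proof. by move=> h; do ?split => //=; rewrite ?lexx ?xx //; right; left. Qed.

Definition bcont F := forall z, bdry x1 x2 y1 y2 z -> ccont F z.

Lemma bcont_h1 F : bcont F -> cont_on (fun x => F (x +i* y1)) x1 x2.
Proof. by move=> h; apply: hcont => x /bdry_h1; exact: h. Qed.
Lemma bcont_h2 F : bcont F -> cont_on (fun x => F (x +i* y2)) x1 x2.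
Proof. by move=> h; apply: hcont => x /bdry_h2; exact: h. Qed.
Lemma bcont_v1 F : bcont F -> cont_on (fun y => F (x1 +i* y)) y1 y2.
Proof. by move=> h; apply: vcont => x /bdry_v1; exact: h. Qed.
Lemma bcont_v2 F : bcont F -> cont_on (fun y => F (x2 +i* y)) y1 y2.
Proof. by move=> h; apply: vcont => x /bdry_v2; exact: h. Qed.

Lemma rect_int_ext F G : (forall z, bdry x1 x2 y1 y2 z -> F z = G z) ->
  rect_int F x1 x2 y1 y2 = rect_int G x1 x2 y1 y2.
Proof.
move=> h; rewrite /rect_int /hor_int /ver_int.
congr (_ + _ - _ - _); try congr ('i * _); apply: cint_ext => t ht; apply: h.
- exact: bdry_h1.
- exact: bdry_v2.
- exact: bdry_h2.
- exact: bdry_v1.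
Qed.

Lemma rect_intD F G : bcont F -> bcont G ->
  rect_int (fun z => F z + G z) x1 x2 y1 y2 = rect_int F x1 x2 y1 y2 + rect_int G x1 x2 y1 y2.
Proof.
move=> hF hG; rewrite /rect_int /hor_int /ver_int !cintD; try ring.
all: by [exact: bcont_h1|exact: bcont_h2|exact: bcont_v1|exact: bcont_v2].
Qed.

Lemma rect_intZ (k : R[i]) F : bcont F ->
  rect_int (fun z => k * F z) x1 x2 y1 y2 = k * rect_int F x1 x2 y1 y2.
Proof.
move=> hF; rewrite /rect_int /hor_int /ver_int !cintZ; try ring.
all: by [exact: bcont_h1|exact: bcont_h2|exact: bcont_v1|exact: bcont_v2].
Qed.

Lemma rect_int_bound F (B : R) : bcont F -> (forall z, bdry x1 x2 y1 y2 z -> nrm (F z) <= B) ->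
  nrm (rect_int F x1 x2 y1 y2) <= 4 * B * ((x2 - x1) + (y2 - y1)).
Proof.
move=> hF hB; rewrite /rect_int.
have a1 : nrm (hor_int F y1 x1 x2) <= 2 * B * (x2 - x1).
  apply: cint_bound => //; first exact: bcont_h1.
  by move=> x /bdry_h1; exact: hB.
have a2 : nrm (hor_int F y2 x1 x2) <= 2 * B * (x2 - x1).
  apply: cint_bound => //; first exact: bcont_h2.
  by move=> x /bdry_h2; exact: hB.
have a3 : nrm (ver_int F x1 y1 y2) <= 2 * B * (y2 - y1).
  rewrite /ver_int nrmM nrm_i mul1r; apply: cint_bound => //; first exact: bcont_v1.
  by move=> x /bdry_v1; exact: hB.
have a4 : nrm (ver_int F x2 y1 y2) <= 2 * B * (y2 - y1).
  rewrite /ver_int nrmM nrm_i mul1r; apply: cint_bound => //; first exact: bcont_v2.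
  by move=> x /bdry_v2; exact: hB.
have := nrmB (hor_int F y1 x1 x2 + ver_int F x2 y1 y2 - hor_int F y2 x1 x2) (ver_int F x1 y1 y2).
have := nrmB (hor_int F y1 x1 x2 + ver_int F x2 y1 y2) (hor_int F y2 x1 x2).
have := nrmD (hor_int F y1 x1 x2) (ver_int F x2 y1 y2).
by move: a1 a2 a3 a4; lra.
Qed.

Lemma hor_int_primitive F P y a b : a <= b ->
  (forall x, a <= x <= b -> ccont F (x +i* y) /\ cdiff P (x +i* y) (F (x +i* y))) ->
  hor_int F y a b = P (b +i* y) - P (a +i* y).
Proof.
move=> ab h; apply: (@cint_FTC _ (fun x => P (x +i* y))) => //.
  by apply: hcont => x /h[].
move=> x /h[_ hP] e e0; have [d d0 hd] := hP e e0.
exists d => // t td; have := hd ((x + t) +i* y).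
have -> : (x + t) +i* y - x +i* y = t%:C by apply: complex_ReIm_inj => /=; ring.
by rewrite nrm_real; apply.
Qed.

Lemma ver_int_primitive F P x a b : a <= b ->
  (forall y, a <= y <= b -> ccont F (x +i* y) /\ cdiff P (x +i* y) (F (x +i* y))) ->
  ver_int F x a b = P (x +i* b) - P (x +i* a).
Proof.
move=> ab h; rewrite /ver_int -cintZ; last by apply: vcont => y /h[].
apply: (@cint_FTC _ (fun y => P (x +i* y))) => //.
  by apply: cont_onZ; apply: vcont => y /h[].
move=> y /h[_ hP] e e0; have [d d0 hd] := hP e e0.
exists d => // t td; have := hd (x +i* (y + t)).
have -> : x +i* (y + t) - x +i* y = t%:C * 'i by apply: complex_ReIm_inj => /=; ring.
by rewrite nrmM nrm_i mulr1 nrm_real mulrA; apply.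
Qed.

(** Each side contributes the difference of the values of P at its ends, and these
    cancel around the boundary. *)
Lemma rect_int_primitive F P : bcont F ->
  (forall z, bdry x1 x2 y1 y2 z -> cdiff P z (F z)) -> rect_int F x1 x2 y1 y2 = 0.
Proof.
move=> hF hP; rewrite /rect_int (@hor_int_primitive _ P) // ?(@hor_int_primitive _ P y2) //
   ?(@ver_int_primitive _ P x1) // ?(@ver_int_primitive _ P x2) //; first ring.
- by move=> t /bdry_v2 h; split; [exact: hF|exact: hP].
- by move=> t /bdry_v1 h; split; [exact: hF|exact: hP].
- by move=> t /bdry_h2 h; split; [exact: hF|exact: hP].
- by move=> t /bdry_h1 h; split; [exact: hF|exact: hP].
Qed.

End Fixed.

Lemma rect_int_cat_x F x1 a x2 y1 y2 : x1 <= a -> a <= x2 ->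
  cont_on (fun x => F (x +i* y1)) x1 x2 -> cont_on (fun x => F (x +i* y2)) x1 x2 ->
  rect_int F x1 x2 y1 y2 = rect_int F x1 a y1 y2 + rect_int F a x2 y1 y2.
Proof.
move=> xa ax h1 h2; rewrite /rect_int /hor_int (cint_cat xa ax h1) (cint_cat xa ax h2); ring.
Qed.

Lemma rect_int_cat_y F x1 x2 y1 b y2 : y1 <= b -> b <= y2 ->
  cont_on (fun y => F (x1 +i* y)) y1 y2 -> cont_on (fun y => F (x2 +i* y)) y1 y2 ->
  rect_int F x1 x2 y1 y2 = rect_int F x1 x2 y1 b + rect_int F x1 x2 b y2.
Proof.
move=> yb byy h1 h2; rewrite /rect_int /ver_int (cint_cat yb byy h1) (cint_cat yb byy h2); ring.
Qed.

Lemma dist_itv a h x y : a <= x <= a + h -> a <= y <= a + h -> `|x - y| <= h.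
Proof.
by move=> /andP[? ?] /andP[? ?]; rewrite ler_norml; apply/andP; split; lra.
Qed.

Lemma rect_diam x y (w h : R) u v : rect x (x + w) y (y + h) u ->
  rect x (x + w) y (y + h) v -> nrm (u - v) <= w + h.
Proof.
move=> [u1 u2] [v1 v2]; rewrite (le_trans (nrm_ReIm _)) // !raddfB /=.
by apply: lerD; [exact: dist_itv u1 v1|exact: dist_itv u2 v2].
Qed.

(** Chooses the quarter of a rectangle on which the integral is large. *)
Lemma quarter (s a b c d : R) : s <= a + b + (c + d) ->
  s <= 4 * a \/ s <= 4 * b \/ s <= 4 * c \/ s <= 4 * d.
Proof.
move=> h; have [|ha] := leP s (4 * a); first by left.
have [|hb] := leP s (4 * b); first by right; left.
have [|hc] := leP s (4 * c); first by right; right; left.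
by right; right; right; lra.
Qed.

Lemma nested (a b : nat -> R) : (forall n m, a n <= b m) ->
  exists x, forall n, a n <= x <= b n.
Proof.
move=> h; exists (sup (range a)) => n; apply/andP; split.
  apply: ub_le_sup; last by exists n.
  by exists (b 0%N) => _ [m _ <-].
apply: ge_sup; first by exists (a 0%N), 0%N.
by move=> _ [m _ <-].
Qed.

Lemma pow2_small (C d : R) : 0 < d -> exists n, C / 2 ^+ n < d.
Proof.
move=> d0; exists (Num.bound (C / d)).
rewrite ltr_pdivrMr ?exprn_gt0 // mulrC -ltr_pdivrMr //.
have [Cn|Cp] := ltP (C / d) 0; first by rewrite (lt_trans Cn) // exprn_gt0.
apply: (lt_trans (archi_boundP Cp)).
by rewrite -natrX ltr_nat ltn_expl.
Qed.

(** If the integral were nonzero, bisection would give nested rectangles on the n-th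
    of which it is at least 4^-n times the original one. At their common point z the
    function is affine up to an error o(|v - z|); the affine part has a primitive, and
    the error integrates to o(4^-n). *)
Lemma Goursat F x1 x2 y1 y2 : x1 <= x2 -> y1 <= y2 ->
  (forall z, rect x1 x2 y1 y2 z -> exists l, cdiff F z l) -> rect_int F x1 x2 y1 y2 = 0.
Proof.
move=> xx yy hF.
pose w n := (x2 - x1) / 2 ^+ n; pose h n := (y2 - y1) / 2 ^+ n.
have wS n : w n = w n.+1 + w n.+1.
  by rewrite /w exprS; field; rewrite ?expf_neq0 ?pnatr_eq0.
have hS n : h n = h n.+1 + h n.+1.
  by rewrite /h exprS; field; rewrite ?expf_neq0 ?pnatr_eq0.
have w0 n : 0 <= w n by rewrite divr_ge0 ?subr_ge0 // exprn_ge0.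
have h0 n : 0 <= h n by rewrite divr_ge0 ?subr_ge0 // exprn_ge0.
pose T n (p : R * R) := rect_int F p.1 (p.1 + w n) p.2 (p.2 + h n).
pose S := rect_int F x1 x2 y1 y2.
pose inv n (p : R * R) := [/\ x1 <= p.1 <= p.1 + w n, p.1 + w n <= x2,
  y1 <= p.2 <= p.2 + h n, p.2 + h n <= y2 & nrm S <= 4 ^+ n * nrm (T n p)].
have cF z : rect x1 x2 y1 y2 z -> ccont F z by move=> /hF[l /cdiff_ccont].
(* a rectangle of the n-th generation is given by its lower left corner *)
have step (np : nat * (R * R)) : exists q : R * R, inv np.1 np.2 ->
   [/\ inv np.1.+1 q, np.2.1 <= q.1, q.1 + w np.1.+1 <= np.2.1 + w np.1,
   np.2.2 <= q.2 & q.2 + h np.1.+1 <= np.2.2 + h np.1].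
  case: np => n [a b] /=.
  have [[/= /andP[ha _] ha' /andP[hb _] hb' hS0]|] := pselect (inv n (a, b)); last by exists (a, b).
  set w' := w n.+1; set h' := h n.+1.
  have w'0 : 0 <= w' := w0 _; have h'0 : 0 <= h' := h0 _.
  rewrite (wS n) (hS n) -/w' -/h'; move: ha' hb'; rewrite wS hS -/w' -/h' => ha' hb'.
  have E : T n (a, b) = (T n.+1 (a, b) + T n.+1 (a, b + h')) + 
      (T n.+1 (a + w', b) + T n.+1 (a + w', b + h')).
    rewrite /T /= wS hS -/w' -/h' [a + (w' + w')]addrA [b + (h' + h')]addrA.
    have ch y : b <= y <= b + h' + h' -> cont_on (fun x => F (x +i* y)) a (a + w' + w').
      move=> /andP[y1' y2']; apply: hcont => x /andP[x1' x2']; apply: cF; split => /=;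
        apply/andP; split; lra.
    have cv x : a <= x <= a + w' + w' -> cont_on (fun y => F (x +i* y)) b (b + h' + h').
      move=> /andP[x1' x2']; apply: vcont => y /andP[y1' y2']; apply: cF; split => /=;
        apply/andP; split; lra.
    rewrite (@rect_int_cat_x F a (a + w')); [|lra|lra|apply: ch|apply: ch]; try (apply/andP; split; lra).
    rewrite (@rect_int_cat_y F a _ b (b + h')); [|lra|lra|apply: cv|apply: cv]; try (apply/andP; split; lra).
    by rewrite (@rect_int_cat_y F (a + w') _ b (b + h')); [|lra|lra|apply: cv|apply: cv]; try (apply/andP; split; lra).
  have mk q : (q = (a, b) \/ q = (a, b + h') \/ q = (a + w', b) \/ q = (a + w', b + h')) ->
      nrm (T n (a, b)) <= 4 * nrm (T n.+1 q) ->
    exists q : R * R, inv n (a, b) -> [/\ inv n.+1 q, a <= q.1, q.1 + w' <= a + (w' + w'),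
     b <= q.2 & q.2 + h' <= b + (h' + h')].
    move=> hq hT; exists q => _.
    have [q1 q2] : (a <= q.1 /\ q.1 + w' <= a + (w' + w')) /\ (b <= q.2 /\ q.2 + h' <= b + (h' + h')).
      by move: w'0 h'0; clear -hq; case: hq => [|[|[|]]] -> /=; split; split; lra.
    case: q1 q2 => q1 q2 [q3 q4]; split => //.
    split; rewrite -/w' -/h'; try (move: ha hb ha' hb' q1 q2 q3 q4 w'0 h'0; clear;
      by [move=> *; apply/andP; split; lra | lra]).
    rewrite exprSr -mulrA; apply: (le_trans hS0).
    by rewrite ler_pM2l // exprn_gt0.
  have /quarter : nrm (T n (a, b)) <= nrm (T n.+1 (a, b)) + nrm (T n.+1 (a, b + h')) +
      (nrm (T n.+1 (a + w', b)) + nrm (T n.+1 (a + w', b + h'))).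
    by rewrite E (le_trans (nrmD _ _)) // lerD ?nrmD.
  case=> [|[|[|]]] le4; apply: mk le4; first by left.
  - by right; left.
  - by right; right; left.
  - by right; right; right.
have [nx hnx] := choice step.
pose p := fix p n := if n is k.+1 then nx (k, p k) else (x1, y1).
have w00 : x1 + w 0%N = x2 by rewrite /w expr0 divr1 addrC subrK.
have h00 : y1 + h 0%N = y2 by rewrite /h expr0 divr1 addrC subrK.
have pinv n : inv n (p n).
  elim: n => [|n IH].
    by split; rewrite ?w00 ?h00 //= ?w00 ?h00 ?lexx ?xx ?yy // expr0 mul1r /T /= w00 h00.
  by have [] := hnx (n, p n) IH.
have mono n k : [/\ (p n).1 <= (p (n + k)%N).1, (p (n + k)%N).1 + w (n + k)%N <= (p n).1 + w n,
    (p n).2 <= (p (n + k)%N).2 & (p (n + k)%N).2 + h (n + k)%N <= (p n).2 + h n].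
  elim: k => [|k [i1 i2 i3 i4]]; first by rewrite addn0.
  have [_] := hnx ((n + k)%N, p (n + k)%N) (pinv _); rewrite /= addnS => j1 j2 j3 j4.
  by split; [exact: le_trans j1|exact: le_trans j2 _|exact: le_trans j3|exact: le_trans j4 _].
have cross (f g : nat -> R) : (forall n, 0 <= g n) ->
   (forall n k, f n <= f (n + k)%N /\ f (n + k)%N + g (n + k)%N <= f n + g n) ->
   forall n m, f n <= f m + g m.
  move=> g0 H n m; case: (leqP n m) => nm.
    have [a _] := H n (m - n)%N; rewrite subnKC // in a.
    by rewrite (le_trans a) // lerDl.
  have [_ a] := H m (n - m)%N; rewrite subnKC 1?ltnW // in a.
  by rewrite (le_trans _ a) // lerDl.
have [xs hxs] : exists x, forall n, (p n).1 <= x <= (p n).1 + w n.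
  by apply: nested; apply: cross => // n k; have [] := mono n k.
have [ys hys] : exists y, forall n, (p n).2 <= y <= (p n).2 + h n.
  by apply: nested; apply: cross => // n k; have [] := mono n k.
pose z := xs +i* ys.
have [l hl] : exists l, cdiff F z l.
  by apply: hF; split => /=; [have := hxs 0%N; rewrite /= w00|have := hys 0%N; rewrite /= h00].
pose D := (x2 - x1) + (y2 - y1).
have D0 : 0 <= D by rewrite addr_ge0 ?subr_ge0.
apply: nrm_le0 => e e0.
have K0 : 0 < 4 * D ^+ 2 + 1 by rewrite ltr_wpDl // mulr_ge0 // exprn_ge0.
have [d d0 hd] := hl _ (divr_gt0 e0 K0).
have [n hn] := pow2_small D d0.
have wh : w n + h n = D / 2 ^+ n by rewrite -mulrDl.
have [/= /andP[g1 _] g2 /andP[g3 _] g4 gS] := pinv n.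
apply: (le_trans gS).
have sub v : rect (p n).1 ((p n).1 + w n) (p n).2 ((p n).2 + h n) v -> nrm (v - z) <= D / 2 ^+ n.
  by move=> hv; rewrite -wh; apply: rect_diam hv _; split; [exact: hxs|exact: hys].
have incl v : rect (p n).1 ((p n).1 + w n) (p n).2 ((p n).2 + h n) v -> rect x1 x2 y1 y2 v.
  move=> [/andP[v1 v2] /andP[v3 v4]]; split; apply/andP; split.
  - exact: le_trans v1.
  - exact: le_trans g2.
  - exact: le_trans v3.
  - exact: le_trans g4.
pose Lf v := F z + (v - z) * l.
have dL v : cdiff (fun v => F z * v + (2^-1 * l) * ((v - z) * (v - z))) v (Lf v).
  have h1 : cdiff (fun v => v - z) v 1.
    by have := cdiffD (cdiff_id v) (cdiff_cst (- z) v); rewrite addr0.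
  have -> : Lf v = F z * 1 + 2^-1 * l * (1 * (v - z) + (v - z) * 1) by rewrite /Lf; field.
  exact: cdiffD (cdiffZ (F z) (cdiff_id v)) (cdiffZ (2^-1 * l) (cdiffM h1 h1)).
have cL v : ccont Lf v.
  apply: ccontD; first exact: ccont_cst.
  apply: ccontM; last exact: ccont_cst.
  by apply: ccontD; [exact: cdiff_ccont (cdiff_id v)|exact: ccont_cst].
have xn : (p n).1 <= (p n).1 + w n by rewrite lerDl.
have yn : (p n).2 <= (p n).2 + h n by rewrite lerDl.
have L0 : rect_int Lf (p n).1 ((p n).1 + w n) (p n).2 ((p n).2 + h n) = 0.
  by apply: (@rect_int_primitive _ _ _ _ xn yn Lf _ _ (fun v _ => dL v)) => v _.
have bF : bcont (p n).1 ((p n).1 + w n) (p n).2 ((p n).2 + h n) F.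
  by move=> v [/incl/cF].
have bG : bcont (p n).1 ((p n).1 + w n) (p n).2 ((p n).2 + h n) (fun v => F v + (-1) * Lf v).
  by move=> v hv; apply: ccontD; [exact: bF|exact: ccontZ].
have -> : T n (p n) = rect_int (fun v => F v + (-1) * Lf v) (p n).1 ((p n).1 + w n) (p n).2 ((p n).2 + h n).
  have cL' : bcont (p n).1 ((p n).1 + w n) (p n).2 ((p n).2 + h n) Lf by move=> v _.
  rewrite rect_intD ?rect_intZ // ?L0 ?mulr0 ?addr0 //.
  by move=> v _; apply: ccontZ.
have q0 : 0 <= D / 2 ^+ n by rewrite divr_ge0 // exprn_ge0.
have B : nrm (rect_int (fun v => F v + (-1) * Lf v) (p n).1 ((p n).1 + w n) (p n).2 ((p n).2 + h n)) <=
  4 * (e / (4 * D ^+ 2 + 1) * (D / 2 ^+ n)) * (D / 2 ^+ n).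
  have := @rect_int_bound _ _ _ _ xn yn _ (e / (4 * D ^+ 2 + 1) * (D / 2 ^+ n)) bG.
  rewrite [(p n).1 + _ - _]addrAC subrr add0r [(p n).2 + _ - _]addrAC subrr add0r wh.
  apply=> v [hv _]; have -> : F v + -1 * Lf v = F v - F z - (v - z) * l by rewrite /Lf; ring.
  have vz := sub v hv.
  apply: (le_trans (hd v (le_lt_trans vz hn))).
  by apply: ler_wpM2l => //; rewrite divr_ge0 ?ltW.
apply: (@le_trans _ _ (4 ^+ n * (4 * (e / (4 * D ^+ 2 + 1) * (D / 2 ^+ n)) * (D / 2 ^+ n)))).
  by rewrite ler_pM2l // exprn_gt0.
have -> : (4 : R) ^+ n = 2 ^+ n * 2 ^+ n by rewrite -exprMn; congr (_ ^+ _); ring.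
have -> : 2 ^+ n * 2 ^+ n * (4 * (e / (4 * D ^+ 2 + 1) * (D / 2 ^+ n)) * (D / 2 ^+ n)) =
   e * ((4 * D ^+ 2) / (4 * D ^+ 2 + 1)).
  by field; rewrite gt_eqF //= expf_neq0 // pnatr_eq0.
rewrite ger_pMr // ler_pdivrMr // mul1r lerDl //.
Qed.

End Rectangle.

(** * Cauchy's formula for rectangles *)

Section Cauchy.
Context (R : realType).
Implicit Types (F G P g : R[i] -> R[i]) (x y : R) (z w : R[i]).

Lemma cdiff_sub_cst z w : cdiff (fun v => v - z) w 1.
Proof. by have := cdiffD (cdiff_id w) (cdiff_cst (- z) w); rewrite addr0. Qed.

(** Cut the large rectangle along the lines carrying the sides of the small one: the
    other pieces do not meet its interior, and Goursat's theorem applies to them. *)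
Lemma rect_int_shrink F x1 a b x2 y1 c d y2 :
  x1 <= a -> a <= b -> b <= x2 -> y1 <= c -> c <= d -> d <= y2 ->
  (forall z, rect x1 x2 y1 y2 z -> ~ (a < complex.Re z < b /\ c < complex.Im z < d) ->
    exists l, cdiff F z l) ->
  rect_int F x1 x2 y1 y2 = rect_int F a b c d.
Proof.
move=> xa ab bx yc cd dy hF.
have hC z : rect x1 x2 y1 y2 z -> ~ (a < complex.Re z < b /\ c < complex.Im z < d) -> ccont F z.
  by move=> h1 h2; have [l /cdiff_ccont] := hF z h1 h2.
have hh y u v : x1 <= u -> v <= x2 -> y1 <= y <= y2 -> ~ (c < y < d) ->
    cont_on (fun x => F (x +i* y)) u v.
  move=> xu vx yy yn; apply: hcont => x /andP[xl xr]; apply: hC; last by move=> [_].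
  by split => //=; rewrite (le_trans xu xl) (le_trans xr vx).
have hv x u v : y1 <= u -> v <= y2 -> x1 <= x <= x2 -> ~ (a < x < b) ->
    cont_on (fun y => F (x +i* y)) u v.
  move=> xu vx yy yn; apply: vcont => y /andP[xl xr]; apply: hC; last by move=> [].
  by split => //=; rewrite (le_trans xu xl) (le_trans xr vx).
have G0 u1 u2 v1 v2 : x1 <= u1 -> u1 <= u2 -> u2 <= x2 -> y1 <= v1 -> v1 <= v2 -> v2 <= y2 ->
   (u2 <= a \/ b <= u1 \/ v2 <= c \/ d <= v1) -> rect_int F u1 u2 v1 v2 = 0.
  move=> h1 h2 h3 h4 h5 h6 hh'; apply: Goursat => // z [/= /andP[i1 i2] /andP[i3 i4]].
  apply: hF.
    by split; rewrite ?(le_trans h1 i1) ?(le_trans i2 h3) ?(le_trans h4 i3) ?(le_trans i4 h6).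
  by move=> [/andP[j1 j2] /andP[j3 j4]]; case: hh' => [|[|[|]]]; lra.
rewrite (@rect_int_cat_x _ F x1 a x2); last 4 first.
- by [].
- lra.
- by apply: hh; rewrite ?lexx //; first lra; move=> /andP[]; lra.
- by apply: hh; rewrite ?lexx ?andbT //; first lra; move=> /andP[]; lra.
rewrite (@rect_int_cat_x _ F a b x2); last 4 first.
- by [].
- lra.
- by apply: hh; rewrite ?lexx //; first lra; move=> /andP[]; lra.
- by apply: hh; rewrite ?lexx ?andbT //; first lra; move=> /andP[]; lra.
rewrite (@rect_int_cat_y _ F a b y1 c y2); last 4 first.
- by [].
- lra.
- by apply: hv; rewrite ?lexx ?xa //; first lra; move=> /andP[]; lra.
- by apply: hv; rewrite ?lexx ?andbT //; first (apply/andP; split; lra); move=> /andP[]; lra.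
rewrite (@rect_int_cat_y _ F a b c d y2); last 4 first.
- by [].
- lra.
- by apply: hv; rewrite ?lexx ?xa //; first lra; move=> /andP[]; lra.
- by apply: hv; rewrite ?lexx ?andbT //; first (apply/andP; split; lra); move=> /andP[]; lra.
by rewrite (G0 x1 a y1 y2) ?(G0 b x2 y1 y2) ?(G0 a b y1 c) ?(G0 a b d y2) ?add0r ?addr0 //; lra.
Qed.

Definition open_rect x1 x2 y1 y2 : set R[i] :=
  [set z | x1 < complex.Re z < x2 /\ y1 < complex.Im z < y2].

(** This equals 2 pi i for z inside the rectangle; all that is used is that it is
    nonzero and does not depend on z. *)
Definition rect_winding x1 x2 y1 y2 z := rect_int (fun v => (v - z)^-1) x1 x2 y1 y2.

Lemma open_rect_sub x1 x2 y1 y2 z : open_rect x1 x2 y1 y2 z -> rect x1 x2 y1 y2 z.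
Proof. by move=> [/andP[? ?] /andP[? ?]]; split; rewrite !ltW. Qed.

Lemma open_rect_bdry x1 x2 y1 y2 z : open_rect x1 x2 y1 y2 z -> forall v, bdry x1 x2 y1 y2 v -> v != z.
Proof.
move=> [/andP[a1 a2] /andP[a3 a4]] v [_ h]; apply/eqP => vz.
by move: h; rewrite vz; lra.
Qed.

Lemma cdiff_quot g z w l : cdiff g w l -> w != z ->
  exists l', cdiff (fun v => g v / (v - z)) w l'.
Proof. by move=> hg wz; eexists; apply: cdiffM hg _; exact: cdiff_inv_sub. Qed.

(** The quotient (g v - g z) / (v - z) is bounded near z, and its integral does not
    change when the rectangle shrinks to z; hence it is zero. *)
Lemma Cauchy_formula g x1 x2 y1 y2 z : open_rect x1 x2 y1 y2 z ->
  (forall w, rect x1 x2 y1 y2 w -> exists l, cdiff g w l) ->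
  rect_int (fun v => g v / (v - z)) x1 x2 y1 y2 = g z * rect_winding x1 x2 y1 y2 z.
Proof.
move=> hz hg; have [/andP[a1 a2] /andP[a3 a4]] := hz.
have xx : x1 <= x2 by lra.
have yy : y1 <= y2 by lra.
pose F v := (g v - g z) / (v - z).
have dF w : rect x1 x2 y1 y2 w -> w != z -> exists l, cdiff F w l.
  move=> /hg[l hl] wz; apply: (@cdiff_quot (fun v => g v - g z) z w l) => //.
  by have := cdiffD hl (cdiff_cst (- g z) w); rewrite addr0.
have F0 : rect_int F x1 x2 y1 y2 = 0.
  apply: nrm_le0 => e e0.
  have [l hl] : exists l, cdiff g z l by apply: hg; exact: open_rect_sub.
  have [d d0 hd] := hl 1 ltr01.
  have L0 : 0 < 1 + nrm l by rewrite ltr_pwDl // nrm_ge0.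
  pose s0 := Num.min (Num.min (complex.Re z - x1) (x2 - complex.Re z))
    (Num.min (complex.Im z - y1) (y2 - complex.Im z)).
  pose s1 := Num.min (d / 3) (e / (16 * (1 + nrm l))).
  have s00 : 0 < s0 by rewrite !min_gt0 // subr_gt0.
  have s10 : 0 < s1 by rewrite !min_gt0 // divr_gt0 // mulr_gt0.
  pose s := Num.min s0 s1.
  have sp : 0 < s by rewrite min_gt0.
  have : s <= s0 by rewrite ge_min lexx.
  rewrite /s0 !le_min => /andP[/andP[b1 b2] /andP[b3 b4]].
  have : s <= s1 by rewrite ge_min lexx orbT.
  rewrite /s1 le_min => /andP[b5 b6].
  rewrite (@rect_int_shrink F x1 (complex.Re z - s) (complex.Re z + s) x2 y1
     (complex.Im z - s) (complex.Im z + s) y2);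
    try (move: b1 b2 b3 b4 sp; clear; lra); last first.
    move=> w hw hn; apply: dF => //; apply/eqP => wz; apply: hn; rewrite wz.
    by rewrite !gtrBl !ltrDl !sp.
  have xs : complex.Re z - s <= complex.Re z + s by move: sp; clear; lra.
  have ys : complex.Im z - s <= complex.Im z + s by move: sp; clear; lra.
  have hs : open_rect (complex.Re z - s) (complex.Re z + s) (complex.Im z - s) (complex.Im z + s) z.
    by split; rewrite gtrBl ltrDl sp.
  have := @rect_int_bound _ _ _ _ _ xs ys F (1 + nrm l).
  move=> H; apply: (le_trans (H _ _)).
  - move=> w hw; have wz := open_rect_bdry hs hw.
    have [k] : exists k, cdiff F w k; last by move=> /cdiff_ccont.
    apply: dF => //; case: hw => [[/andP[c1 c2] /andP[c3 c4]] _].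
    move: b1 b2 b3 b4 c1 c2 c3 c4; clear=> *.
    by split; apply/andP; split; lra.
  - move=> w hw; have wz := open_rect_bdry hs hw.
    have nw0 : 0 < nrm (w - z) by rewrite nrm_gt0 // subr_eq0.
    have nw : nrm (w - z) < d.
      apply: (le_lt_trans (nrm_ReIm _)); rewrite !raddfB /=.
      apply: (@le_lt_trans _ _ (s + s)); last by move: b5 sp d0; clear; lra.
      by case: hw => [[c1 c2] _]; apply: lerD; rewrite ler_distl.
    rewrite /F nrmM nrmV ler_pdivrMr //.
    rewrite -[g w - g z](subrK ((w - z) * l)) (le_trans (nrmD _ _)) //.
    by rewrite [leRHS]mulrDl lerD ?hd // nrmM mulrC.
  - move: b6; rewrite ler_pdivlMr ?mulr_gt0 // => b6.
    have -> : 4 * (1 + nrm l) * (complex.Re z + s - (complex.Re z - s) + (complex.Im z + s - (complex.Im z - s)))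
      = s * (16 * (1 + nrm l)) by ring.
    exact: b6.
have cF : bcont x1 x2 y1 y2 F.
  by move=> w hw; have [l /cdiff_ccont] := dF w (proj1 hw) (open_rect_bdry hz hw).
have ck : bcont x1 x2 y1 y2 (fun v => (v - z)^-1).
  by move=> w hw; apply: ccont_inv_sub; exact: open_rect_bdry hw.
have -> : g z * rect_winding x1 x2 y1 y2 z = rect_int (fun v => F v + g z * (v - z)^-1) x1 x2 y1 y2.
  rewrite rect_intD // ?rect_intZ // ?F0 ?add0r //.
  by move=> w hw; apply: ccontZ; exact: ck.
apply: rect_int_ext => // w hw; rewrite /F; field.
by rewrite subr_eq0; exact: open_rect_bdry hw.
Qed.

(** On each side of the boundary the integrand contributes a positive imaginary
    part. *)
Lemma rect_winding_neq0 x1 x2 y1 y2 z : open_rect x1 x2 y1 y2 z -> rect_winding x1 x2 y1 y2 z != 0.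
Proof.
case: z => zx zy hz; have [/= /andP[a1 a2] /andP[a3 a4]] := hz.
set z := zx +i* zy.
have xx : x1 <= x2 by lra.
have yy : y1 <= y2 by lra.
have ck : bcont x1 x2 y1 y2 (fun v => (v - z)^-1).
  by move=> w hw; apply: ccont_inv_sub; exact: open_rect_bdry hw.
pose D2 := (x2 - x1) ^+ 2 + (y2 - y1) ^+ 2.
pose s0 := Num.min (Num.min (zx - x1) (x2 - zx))
    (Num.min (zy - y1) (y2 - zy)).
have s00 : 0 < s0 by rewrite !min_gt0 // subr_gt0.
have : s0 <= s0 by [].
rewrite {2}/s0 !le_min => /andP[/andP[b1 b2] /andP[b3 b4]].
have D0 : 0 < D2 by rewrite /D2; nra.
pose c := s0 / D2.
have c0 : 0 < c by rewrite divr_gt0.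
(* c is a common lower bound for the contributions of the four sides: s0 bounds the
   distance from z to each side from below, and D2 bounds |v - z|^2 from above *)
have key (p q : R) : 0 < p ^+ 2 + q ^+ 2 -> p ^+ 2 <= (x2 - x1) ^+ 2 -> q ^+ 2 <= (y2 - y1) ^+ 2 ->
    (s0 <= p -> c <= p / (p ^+ 2 + q ^+ 2)) /\ (s0 <= q -> c <= q / (p ^+ 2 + q ^+ 2)).
  move=> pq0 hp hq; have le : p ^+ 2 + q ^+ 2 <= D2 by rewrite lerD.
  have li : D2^-1 <= (p ^+ 2 + q ^+ 2)^-1 by rewrite lef_pV2 ?posrE.
  by split=> h; apply: ler_pM; rewrite ?invr_ge0 ?(ltW s00) ?(ltW D0).
have sq (p q : R) : - q <= p -> p <= q -> p ^+ 2 <= q ^+ 2.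
  by move=> h1 h2; nra.
have inv (p q : R) : (p +i* q)^-1 = (p / (p ^+ 2 + q ^+ 2)) +i* (- q / (p ^+ 2 + q ^+ 2)).
  by rewrite /GRing.inv /= mulNr.
have pos1 (p q : R) : 0 < p -> 0 < p ^+ 2 + q ^+ 2.
  by move=> p0; rewrite ltr_pwDl ?sqr_ge0 // exprn_gt0.
have pos2 (p q : R) : 0 < q -> 0 < p ^+ 2 + q ^+ 2.
  by move=> p0; rewrite ltr_wpDl ?sqr_ge0 // exprn_gt0.
have subE (p q : R) : p +i* q - z = (p - zx) +i* (q - zy) by [].
suff : 0 < complex.Im (rect_winding x1 x2 y1 y2 z) by apply: contraTneq => ->; rewrite ltxx.
have h1 : c * (x2 - x1) <= complex.Im (hor_int (fun v => (v - z)^-1) y1 x1 x2).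
  apply: cint_Im_ge => // [|x /andP[l r]]; first exact: bcont_h1 ck.
  rewrite subE inv /= opprB -[y1 - zy]opprB sqrrN.
  by apply: (proj2 (key _ _ _ _ _)) => //; [apply: pos2; move: a3 a4; clear; lra|apply: sq; move: l r a1 a2; clear; lra|apply: sq; move: l r a3 a4; clear; lra].
have h2 : c * (x2 - x1) <= complex.Im (- hor_int (fun v => (v - z)^-1) y2 x1 x2).
  rewrite -[- hor_int _ _ _ _]mulN1r /hor_int -cintZ; last exact: bcont_h2 ck.
  apply: cint_Im_ge => // [|x /andP[l r]]; first by apply: cont_onZ; exact: bcont_h2 ck.
  rewrite mulN1r subE inv /= mulNr opprK.
  by apply: (proj2 (key _ _ _ _ _)) => //; [apply: pos2; move: a3 a4; clear; lra|apply: sq; move: l r a1 a2; clear; lra|apply: sq; move: l r a3 a4; clear; lra].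
have h3 : c * (y2 - y1) <= complex.Im (ver_int (fun v => (v - z)^-1) x2 y1 y2).
  rewrite /ver_int ['i * _]mulrC ImiRe.
  apply: cint_Re_ge => // [|y /andP[l r]]; first exact: bcont_v2 ck.
  rewrite subE inv /=.
  by apply: (proj1 (key _ _ _ _ _)) => //; [apply: pos1; move: a1 a2; clear; lra|apply: sq; move: l r a1 a2; clear; lra|apply: sq; move: l r a3 a4; clear; lra].
have h4 : c * (y2 - y1) <= complex.Im (- ver_int (fun v => (v - z)^-1) x1 y1 y2).
  rewrite /ver_int -mulrN [_ * (- _)]mulrC ImiRe -[- cint _ _ _]mulN1r -cintZ; last exact: bcont_v1 ck.
  apply: cint_Re_ge => // [|y /andP[l r]]; first by apply: cont_onZ; exact: bcont_v1 ck.
  rewrite mulN1r subE inv /= -mulNr opprB -[x1 - zx]opprB sqrrN.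
  by apply: (proj1 (key _ _ _ _ _)) => //; [apply: pos1; move: a1 a2; clear; lra|apply: sq; move: l r a1 a2; clear; lra|apply: sq; move: l r a3 a4; clear; lra].
rewrite /rect_winding /rect_int; rewrite !raddfD.
have : 0 < c * (x2 - x1) by rewrite mulr_gt0 // subr_gt0 (lt_trans a1).
have : 0 < c * (y2 - y1) by rewrite mulr_gt0 // subr_gt0 (lt_trans a3).
by move: h1 h2 h3 h4; clear; lra.
Qed.

(** Subdivide [0, 1] into n steps: the total variation of phi is at most C / n. *)
Lemma quad_const (phi : R -> R[i]) (C : R) : 0 <= C ->
  (forall s t, 0 <= s <= 1 -> 0 <= t <= 1 -> nrm (phi t - phi s) <= C * (t - s) ^+ 2) ->
  phi 1 = phi 0.
Proof.
move=> C0 h; apply: nrm_eq_eps => e e0.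
have C1 : 0 < C + 1 by rewrite ltr_wpDl.
have [N hN] := archi_inv (divr_gt0 e0 C1).
have := hN N (leqnn _); set n : R := N.+1%:R => ne.
have n0 : 0 < n by rewrite ltr0n.
have -> : phi 1 - phi 0 = \sum_(0 <= i < N.+1) (phi (i.+1%:R / n) - phi (i%:R / n)).
  by rewrite (telescope_sumr (fun i => phi (i%:R / n))) // mul0r divff ?gt_eqF.
apply: (le_trans (nrm_sum _ _ _)).
apply: (@le_trans _ _ (\sum_(0 <= i < N.+1) C / n ^+ 2)).
  rewrite big_nat [leRHS]big_nat; apply: ler_sum => i /andP[_ iN].
  apply: (le_trans (h _ _ _ _)).
  - by rewrite divr_ge0 ?ler0n ?(ltW n0) //= ler_pdivrMr // mul1r ler_nat ltnW.
  - by rewrite divr_ge0 ?ler0n ?(ltW n0) //= ler_pdivrMr // mul1r ler_nat.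
  - by rewrite -mulrBl -natr1 addrAC subrr add0r mul1r exprVn.
rewrite sumr_const_nat subn0 -[_ *+ _]mulr_natr -/n.
have -> : C / n ^+ 2 * n = C * n^-1 by field; rewrite gt_eqF.
apply: (@le_trans _ _ (C * (e / (C + 1)))); first by apply: ler_wpM2l => //; exact: ltW.
by rewrite mul_div_succ_le.
Qed.

(** Second order expansion of the Cauchy kernel 1 / (v - z) in z, uniform in v. *)
Lemma kernel_expand (v z w : R[i]) (d : R) : 0 < d -> d <= nrm (v - z) -> d <= nrm (v - w) ->
  nrm ((v - w)^-1 - (v - z)^-1 - (w - z) * (v - z)^-2) <= nrm (w - z) ^+ 2 / d ^+ 3.
Proof.
move=> d0 h1 h2.
have z0 : v - z != 0 by apply: contraTneq h1 => ->; rewrite nrm0 -ltNge.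
have w0 : v - w != 0 by apply: contraTneq h2 => ->; rewrite nrm0 -ltNge.
have -> : (v - w)^-1 - (v - z)^-1 - (w - z) * (v - z)^-2 =
   (w - z) ^+ 2 / ((v - z) ^+ 2 * (v - w)) by field; rewrite z0 w0.
rewrite nrmM nrmV nrmM !nrmX ler_wpM2l ?exprn_ge0 ?nrm_ge0 //.
rewrite lef_pV2 ?posrE ?mulr_gt0 ?exprn_gt0 ?(lt_le_trans d0) //.
rewrite [d ^+ 3]exprSr; apply: ler_pM => //; rewrite ?exprn_ge0 ?(ltW d0) //.
by rewrite lerXn2r ?nnegrE ?nrm_ge0 ?(ltW d0).
Qed.

Lemma kernel2_expand (v z w : R[i]) (d : R) : 0 < d -> 2 * d <= nrm (v - z) -> nrm (w - z) <= d ->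
  nrm ((v - w)^-2 - (v - z)^-2 - (w - z) * (2 * (v - z)^-3)) <= nrm (w - z) ^+ 2 * (5 / d ^+ 4).
Proof.
move=> d0 h1 h2.
have h3 : d <= nrm (v - w).
  have := nrm_trans w v z; lra.
have h1' : d <= nrm (v - z) by lra.
have z0 : v - z != 0 by apply: contraTneq h1' => ->; rewrite nrm0 -ltNge.
have w0 : v - w != 0 by apply: contraTneq h3 => ->; rewrite nrm0 -ltNge.
have -> : (v - w)^-2 - (v - z)^-2 - (w - z) * (2 * (v - z)^-3) =
   (w - z) ^+ 2 * (3 * ((v - z)^-1 ^+ 2 * (v - w)^-1 ^+ 2) - 2 * (w - z) * (v - z)^-1 * ((v - z)^-1 ^+ 2 * (v - w)^-1 ^+ 2)).
  by field; rewrite z0 w0.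
have i1 : nrm (v - z)^-1 <= d^-1 by rewrite nrmV lef_pV2 ?posrE ?(lt_le_trans d0).
have i2 : nrm (v - w)^-1 <= d^-1 by rewrite nrmV lef_pV2 ?posrE ?(lt_le_trans d0).
have i3 : nrm ((v - z)^-1 ^+ 2 * (v - w)^-1 ^+ 2) <= d^-1 ^+ 2 * d^-1 ^+ 2.
  by rewrite nrmM !nrmX; apply: ler_pM; rewrite ?exprn_ge0 ?nrm_ge0 // lerXn2r ?nnegrE ?nrm_ge0 ?invr_ge0 ?(ltW d0).
rewrite nrmM nrmX ler_wpM2l ?exprn_ge0 ?nrm_ge0 //.
have -> : 5 / d ^+ 4 = 3 * (d^-1 ^+ 2 * d^-1 ^+ 2) + 2 * d * d^-1 * (d^-1 ^+ 2 * d^-1 ^+ 2).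
  by field; rewrite gt_eqF.
rewrite (le_trans (nrmB _ _)) // lerD // nrmM ?(nrm_nat _ 3) ?ler_pM2l //.
apply: ler_pM; rewrite ?nrm_ge0 // nrmM; apply: ler_pM; rewrite ?nrm_ge0 // nrmM (nrm_nat _ 2).
by rewrite ler_pM2l.
Qed.

Definition far (S : set R[i]) (d : R) z := forall v, S v -> d <= nrm (v - z).

Lemma far_bdry x1 x2 y1 y2 z : open_rect x1 x2 y1 y2 z ->
  exists2 d : R, 0 < d & far (bdry x1 x2 y1 y2) d z.
Proof.
move=> [/andP[a1 a2] /andP[a3 a4]].
pose s0 := Num.min (Num.min (complex.Re z - x1) (x2 - complex.Re z))
    (Num.min (complex.Im z - y1) (y2 - complex.Im z)).
have s00 : 0 < s0 by rewrite !min_gt0 // subr_gt0.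
have : s0 <= s0 by [].
rewrite {2}/s0 !le_min => /andP[/andP[b1 b2] /andP[b3 b4]].
exists s0 => // v [_ hv].
have := nrm_Re (v - z); have := nrm_Im (v - z); rewrite !raddfB /= => h1 h2.
case: hv => [h|[h|[h|h]]].
- by apply: le_trans h2; rewrite h -normrN opprB (le_trans b1) // ler_norm.
- by apply: le_trans h2; rewrite h (le_trans b2) // ler_norm.
- by apply: le_trans h1; rewrite h -normrN opprB (le_trans b3) // ler_norm.
- by apply: le_trans h1; rewrite h (le_trans b4) // ler_norm.
Qed.

Lemma ccont_inv2 z w : w != z -> ccont (fun v => (v - z)^-2) w.
Proof.
move=> wz; have h : ccont (fun v => (v - z)^-1 * (v - z)^-1) w.
  by apply: ccontM; exact: ccont_inv_sub.
by move=> e e0; have [d d0 hd] := h e e0; exists d => // v /hd; rewrite -!expr2 !exprVn.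
Qed.

(** The derivative in z is the integral of (v - z)^-2, which has a primitive; so
    the variation along a segment is quadratic in the step. *)
Lemma rect_winding_const x1 x2 y1 y2 z w : open_rect x1 x2 y1 y2 z -> open_rect x1 x2 y1 y2 w ->
  rect_winding x1 x2 y1 y2 z = rect_winding x1 x2 y1 y2 w.
Proof.
move=> hz hw.
have [xx yy] : x1 <= x2 /\ y1 <= y2 by move: hz => [/andP[? ?] /andP[? ?]]; lra.
pose p (t : R) := z + t%:C * (w - z).
pose s0 (u : R[i]) := Num.min (Num.min (complex.Re u - x1) (x2 - complex.Re u))
    (Num.min (complex.Im u - y1) (y2 - complex.Im u)).
have s0p u : open_rect x1 x2 y1 y2 u -> 0 < s0 u.
  by move=> [/andP[? ?] /andP[? ?]]; rewrite !min_gt0 // subr_gt0.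
pose d := Num.min (s0 z) (s0 w).
have d0 : 0 < d by rewrite min_gt0 // s0p.
have : d <= s0 z by rewrite ge_min lexx.
rewrite /s0 !le_min => /andP[/andP[b1 b2] /andP[b3 b4]].
have : d <= s0 w by rewrite ge_min lexx orbT.
rewrite /s0 !le_min => /andP[/andP[c1 c2] /andP[c3 c4]].
have pt t : 0 <= t <= 1 -> far (bdry x1 x2 y1 y2) d (p t).
  move=> /andP[t0 t1] v [_ hv].
  have := nrm_Re (v - p t); have := nrm_Im (v - p t); rewrite !raddfB /=.
  have -> : complex.Re (p t) = complex.Re z + t * (complex.Re w - complex.Re z).
    by rewrite /p; case: (z) => ? ?; case: (w) => ? ? /=; ring.
  have -> : complex.Im (p t) = complex.Im z + t * (complex.Im w - complex.Im z).
    by rewrite /p; case: (z) => ? ?; case: (w) => ? ? /=; ring.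
  move=> h1 h2; case: hv => [h|[h|[h|h]]].
  - by apply: le_trans h2; rewrite h -normrN opprB; apply: le_trans (ler_norm _); nra.
  - by apply: le_trans h2; rewrite h; apply: le_trans (ler_norm _); nra.
  - by apply: le_trans h1; rewrite h -normrN opprB; apply: le_trans (ler_norm _); nra.
  - by apply: le_trans h1; rewrite h; apply: le_trans (ler_norm _); nra.
have far_neq u v : far (bdry x1 x2 y1 y2) d u -> bdry x1 x2 y1 y2 v -> v != u.
  move=> hu /hu hv; apply: contraTneq hv => ->; rewrite subrr nrm0 -ltNge //.
pose K := 4 * (nrm (w - z) ^+ 2 / d ^+ 3) * ((x2 - x1) + (y2 - y1)).
have K0 : 0 <= K.
  apply: mulr_ge0; last by rewrite addr_ge0 ?subr_ge0.
  by rewrite pmulr_rge0 // divr_ge0 ?exprn_ge0 ?nrm_ge0 ?(ltW d0).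
have := @quad_const (fun t => rect_winding x1 x2 y1 y2 (p t)) K K0.
have -> : p 1 = w by rewrite /p rmorph1 mul1r addrC subrK.
have -> : p 0 = z by rewrite /p rmorph0 mul0r addr0.
move=> -> // s t hs ht.
have fs := pt s hs; have ft := pt t ht.
have k1 (u : R[i]) : far (bdry x1 x2 y1 y2) d u -> bcont x1 x2 y1 y2 (fun v => (v - u)^-1).
  by move=> hu v hv; apply: ccont_inv_sub; exact: far_neq hv.
have k2 (u : R[i]) : far (bdry x1 x2 y1 y2) d u -> bcont x1 x2 y1 y2 (fun v => (v - u)^-2).
  by move=> hu v hv; apply: ccont_inv2; exact: far_neq hv.
have Z2 : rect_int (fun v => (v - p s)^-2) x1 x2 y1 y2 = 0.
  apply: (@rect_int_primitive _ _ _ _ _ xx yy _ (fun v => (-1) * (v - p s)^-1)); first exact: k2.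
  move=> v hv; have vs := far_neq _ _ fs hv.
  have := cdiffZ (-1) (cdiff_inv_sub vs); rewrite mulrA mulrNN mulr1 mul1r.
  by [].
have E : rect_winding x1 x2 y1 y2 (p t) - rect_winding x1 x2 y1 y2 (p s) =
   rect_int (fun v => (v - p t)^-1 + ((-1) * (v - p s)^-1 + (- (p t - p s)) * (v - p s)^-2)) x1 x2 y1 y2.
  rewrite rect_intD //; [|exact: k1|].
    rewrite rect_intD //; [|by move=> v hv; apply: ccontZ; exact: k1|by move=> v hv; apply: ccontZ; exact: k2].
    rewrite !rect_intZ //; [|exact: k2|exact: k1].
    by rewrite Z2 mulr0 addr0 mulN1r.
  move=> v hv; apply: ccontD; apply: ccontZ; [exact: k1|exact: k2].
have pts : nrm (p t - p s) = `|t - s| * nrm (w - z).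
  by rewrite -nrm_real -nrmM; congr nrm; rewrite /p rmorphB; ring.
rewrite E.
have -> : K * (t - s) ^+ 2 = 4 * (nrm (p t - p s) ^+ 2 / d ^+ 3) * ((x2 - x1) + (y2 - y1)).
  by rewrite pts exprMn -normrX ger0_norm ?sqr_ge0 // /K; ring.
apply: rect_int_bound => //.
  move=> v hv; apply: ccontD; first exact: k1.
  by apply: ccontD; apply: ccontZ; [exact: k1|exact: k2].
move=> v hv; rewrite mulN1r mulNr addrA.
by apply: kernel_expand => //; [exact: fs|exact: ft].
Qed.

End Cauchy.

(** * The derivative of an analytic function is analytic *)

Section AnalyticDerivative.
Context (R : realType).
Implicit Types (g : R[i] -> R[i]) (x y : R) (z w : R[i]).

Lemma cont_on_bounded (u : R -> R[i]) a b : cont_on u a b ->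
  exists2 B : R, 0 <= B & forall x, a <= x <= b -> nrm (u x) <= B.
Proof.
move=> hu.
suff [d d0 hd] : exists2 d : R, 0 < d & forall x, `[a, b]%classic x ->
    a <= x <= b -> 0 < d -> nrm (u x) <= d^-1.
  exists d^-1; first by rewrite invr_ge0 ltW.
  by move=> x xab; apply: hd; rewrite //= in_itv.
apply: compact_uniform; first exact: segment_compact.
  move=> d d' x dd' h xab d'0; have d0 := lt_le_trans d'0 dd'.
  by apply: (le_trans (h xab d0)); rewrite lef_pV2.
move=> x /=; rewrite in_itv /= => xab; have [d d0 hd] := hu x xab 1 ltr01.
have c0 : 0 < nrm (u x) + 1 by rewrite ltr_wpDl // nrm_ge0.
exists (nrm (u x) + 1)^-1; first by rewrite invr_gt0.
apply/nbhs_ballP; exists d => //= y; rewrite -ball_normE /ball_ /= distrC => /hd yx _ _.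
by rewrite invrK -[u y](subrK (u x)) (le_trans (nrmD _ _)) // addrC lerD2l.
Qed.

Lemma bdry_bounded g x1 x2 y1 y2 : x1 <= x2 -> y1 <= y2 -> bcont x1 x2 y1 y2 g ->
  exists2 B : R, 0 <= B & forall v, bdry x1 x2 y1 y2 v -> nrm (g v) <= B.
Proof.
move=> xx yy hg.
have [B1 B10 h1] := cont_on_bounded (bcont_h1 yy hg).
have [B2 B20 h2] := cont_on_bounded (bcont_h2 yy hg).
have [B3 B30 h3] := cont_on_bounded (bcont_v1 xx hg).
have [B4 B40 h4] := cont_on_bounded (bcont_v2 xx hg).
exists (B1 + B2 + (B3 + B4)); first by rewrite !addr_ge0.
move=> [p q] [[/= hp hq] [|[|[|]]]] E; rewrite E; move: (h1 p) (h2 p) (h3 q) (h4 q).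
- by move=> _ _ /(_ hq); lra.
- by move=> _ _ _ /(_ hq); lra.
- by move=> /(_ hp); lra.
- by move=> _ /(_ hp); lra.
Qed.

(** Differentiation under the integral sign. The hypothesis on k says that k2 is its
    derivative in the parameter with a quadratic error uniform on the boundary. *)
Lemma rect_int_param (k : R[i] -> R[i] -> R[i]) (k2 : R[i] -> R[i]) g z (M d : R) x1 x2 y1 y2 :
  x1 <= x2 -> y1 <= y2 -> 0 < d -> 0 <= M ->
  bcont x1 x2 y1 y2 g -> bcont x1 x2 y1 y2 k2 ->
  (forall w, nrm (w - z) < d -> bcont x1 x2 y1 y2 (fun v => k v w)) ->
  (forall v w, bdry x1 x2 y1 y2 v -> nrm (w - z) < d ->
    nrm (k v w - k v z - (w - z) * k2 v) <= nrm (w - z) ^+ 2 * M) ->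
  cdiff (fun w => rect_int (fun v => g v * k v w) x1 x2 y1 y2) z
     (rect_int (fun v => g v * k2 v) x1 x2 y1 y2).
Proof.
move=> xx yy d0 M0 hg hk2 hk hM e e0.
have [B B0 hB] := bdry_bounded xx yy hg.
pose D := (x2 - x1) + (y2 - y1).
have D0 : 0 <= D by rewrite addr_ge0 ?subr_ge0.
pose K := 4 * (B * M) * D.
have K0 : 0 <= K by rewrite mulr_ge0 // mulr_ge0 // mulr_ge0.
have K1 : 0 < K + 1 by rewrite ltr_wpDl.
exists (Num.min d (e / (K + 1))); first by rewrite min_gt0 // divr_gt0.
move=> w; rewrite lt_min => /andP[wd we].
have zd : nrm (z - z) < d by rewrite subrr nrm0.
have c1 (w' : R[i]) : nrm (w' - z) < d -> bcont x1 x2 y1 y2 (fun v => g v * k v w').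
  by move=> /hk h v hv; apply: ccontM; [exact: hg|exact: h].
have c2 : bcont x1 x2 y1 y2 (fun v => g v * k2 v).
  by move=> v hv; apply: ccontM; [exact: hg|exact: hk2].
have -> : rect_int (fun v => g v * k v w) x1 x2 y1 y2 - rect_int (fun v => g v * k v z) x1 x2 y1 y2
    - (w - z) * rect_int (fun v => g v * k2 v) x1 x2 y1 y2 =
   rect_int (fun v => g v * k v w + ((-1) * (g v * k v z) + (- (w - z)) * (g v * k2 v))) x1 x2 y1 y2.
  rewrite rect_intD //; [|exact: c1|].
    rewrite rect_intD //; [|by move=> v hv; apply: ccontZ; exact: c1|by move=> v hv; apply: ccontZ; exact: c2].
    by rewrite !rect_intZ //; [ring|exact: c1].
  by move=> v hv; apply: ccontD; apply: ccontZ; [exact: c1|exact: c2].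
apply: (@le_trans _ _ (4 * (B * (nrm (w - z) ^+ 2 * M)) * D)).
  apply: rect_int_bound => //.
    move=> v hv; apply: ccontD; first exact: c1.
    by apply: ccontD; apply: ccontZ; [exact: c1|exact: c2].
  move=> v hv.
  have -> : g v * k v w + (-1 * (g v * k v z) + - (w - z) * (g v * k2 v)) =
     g v * (k v w - k v z - (w - z) * k2 v) by ring.
  by rewrite nrmM; apply: ler_pM; rewrite ?nrm_ge0 ?hB ?hM.
have -> : 4 * (B * (nrm (w - z) ^+ 2 * M)) * D = K * nrm (w - z) * nrm (w - z) by rewrite /K; ring.
apply: ler_wpM2r; first exact: nrm_ge0.
apply: (@le_trans _ _ (K * (e / (K + 1)))); first by apply: ler_wpM2l => //; exact: ltW.
by rewrite mul_div_succ_le.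
Qed.

Lemma ccont_inv3 z w : w != z -> ccont (fun v => 2 * (v - z)^-3) w.
Proof.
move=> wz; have h : ccont (fun v => 2 * ((v - z)^-1 * (v - z)^-2)) w.
  by apply: ccontZ; apply: ccontM; [exact: ccont_inv_sub|exact: ccont_inv2].
by move=> e e0; have [d d0 hd] := h e e0; exists d => // v /hd; rewrite -!invfM -!exprS.
Qed.

(** Cauchy's formula on a small square writes g, hence its derivative, as an integral
    in which the parameter occurs only in the kernel. *)
Lemma analytic_deriv g g' z (r : R) : 0 < r ->
  (forall w, nrm (w - z) < r -> cdiff g w (g' w)) -> exists l, cdiff g' z l.
Proof.
move=> r0 hg; pose s := r / 3.
have s0 : 0 < s by rewrite divr_gt0.
have s3 : s * 3 = r by rewrite /s divfK.
pose x1 := complex.Re z - s; pose x2 := complex.Re z + s.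
pose y1 := complex.Im z - s; pose y2 := complex.Im z + s.
have xx : x1 <= x2 by rewrite /x1 /x2; lra.
have yy : y1 <= y2 by rewrite /y1 /y2; lra.
have hr w : rect x1 x2 y1 y2 w -> nrm (w - z) < r.
  move=> [a1 a2]; apply: (le_lt_trans (nrm_ReIm _)); rewrite !raddfB /=.
  apply: (@le_lt_trans _ _ (s + s)); last by move: s0 s3; clear; lra.
  by apply: lerD; rewrite ler_distl.
have hi w : nrm (w - z) < s -> open_rect x1 x2 y1 y2 w.
  move=> h; have := le_lt_trans (nrm_Re (w - z)) h; have := le_lt_trans (nrm_Im (w - z)) h.
  rewrite !ltr_norml !raddfB /= /x1 /x2 /y1 /y2 => /andP[a1 a2] /andP[a3 a4].
  by split; apply/andP; split; lra.
have hz : open_rect x1 x2 y1 y2 z by apply: hi; rewrite subrr nrm0.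
have [d d0 hd] := far_bdry hz.
have d20 : 0 < d / 2 by rewrite divr_gt0.
have cg : bcont x1 x2 y1 y2 g.
  by move=> v [/hr/hg/cdiff_ccont].
set kz := rect_winding x1 x2 y1 y2 z.
have k0 : kz != 0 by exact: rect_winding_neq0.
have far2 w : nrm (w - z) < d / 2 -> far (bdry x1 x2 y1 y2) (d / 2) w.
  by move=> h v /hd hv; have := nrm_trans w v z; lra.
have far_neq v u (d' : R) : 0 < d' -> far (bdry x1 x2 y1 y2) d' u -> bdry x1 x2 y1 y2 v -> v != u.
  by move=> d'0 hu /hu hv; apply: contraTneq hv => ->; rewrite subrr nrm0 -ltNge.
(* on the square, g is a constant times the Cauchy integral of its boundary values;
   this is then differentiated twice *)
have gE w : nrm (w - z) < s -> g w = kz^-1 * rect_int (fun v => g v * (v - w)^-1) x1 x2 y1 y2.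
  move=> h; have hw := hi w h.
  rewrite (@Cauchy_formula _ g x1 x2 y1 y2 w hw).
    by rewrite (rect_winding_const hw hz) -/kz mulrC mulfK.
  by move=> v /hr/hg ?; exists (g' v).
have dP w : nrm (w - z) < s -> cdiff (fun w => rect_int (fun v => g v * (v - w)^-1) x1 x2 y1 y2) w
   (rect_int (fun v => g v * (v - w)^-2) x1 x2 y1 y2).
  move=> hw; have [c c0 hc] := far_bdry (hi w hw).
  have c20 : 0 < c / 2 by rewrite divr_gt0.
  have farc u : nrm (u - w) < c / 2 -> far (bdry x1 x2 y1 y2) (c / 2) u.
    by move=> h v /hc hv; have := nrm_trans u v w; lra.
  apply: (@rect_int_param (fun v w => (v - w)^-1) (fun v => (v - w)^-2) g w ((c / 2) ^- 3) (c / 2)) => //.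
  - by rewrite invr_ge0 exprn_ge0 // ltW.
  - by move=> v hv; apply: ccont_inv2; exact: far_neq c0 hc hv.
  - by move=> u /farc hu v hv; apply: ccont_inv_sub; exact: far_neq c20 hu hv.
  - move=> v u hv /farc hu; apply: kernel_expand => //; last exact: hu.
    by have := hc v hv; lra.
have g'E w : nrm (w - z) < s -> kz^-1 * rect_int (fun v => g v * (v - w)^-2) x1 x2 y1 y2 = g' w.
  move=> hw; have hwr : nrm (w - z) < r by lra.
  apply: (cdiff_unique _ (hg w hwr)).
  apply: (@cdiff_local _ _ _ _ _ (s - nrm (w - z)) _ _ (cdiffZ kz^-1 (dP w hw))).
    by rewrite subr_gt0.
  move=> u hu; rewrite -gE //.
  by have := nrm_trans w u z; lra.
exists (kz^-1 * rect_int (fun v => g v * (2 * (v - z)^-3)) x1 x2 y1 y2).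
apply: (@cdiff_local _ (fun w => kz^-1 * rect_int (fun v => g v * (v - w)^-2) x1 x2 y1 y2) _ _ _ s s0).
  exact: g'E.
apply: cdiffZ.
apply: (@rect_int_param (fun v w => (v - w)^-2) (fun v => 2 * (v - z)^-3) g z (5 / (d / 2) ^+ 4) (d / 2)) => //.
- by rewrite divr_ge0 // exprn_ge0 // ltW.
- by move=> v hv; apply: ccont_inv3; exact: far_neq d0 hd hv.
- by move=> u /far2 hu v hv; apply: ccont_inv2; exact: far_neq d20 hu hv.
- move=> v u hv hu; apply: kernel2_expand => //; last exact: ltW.
  by have := hd v hv; lra.
Qed.

End AnalyticDerivative.

(** * Runge's theorem *)

Section Runge.
Context (R : realType).
Implicit Types (F g : R[i] -> R[i]) (K G : set R[i]) (z w v : R[i]) (a b : R).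

Lemma cont_on_unif (u : R -> R[i]) a b : cont_on u a b -> forall e : R, 0 < e ->
  exists2 d : R, 0 < d & forall x y, a <= x <= b -> a <= y <= b -> `|x - y| < d -> nrm (u x - u y) <= e.
Proof.
move=> hu e e0.
suff [d d0 hd] : exists2 d : R, 0 < d & forall y, `[a, b]%classic y ->
    a <= y <= b -> forall x, a <= x <= b -> `|x - y| < d -> nrm (u x - u y) <= e.
  by exists d => // x y xab yab; apply: hd; rewrite //= in_itv.
apply: compact_uniform; first exact: segment_compact.
  by move=> d d' y dd' h yab x xab xy; exact: h yab x xab (lt_le_trans xy dd').
move=> x /=; rewrite in_itv /= => xab.
have [d d0 hd] := hu x xab (e / 2) (divr_gt0 e0 (ltr0Sn _ 1)).
have d20 : 0 < d / 2 by rewrite divr_gt0.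
exists (d / 2) => //.
apply/nbhs_ballP; exists (d / 2) => //= y; rewrite -ball_normE /ball_ /= => xy _ t _ ty.
rewrite (le_trans (nrm_trans (u x) _ _)) // [leRHS]splitr lerD //.
  apply: hd; rewrite (le_lt_trans (ler_distD y _ _)) // [ltRHS]splitr ltrD //.
  by rewrite distrC.
by rewrite nrmC; apply: hd; rewrite distrC; lra.
Qed.

(** The Cauchy transform of F along p, with respect to the parameter of p: for a
    vertical side the factor 'i of dv is put in by hand. *)
Definition cauchy_int F (p : R -> R[i]) a b z := cint (fun x => F (p x) / (p x - z)) a b.

Section Edge.
Context (F : R[i] -> R[i]) (p : R -> R[i]) (a b : R).
Hypotheses (ab : a <= b) (p_lip : forall s t, nrm (p s - p t) <= `|s - t|).
Hypothesis F_cont : forall x, a <= x <= b -> ccont F (p x).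

Lemma path_cont (H : R[i] -> R[i]) : (forall x, a <= x <= b -> ccont H (p x)) ->
  cont_on (fun x => H (p x)) a b.
Proof.
move=> h x xab e e0; have [d d0 hd] := h x xab e e0.
by exists d => // y yx; apply: hd; exact: le_lt_trans (p_lip _ _) yx.
Qed.

Lemma cauchy_int_integrand z (d : R) : 0 < d -> (forall x, a <= x <= b -> d <= nrm (p x - z)) ->
  cont_on (fun x => F (p x) / (p x - z)) a b.
Proof.
move=> d0 hd; apply: (@path_cont (fun v => F v / (v - z))) => x xab.
apply: ccontM; first exact: F_cont.
apply: ccont_inv_sub; have := hd x xab; apply: contraTneq => ->.
by rewrite subrr nrm0 -ltNge.
Qed.

Lemma inv_diff (v v' : R[i]) (d : R) : 0 < d -> d <= nrm v -> d <= nrm v' ->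
  nrm (v^-1 - v'^-1) <= nrm (v - v') / d ^+ 2.
Proof.
move=> d0 h h'.
have v0 : v != 0 by apply: contraTneq h => ->; rewrite nrm0 -ltNge.
have v'0 : v' != 0 by apply: contraTneq h' => ->; rewrite nrm0 -ltNge.
have -> : v^-1 - v'^-1 = (v' - v) / (v * v') by field; rewrite v0 v'0.
rewrite nrmM nrmV nrmM cnrmC ler_wpM2l ?nrm_ge0 // lef_pV2 ?posrE ?mulr_gt0 ?exprn_gt0 ?(lt_le_trans d0) //.
by rewrite expr2; apply: ler_pM => //; exact: ltW.
Qed.

Lemma cauchy_int_cont z (d : R) : 0 < d -> (forall x, a <= x <= b -> d <= nrm (p x - z)) ->
  ccont (cauchy_int F p a b) z.
Proof.
move=> d0 hd e e0.
have [B B0 hB] := cont_on_bounded (path_cont F_cont).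
have d20 : 0 < d / 2 by rewrite divr_gt0.
pose C := 2 * (B / (d / 2) ^+ 2) * (b - a).
have C0 : 0 <= C.
  by rewrite /C !mulr_ge0 ?subr_ge0 // ?invr_ge0 ?exprn_ge0 // ltW.
have C1 : 0 < C + 1 by rewrite ltr_wpDl.
exists (Num.min (d / 2) (e / (C + 1))); first by rewrite min_gt0 // divr_gt0.
move=> w; rewrite lt_min => /andP[wd we].
have hw x : a <= x <= b -> d / 2 <= nrm (p x - w).
  by move=> /hd h; have := nrm_trans w (p x) z; lra.
have hz x : a <= x <= b -> d / 2 <= nrm (p x - z) by move=> /hd; lra.
have cz := cauchy_int_integrand d0 hd; have cw := cauchy_int_integrand d20 hw.
have -> : cauchy_int F p a b w - cauchy_int F p a b z =
   cint (fun x => F (p x) / (p x - w) + (-1) * (F (p x) / (p x - z))) a b.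
  by rewrite cintD ?cintZ ?mulN1r //; exact: cont_onZ.
apply: (@le_trans _ _ (2 * (B * (nrm (w - z) / (d / 2) ^+ 2)) * (b - a))).
  apply: cint_bound => //; first by apply: cont_onD => //; exact: cont_onZ.
  move=> x xab; rewrite mulN1r -mulrBr nrmM; apply: ler_pM; rewrite ?nrm_ge0 ?hB //.
  apply: (le_trans (inv_diff d20 (hw x xab) (hz x xab))).
  have -> : p x - w - (p x - z) = z - w by ring.
  by rewrite (cnrmC z w); exact: lexx.
have -> : 2 * (B * (nrm (w - z) / (d / 2) ^+ 2)) * (b - a) = C * nrm (w - z) by rewrite /C; ring.
apply: (@le_trans _ _ (C * (e / (C + 1)))); first by apply: ler_wpM2l => //; exact: ltW.
by rewrite mul_div_succ_le.
Qed.

End Edge.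

Lemma cint_cst (k : R[i]) a b : a <= b -> cint (fun=> k) a b = (b - a)%:C * k.
Proof.
move=> ab; rewrite (@cint_FTC _ (fun x => x%:C * k)) //.
- by rewrite rmorphB mulrBl.
- by move=> x _ e e0; exists 1 => // y _; rewrite subrr nrm0 ltW.
- move=> x _ e e0; exists 1 => // h _.
  have -> : (x + h)%:C * k - x%:C * k - h%:C * k = 0 by rewrite rmorphD; ring.
  by rewrite nrm0 mulr_ge0 // ltW.
Qed.

Lemma cint_sum (u : R -> R[i]) a (h : R) n : 0 <= h -> cont_on u a (a + n%:R * h) ->
  cint u a (a + n%:R * h) = \sum_(0 <= i < n) cint u (a + i%:R * h) (a + i.+1%:R * h).
Proof.
move=> h0; elim: n => [|n IH] hu; first by rewrite big_nil mul0r addr0 cintxx.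
have le1 : a + n%:R * h <= a + n.+1%:R * h by rewrite lerD2l ler_wpM2r // ler_nat.
rewrite big_nat_recr //= -IH; last exact: cont_onS hu.
by rewrite -cint_cat // lerDl mulr_ge0.
Qed.

Lemma forall_map (f : nat -> R[i] * R[i]) (P : R[i] * R[i] -> Prop) (r : seq nat) :
  (forall i, i \in r -> P (f i)) -> forall q, q \in map f r -> P q.
Proof. by move=> h q /mapP[i ir ->]; exact: h. Qed.

(** E is, uniformly on K, a limit of sums of simple fractions with poles off K. *)
Definition cauchy_approx K (E : R[i] -> R[i]) := forall e : R, 0 < e ->
  exists2 s : seq (R[i] * R[i]), (forall q, q \in s -> ~ K q.1) &
   forall z, K z -> nrm (E z - \sum_(q <- s) q.2 / (q.1 - z)) <= e.

Lemma cauchy_approx_ext K E E' : (forall z, K z -> E z = E' z) ->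
  cauchy_approx K E -> cauchy_approx K E'.
Proof. by move=> h hE e /hE[s s1 s2]; exists s => // z Kz; rewrite -h // s2. Qed.

Lemma cauchy_approx0 K : cauchy_approx K (fun=> 0).
Proof. by move=> e e0; exists [::] => // z _; rewrite big_nil subrr nrm0 ltW. Qed.

Lemma cauchy_approxD K E E' : cauchy_approx K E -> cauchy_approx K E' ->
  cauchy_approx K (fun z => E z + E' z).
Proof.
move=> h h' e e0; have e2 : 0 < e / 2 by rewrite divr_gt0.
have [s s1 s2] := h _ e2; have [t t1 t2] := h' _ e2.
exists (s ++ t); first by move=> q; rewrite mem_cat => /orP[/s1|/t1].
move=> z Kz; rewrite big_cat /= opprD addrACA (le_trans (nrmD _ _)) // [leRHS]splitr lerD //.
  exact: s2.
exact: t2.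
Qed.

Lemma cauchy_approxZ K E (k : R[i]) : cauchy_approx K E -> cauchy_approx K (fun z => k * E z).
Proof.
move=> h e e0; have k1 : 0 < nrm k + 1 by rewrite ltr_wpDl // nrm_ge0.
have [s s1 s2] := h _ (divr_gt0 e0 k1).
exists [seq (q.1, k * q.2) | q <- s]; first by move=> q /mapP[q' /s1 ? ->].
move=> z Kz; rewrite big_map /=.
under eq_bigr do rewrite -mulrA.
rewrite -mulr_sumr -mulrBr nrmM.
apply: (@le_trans _ _ (nrm k * (e / (nrm k + 1)))); first by rewrite ler_wpM2l ?nrm_ge0 ?s2.
by rewrite mul_div_succ_le.
Qed.

Lemma cauchy_approx_sum K m n (E : nat -> R[i] -> R[i]) :
  (forall i, (i < n)%N -> cauchy_approx K (E i)) ->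
  cauchy_approx K (fun z => \sum_(m <= i < n) E i z).
Proof.
elim: n => [|n IH] h.
  by apply: cauchy_approx_ext (@cauchy_approx0 K) => z _; rewrite big_geq.
have [mn|mn] := leqP m n; last first.
  by apply: cauchy_approx_ext (@cauchy_approx0 K) => z _; rewrite big_geq.
apply: (@cauchy_approx_ext _ (fun z => \sum_(m <= i < n) E i z + E n z)).
  by move=> z _; rewrite big_nat_recr.
by apply: cauchy_approxD; [apply: IH => i ?; apply: h; exact: ltnW|exact: h].
Qed.

Section EdgeApprox.
Context (F : R[i] -> R[i]) (p : R -> R[i]) (a b : R) (K : set R[i]).
Hypotheses (ab : a <= b) (p_lip : forall s t, nrm (p s - p t) <= `|s - t|).
Hypothesis F_cont : forall x, a <= x <= b -> ccont F (p x).

Lemma edge_far : (forall z, ~ K z -> exists2 r : R, 0 < r & forall w, nrm (w - z) < r -> ~ K w) ->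
  (forall x, a <= x <= b -> ~ K (p x)) ->
  exists2 d : R, 0 < d & forall x z, a <= x <= b -> K z -> d <= nrm (p x - z).
Proof.
move=> Kc pK.
suff [d d0 hd] : exists2 d : R, 0 < d & forall x, `[a, b]%classic x ->
    a <= x <= b -> forall z, K z -> d <= nrm (p x - z).
  by exists d => // x z xab; apply: hd; rewrite //= in_itv.
apply: compact_uniform; first exact: segment_compact.
  by move=> d d' x dd' h xab z Kz; exact: le_trans dd' (h xab z Kz).
move=> x /=; rewrite in_itv /= => xab; have [r r0 hr] := Kc _ (pK x xab).
have r20 : 0 < r / 2 by rewrite divr_gt0.
exists (r / 2) => //; apply/nbhs_ballP; exists (r / 2) => //= y.
rewrite -ball_normE /ball_ /= => xy _ z Kz.
have : r <= nrm (z - p x) by rewrite leNgt; apply/negP => /hr.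
have := nrm_trans (p y) z (p x); have := p_lip y x; rewrite (distrC y) (cnrmC z (p y)); lra.
Qed.

(** The approximating sums are Riemann sums of the integral: their poles lie on the
    path, and they converge uniformly as z stays away from it. *)
Lemma edge_approx (d : R) : 0 < d -> (forall x z, a <= x <= b -> K z -> d <= nrm (p x - z)) ->
  cauchy_approx K (cauchy_int F p a b).
Proof.
move=> d0 hd e e0.
have [B B0 hB] := cont_on_bounded (path_cont p_lip F_cont).
have L1 : 0 < 2 * (b - a) + 1 by rewrite ltr_wpDl // mulr_ge0 // subr_ge0.
pose eta := e / (2 * (b - a) + 1).
have eta0 : 0 < eta by rewrite divr_gt0.
have [d1 d10 hd1] := cont_on_unif (path_cont p_lip F_cont) (mulr_gt0 d0 (divr_gt0 eta0 (ltr0Sn _ 1))).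
have B1 : 0 < B + 1 by rewrite ltr_wpDl.
pose d2 := eta / 2 / (B + 1) * d ^+ 2.
have d20 : 0 < d2 by rewrite mulr_gt0 ?exprn_gt0 // !divr_gt0.
have ba1 : 0 < b - a + 1 by rewrite ltr_wpDl // subr_ge0.
have [N hN] : exists N, forall n, (N <= n)%N -> n.+1%:R^-1 < Num.min d1 d2 / (b - a + 1).
  by apply: archi_inv; rewrite divr_gt0 // min_gt0.
have := hN N (leqnn _); set n : R := N.+1%:R => hn.
have n0 : 0 < n by rewrite ltr0n.
pose h := (b - a) / n.
have h0 : 0 <= h by rewrite divr_ge0 ?subr_ge0 // ltW.
have hh : h < Num.min d1 d2.
  have : (b - a + 1) * n^-1 < Num.min d1 d2 by rewrite mulrC -ltr_pdivlMr.
  apply: le_lt_trans; apply: ler_wpM2r; first by rewrite invr_ge0 ltW.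
  by rewrite lerDl.
move: hh; rewrite lt_min => /andP[hd1' hd2'].
have bE : b = a + N.+1%:R * h by rewrite /h -/n mulrC divfK ?gt_eqF // addrC subrK.
pose x i := a + i%:R * h.
have xab i : (i <= N.+1)%N -> a <= x i <= b.
  move=> iN; rewrite bE lerDl mulr_ge0 //= lerD2l ler_wpM2r // ler_nat //.
have xS i : x i.+1 - x i = h by rewrite /x -natr1; ring.
exists [seq (p (x i), h%:C * F (p (x i))) | i <- index_iota 0 N.+1].
  apply: (@forall_map _ (fun q => ~ K q.1)) => i; rewrite mem_index_iota => /andP[_ iN] Kp.
  by have := hd (x i) _ (xab i (ltnW iN)) Kp; rewrite subrr nrm0 leNgt d0.
move=> z Kz; rewrite big_map.
have hz t : a <= t <= b -> d <= nrm (p t - z) by move=> tab; exact: hd.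
have ci := cauchy_int_integrand p_lip F_cont d0 hz.
have -> : cauchy_int F p a b z = cint (fun t => F (p t) / (p t - z)) a (a + N.+1%:R * h) by rewrite -bE.
rewrite cint_sum //; last by rewrite -bE.
rewrite -sumrB; apply: (le_trans (nrm_sum _ _ _)).
apply: (@le_trans _ _ (\sum_(0 <= i < N.+1) 2 * eta * h)); last first.
  rewrite sumr_const_nat subn0 -[_ *+ _]mulr_natr -/n /h.
  have -> : 2 * eta * ((b - a) / n) * n = eta * (2 * (b - a)) by field; rewrite gt_eqF.
  by rewrite /eta mulrAC -mulrA ger_pMr // ler_pdivrMr // mul1r lerDl.
rewrite big_nat [leRHS]big_nat; apply: ler_sum => i /andP[_ iN].
have /andP[i1 _] := xab i (ltnW iN); have /andP[_ i2] := xab i.+1 iN.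
have xx : x i <= x i.+1 by rewrite -subr_ge0 xS.
have c1 : cont_on (fun t => F (p t) / (p t - z)) (x i) (x i.+1) by exact: cont_onS ci.
pose k := F (p (x i)) / (p (x i) - z).
have cc : cont_on (fun=> - k) (x i) (x i.+1).
  by move=> t _ e' e'0; exists 1 => // t' _; rewrite subrr nrm0 ltW.
have -> : cint (fun t => F (p t) / (p t - z)) (a + i%:R * h) (a + i.+1%:R * h) -
    (p (x i), h%:C * F (p (x i))).2 / ((p (x i), h%:C * F (p (x i))).1 - z) =
    cint (fun t => F (p t) / (p t - z) + - k) (x i) (x i.+1).
  rewrite cintD // cint_cst // xS mulrN /k; congr (_ - _) => /=.
  by rewrite [RHS]mulrA.
rewrite -(xS i); apply: cint_bound => //; first exact: cont_onD.
move=> t /andP[t1 t2].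
have tab : a <= t <= b by rewrite (le_trans i1 t1) (le_trans t2 i2).
have xi : a <= x i <= b by exact: xab (ltnW iN).
have tx : `|t - x i| <= h by rewrite ger0_norm ?subr_ge0 // -(xS i) lerD2r.
have -> : F (p t) / (p t - z) + - k =
   (F (p t) - F (p (x i))) / (p t - z) + F (p (x i)) * ((p t - z)^-1 - (p (x i) - z)^-1).
  by rewrite /k; ring.
rewrite (le_trans (nrmD _ _)) // [leRHS]splitr lerD //.
  rewrite nrmM nrmV ler_pdivrMr ?(lt_le_trans d0 (hz t tab)) //.
  apply: (@le_trans _ _ (d * (eta / 2))); first by apply: hd1 => //; exact: le_lt_trans tx _.
  by rewrite mulrC ler_wpM2l ?hz // ltW // divr_gt0.
rewrite nrmM; apply: (@le_trans _ _ ((B + 1) * (d2 / d ^+ 2))).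
  apply: ler_pM; rewrite ?nrm_ge0 //; first by rewrite (le_trans (hB _ xi)) // lerDl.
  apply: (le_trans (inv_diff d0 (hz t tab) (hz _ xi))).
  rewrite ler_wpM2r ?invr_ge0 ?exprn_ge0 ?(ltW d0) //.
  have -> : p t - z - (p (x i) - z) = p t - p (x i) by ring.
  by rewrite (le_trans (p_lip _ _)) // (le_trans tx) // ltW.
rewrite /d2 mulfK ?expf_neq0 ?gt_eqF // mulrC divfK // gt_eqF //.
Qed.

End EdgeApprox.

(** Collects the two integrals along an edge shared by adjacent cells of a grid: the
    coefficient of the edge is the difference of the coefficients of the cells. *)
Lemma abel_sum (A H : nat -> R[i]) n :
  \sum_(0 <= j < n.+1) A j * (H j - H j.+1) =
  A 0%N * H 0%N - A n * H n.+1 + \sum_(0 <= j < n) (A j.+1 - A j) * H j.+1.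
Proof.
elim: n => [|n IH]; first by rewrite big_nat1 big_geq // addr0; ring.
by rewrite big_nat_recr //= IH [in RHS]big_nat_recr //=; ring.
Qed.

Lemma find_cell (x : nat -> R) (r : R) n : x 0%N <= r <= x n.+1 ->
  exists2 i, (i <= n)%N & x i <= r <= x i.+1.
Proof.
elim: n => [|n IH] /andP[h1 h2]; first by exists 0%N => //; apply/andP.
have [h|h] := leP r (x n.+1); last by exists n.+1 => //; rewrite h2 ltW.
by have [i iN hi] := IH (introT andP (conj h1 h)); exists i => //; exact: leqW.
Qed.

End Runge.

Section RungeTheorem.
Context (R : realType).
Implicit Types (g : R[i] -> R[i]) (K G : set R[i]) (z w v : R[i]).

(** Closedness in terms of the real-valued norm. *)
Definition is_closed K := forall z, ~ K z ->
  exists2 r : R, 0 < r & forall w, nrm (w - z) < r -> ~ K w.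

Lemma ccont_ext (F F' : R[i] -> R[i]) z : (forall w, F w = F' w) -> ccont F z -> ccont F' z.
Proof. by move=> h; have -> : F' = F by apply/funext => w; rewrite h. Qed.

Lemma ccont_sum m n (E : nat -> R[i] -> R[i]) z :
  (forall i, (i < n)%N -> ccont (E i) z) -> ccont (fun w => \sum_(m <= i < n) E i w) z.
Proof.
elim: n => [|n IH] h.
  by apply: ccont_ext (ccont_cst 0 z) => w; rewrite big_geq.
have [mn|mn] := leqP m n; last first.
  by apply: ccont_ext (ccont_cst 0 z) => w; rewrite big_geq.
apply: (@ccont_ext (fun z => \sum_(m <= i < n) E i z + E n z)).
  by move=> w; rewrite big_nat_recr.
by apply: ccontD; [apply: IH => i ?; apply: h; exact: ltnW|exact: h].
Qed.

(** Take a grid so fine that the cells meeting K lie in G. By Cauchy's formula, the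
    sum of the integrals of g v / (v - z) over the boundaries of the cells meeting K is
    a constant times g z when z is inside one of them. After cancellation only edges
    that separate a cell meeting K from one that does not remain; they miss K, so the
    sum is approximable by edge_approx and continuous on K. The latter extends the
    identity to the points of K that lie on the grid. *)
Theorem Runge K G g (B delta : R) : 0 <= B -> 0 < delta ->
  (forall z, K z -> nrm z <= B) -> is_closed K ->
  (forall z w, K z -> nrm (w - z) < delta -> G w) ->
  (forall z, G z -> exists l, cdiff g z l) -> cauchy_approx K g.
Proof.
move=> B0 delta0 KB Kc KG gG.
(* the margin 1 > h keeps the outermost cells away from K *)
pose L := B + 1.
have L0 : 0 < L by rewrite /L ltr_wpDl.
have [N hN] : exists N, forall n, (N <= n)%N -> n.+1%:R^-1 < Num.min (delta / 2) 1 / (2 * L).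
  by apply: archi_inv; rewrite divr_gt0 ?mulr_gt0 // min_gt0 // divr_gt0.
have := hN N (leqnn _); set n := N; set nn : R := n.+1%:R => hn.
have nn0 : 0 < nn by rewrite ltr0n.
pose h := 2 * L / nn.
have h0 : 0 < h by rewrite divr_gt0 // mulr_gt0.
have : h < Num.min (delta / 2) 1 by rewrite /h mulrC -ltr_pdivlMr // mulr_gt0.
rewrite lt_min => /andP[hdelta h1].
pose x (i : nat) := - L + i%:R * h.
have x0 : x 0%N = - L by rewrite /x mul0r addr0.
have xn : x n.+1 = L by rewrite /x /h -/nn mulrC divfK ?gt_eqF //; lra.
have xS i : x i.+1 = x i + h by rewrite /x -natr1; ring.
have xle i j : (i <= j)%N -> x i <= x j.
  by move=> ij; rewrite /x lerD2l ler_wpM2r ?ler_nat // ltW.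
pose cell i j := rect (x i) (x i.+1) (x j) (x j.+1).
pose meets i j := exists z, K z /\ cell i j z.
pose a i j : R[i] := if `[< meets i j >] then 1 else 0.
have a1 i j : meets i j -> a i j = 1 by move=> /asboolP; rewrite /a => ->.
have a0 i j : ~ meets i j -> a i j = 0 by move=> /asboolPn; rewrite /a => /negbTE ->.
have Kco z : K z -> [/\ - B <= complex.Re z, complex.Re z <= B, - B <= complex.Im z & complex.Im z <= B].
  move=> /KB Kz; have := le_trans (nrm_Re z) Kz; have := le_trans (nrm_Im z) Kz.
  by rewrite !ler_norml => /andP[? ?] /andP[? ?].
have xnh : x n = L - h by rewrite -xn xS addrK.
have a0j j : a 0%N j = 0.
  by apply: a0 => -[z [/Kco[k1 k2 k3 k4] [/andP[]]]]; rewrite xS x0 /L; lra.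
have anj j : a n j = 0.
  by apply: a0 => -[z [/Kco[k1 k2 k3 k4] [/andP[]]]]; rewrite xnh /L; lra.
have ai0 i : a i 0%N = 0.
  by apply: a0 => -[z [/Kco[k1 k2 k3 k4] [_ /andP[]]]]; rewrite xS x0 /L; lra.
have ain i : a i n = 0.
  by apply: a0 => -[z [/Kco[k1 k2 k3 k4] [_ /andP[]]]]; rewrite xnh /L; lra.
have near i j v w : cell i j v -> cell i j w -> nrm (v - w) < delta.
  rewrite /cell !xS => hv hw; apply: (le_lt_trans (rect_diam hv hw)).
  by rewrite [ltRHS]splitr ltrD.
have cellG i j v : meets i j -> cell i j v -> G v.
  by move=> [z [Kz cz]] cv; apply: KG Kz _; exact: near cv cz.
pose H i j z := cauchy_int g (fun t => t +i* x j) (x i) (x i.+1) z.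
pose V i j z := 'i * cauchy_int g (fun t => x i +i* t) (x j) (x j.+1) z.
pose rc i j z := rect_int (fun v => g v / (v - z)) (x i) (x i.+1) (x j) (x j.+1).
have rcE i j z : rc i j z = (H i j z - H i j.+1 z) - (V i j z - V i.+1 j z).
  by rewrite /rc /rect_int /hor_int /ver_int /H /V /cauchy_int; ring.
pose E z := \sum_(0 <= i < n.+1) \sum_(0 <= j < n.+1) a i j * rc i j z.
pose E' z := \sum_(0 <= i < n.+1) \sum_(0 <= j < n) (a i j.+1 - a i j) * H i j.+1 z
   + (-1) * \sum_(0 <= j < n.+1) \sum_(0 <= i < n) (a i.+1 j - a i j) * V i.+1 j z.
(* the coefficients of the outermost cells are zero, so Abel summation leaves no edge
   on the border of the grid *)
have EE' z : E z = E' z.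
  rewrite /E /E'.
  under eq_bigr do under eq_bigr do rewrite rcE mulrBr.
  under eq_bigr do rewrite sumrB.
  rewrite sumrB mulN1r [X in _ - X = _]exchange_big /=; congr (_ - _); apply: eq_bigr => i _.
    by rewrite (abel_sum (fun j => a i j) (fun j => H i j z)) ai0 ain !mul0r subrr add0r.
  by rewrite (abel_sum (fun j => a j i) (fun j => V j i z)) a0j anj !mul0r subrr add0r.
(* of the two cells adjacent to an edge with a nonzero coefficient, one meets K and
   the other does not *)
have edge i j i' j' v : a i j - a i' j' != 0 -> cell i j v -> cell i' j' v ->
    ~ K v /\ ccont g v.
  move=> an cv cv'; split.
    move=> Kv; move: an; rewrite !a1 ?subrr ?eqxx //; by exists v.
  have [m|m] := pselect (meets i j).
    by have [l /cdiff_ccont] := gG v (cellG _ _ _ m cv).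
  have [m'|m'] := pselect (meets i' j').
    by have [l /cdiff_ccont] := gG v (cellG _ _ _ m' cv').
  by move: an; rewrite !a0 // subrr eqxx.
have xx i : x i <= x i.+1 by exact: xle.
have lipH (y s t : R) : nrm (s +i* y - t +i* y) <= `|s - t|.
  have -> : s +i* y - t +i* y = (s - t)%:C by apply: complex_ReIm_inj => /=; ring.
  by rewrite nrm_real.
have lipV (y s t : R) : nrm (y +i* s - y +i* t) <= `|s - t|.
  have -> : y +i* s - y +i* t = 'i * (s - t)%:C by apply: complex_ReIm_inj => /=; ring.
  by rewrite nrmM nrm_i mul1r nrm_real.
have inH i j t : x i <= t <= x i.+1 -> cell i j (t +i* x j.+1) /\ cell i j.+1 (t +i* x j.+1).
  by move=> ht; split; split => //=; rewrite ?lexx ?xx.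
have inV i j t : x j <= t <= x j.+1 -> cell i j (x i.+1 +i* t) /\ cell i.+1 j (x i.+1 +i* t).
  by move=> ht; split; split => //=; rewrite ?lexx ?xx.
have Hok i j : cauchy_approx K (fun z => (a i j.+1 - a i j) * H i j.+1 z) /\
   forall z, K z -> ccont (fun z => (a i j.+1 - a i j) * H i j.+1 z) z.
  have [->|an] := eqVneq (a i j.+1 - a i j) 0.
    split; first by apply: cauchy_approx_ext (@cauchy_approx0 _ K) => z _; rewrite mul0r.
    by move=> z _; apply: ccont_ext (ccont_cst 0 z) => w; rewrite mul0r.
  have ed t : x i <= t <= x i.+1 -> ~ K (t +i* x j.+1) /\ ccont g (t +i* x j.+1).
    by move=> /(inH i j)[c1 c2]; exact: edge an c2 c1.
  have c t : x i <= t <= x i.+1 -> ccont g (t +i* x j.+1) by move=> /ed[].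
  have k t : x i <= t <= x i.+1 -> ~ K (t +i* x j.+1) by move=> /ed[].
  have [d d0 hd] := edge_far (lipH (x j.+1)) Kc k.
  split; first by apply: cauchy_approxZ; apply: (edge_approx (xx i) (lipH _) c d0).
  move=> z Kz; apply: ccontZ; apply: (cauchy_int_cont (xx i) (lipH _) c d0).
  by move=> t ht; exact: hd.
have Vok i j : cauchy_approx K (fun z => (a i.+1 j - a i j) * V i.+1 j z) /\
   forall z, K z -> ccont (fun z => (a i.+1 j - a i j) * V i.+1 j z) z.
  have [->|an] := eqVneq (a i.+1 j - a i j) 0.
    split; first by apply: cauchy_approx_ext (@cauchy_approx0 _ K) => z _; rewrite mul0r.
    by move=> z _; apply: ccont_ext (ccont_cst 0 z) => w; rewrite mul0r.
  have ed t : x j <= t <= x j.+1 -> ~ K (x i.+1 +i* t) /\ ccont g (x i.+1 +i* t).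
    by move=> /(inV i j)[c1 c2]; exact: edge an c2 c1.
  have c t : x j <= t <= x j.+1 -> ccont g (x i.+1 +i* t) by move=> /ed[].
  have k t : x j <= t <= x j.+1 -> ~ K (x i.+1 +i* t) by move=> /ed[].
  have [d d0 hd] := edge_far (lipV (x i.+1)) Kc k.
  split; first by do 2 apply: cauchy_approxZ; apply: (edge_approx (xx j) (lipV _) c d0).
  move=> z Kz; do 2 apply: ccontZ; apply: (cauchy_int_cont (xx j) (lipV _) c d0).
  by move=> t ht; exact: hd.
have E'approx : cauchy_approx K E'.
  apply: cauchy_approxD; first by do 2 (apply: cauchy_approx_sum => ? _); exact: (Hok _ _).1.
  by apply: cauchy_approxZ; do 2 (apply: cauchy_approx_sum => ? _); exact: (Vok _ _).1.
have E'cont z : K z -> ccont E' z.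
  move=> Kz; apply: ccontD; first by do 2 (apply: ccont_sum => ? _); exact: (Hok _ _).2.
  by apply: ccontZ; do 2 (apply: ccont_sum => ? _); exact: (Vok _ _).2.
pose kp := rect_winding (- L) L (- L) L 0.
have big0 : open_rect (- L) L (- L) L 0 by split; rewrite /= oppr_lt0 L0.
have kp0 : kp != 0 by exact: rect_winding_neq0.
(* the integrals over the other cells vanish, and the constant of the cell is that of
   the whole grid *)
have Eint i0 j0 z : (i0 <= n)%N -> (j0 <= n)%N -> meets i0 j0 ->
    open_rect (x i0) (x i0.+1) (x j0) (x j0.+1) z -> E z = kp * g z.
  move=> i0n j0n m hz; have [/andP[z1 z2] /andP[z3 z4]] := hz.
  have off i j : (i, j) != (i0, j0) -> a i j * rc i j z = 0.
    move=> ij; have [m'|m'] := pselect (meets i j); last by rewrite a0 // mul0r.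
    rewrite /rc Goursat ?mulr0 // => v cv.
    have [l hl] := gG v (cellG _ _ _ m' cv).
    apply: (@cdiff_quot _ g z v l) => //; apply/eqP => vz.
    move: cv; rewrite vz => -[/andP[c1 c2] /andP[c3 c4]].
    case: (ltngtP i i0) => [lt|lt|ii].
    - by have := xle _ _ lt; move: z1 z2 z3 z4 c1 c2 c3 c4; clear; lra.
    - by have := xle _ _ lt; move: z1 z2 z3 z4 c1 c2 c3 c4; clear; lra.
    case: (ltngtP j j0) => [lt|lt|jj].
    - by have := xle _ _ lt; move: z1 z2 z3 z4 c1 c2 c3 c4; clear; lra.
    - by have := xle _ _ lt; move: z1 z2 z3 z4 c1 c2 c3 c4; clear; lra.
    by move: ij; rewrite ii jj eqxx.
  rewrite /E (bigD1_seq i0) ?mem_index_iota ?iota_uniq //=.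
  rewrite [X in _ + X]big1 ?addr0; last first.
    by move=> i ii; rewrite big1 // => j _; apply: off; rewrite xpair_eqE (negbTE ii).
  rewrite (bigD1_seq j0) ?mem_index_iota ?iota_uniq //=.
  rewrite [X in _ + X]big1 ?addr0; last first.
    by move=> j jj; apply: off; rewrite xpair_eqE (negbTE jj) andbF.
  rewrite a1 // mul1r /rc (@Cauchy_formula _ g _ _ _ _ z hz); last first.
    by move=> v cv; apply: gG; exact: cellG cv.
  rewrite mulrC; congr (_ * _).
  have b1 : - L <= x i0 by rewrite -x0 xle.
  have b2 : x i0.+1 <= L by rewrite -xn xle.
  have b3 : - L <= x j0 by rewrite -x0 xle.
  have b4 : x j0.+1 <= L by rewrite -xn xle.
  have zL : open_rect (- L) L (- L) L z.
    by split; rewrite ?(le_lt_trans b1 z1) ?(lt_le_trans z2 b2) ?(le_lt_trans b3 z3) ?(lt_le_trans z4 b4).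
  rewrite /kp -(rect_winding_const zL big0) /rect_winding.
  rewrite (@rect_int_shrink _ _ (- L) (x i0) (x i0.+1) L (- L) (x j0) (x j0.+1) L) // => v _ hv.
  exists (- 1 / (v - z) ^+ 2); apply: cdiff_inv_sub; apply/eqP => vz; apply: hv.
  by rewrite vz.
(* z may lie on an edge of the grid: move it slightly towards the centre of a cell *)
have Eg z : K z -> E' z = kp * g z.
  move=> Kz; apply: nrm_eq_eps => e e0.
  have e2 : 0 < e / 2 by rewrite divr_gt0.
  have [k1 k2 k3 k4] := Kco z Kz.
  have [i0 i0n hi] : exists2 i, (i <= n)%N & x i <= complex.Re z <= x i.+1.
    by apply: find_cell; rewrite x0 xn /L; move: k1 k2 k3 k4; clear => *; apply/andP; split; lra.
  have [j0 j0n hj] : exists2 i, (i <= n)%N & x i <= complex.Im z <= x i.+1.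
    by apply: find_cell; rewrite x0 xn /L; move: k1 k2 k3 k4; clear => *; apply/andP; split; lra.
  have m : meets i0 j0 by exists z.
  have [l hl] : exists l, cdiff g z l by apply: gG; apply: cellG m _.
  have [d1 d10 hd1] := E'cont z Kz _ e2.
  have [d2 d20 hd2] := ccontZ kp (cdiff_ccont hl) e2.
  pose d := Num.min d1 d2.
  have d0 : 0 < d by rewrite min_gt0.
  pose t := Num.min 1 (d / (3 * h)).
  have t0 : 0 < t by rewrite min_gt0 // divr_gt0 // mulr_gt0.
  have t1 : t <= 1 by rewrite ge_min lexx.
  have h30 : 0 < 3 * h by rewrite mulr_gt0.
  have th : t * (3 * h) <= d.
    by rewrite -(ler_pdivlMr _ _ h30) /t ge_min lexx orbT.
  pose w := (complex.Re z + t * (x i0 + h / 2 - complex.Re z)) +i*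
            (complex.Im z + t * (x j0 + h / 2 - complex.Im z)).
  move: hi hj; rewrite !xS => /andP[p1 p2] /andP[p3 p4].
  have q (r y : R) : y <= r -> r <= y + h -> y < r + t * (y + h / 2 - r) < y + h.
    by move: t0 t1 h0; clear => *; apply/andP; split; nra.
  have wi : open_rect (x i0) (x i0.+1) (x j0) (x j0.+1) w by split; rewrite /= xS; apply: q.
  have wz : nrm (w - z) < d.
    apply: (le_lt_trans (nrm_ReIm _)); rewrite !raddfB /= ![_ + t * _ - _]addrAC !subrr !add0r.
    rewrite !normrM (gtr0_norm t0) -mulrDr; apply: lt_le_trans th.
    rewrite ltr_pM2l //; apply: (@le_lt_trans _ _ (h + h)); last by move: h0; clear; lra.
    have mid (y : R) : y <= y + h / 2 <= y + h by move: h0; clear; lra.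
    by apply: lerD; apply: dist_itv (mid _) _; apply/andP.
  move: wz; rewrite lt_min => /andP[/hd1 w1 /hd2 w2].
  have := Eint _ _ _ i0n j0n m wi; rewrite EE' => Ew.
  apply: (le_trans (nrm_trans (E' w) _ _)); rewrite [leRHS]splitr; apply: lerD.
    by rewrite cnrmC.
  by rewrite Ew.
apply: (@cauchy_approx_ext _ K (fun z => kp^-1 * E' z)).
  by move=> z Kz; rewrite Eg // mulKf.
exact: cauchy_approxZ.
Qed.

End RungeTheorem.

(** * Winding numbers and Cauchy's formula for rectifiable curves *)

Section Winding.
Context (R : realType) (gamma : R -> R[i]) (W : R -> R).
Hypothesis gamma_cont : {within `[0, 1], continuous gamma}.
Hypothesis hW : dominates gamma W.
Implicit Types (z w v : R[i]).

Lemma curve_cont x : 0 <= x <= 1 -> forall e : R, 0 < e -> exists2 d : R, 0 < d &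
    forall y, 0 <= y <= 1 -> `|y - x| < d -> nrm (gamma y - gamma x) <= e.
Proof.
move=> x01 e e0; have /subspace_continuousP h := gamma_cont.
have := h x; rewrite /= in_itv /= => /(_ x01).
move=> /(_ [set w | nrm (w - gamma x) < e]) /=.
have : nbhs (gamma x) [set w | nrm (w - gamma x) < e] by apply/nbhs_nrmP; exists e.
move=> hn /(_ hn) /nbhs_ballP[d /= d0 hd]; exists d => // y y01 yx; apply: ltW.
apply: (hd y); last by rewrite /= in_itv.
by rewrite -ball_normE /ball_ /= distrC.
Qed.

Lemma curve_comp (V : normedModType R[i]) (F : R[i] -> V) :
  (forall t, 0 <= t <= 1 -> forall e : R, 0 < e -> exists2 d : R, 0 < d &
    forall s, 0 <= s <= 1 -> nrm (gamma s - gamma t) < d -> nrm (F (gamma s) - F (gamma t)) <= e) ->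
  unif_cont01 (F \o gamma).
Proof.
move=> h; apply: unif_cont01P => x x01 e e0; have [d d0 hd] := h x x01 e e0.
have [d' d'0 hd'] := curve_cont x01 (divr_gt0 d0 (ltr0Sn _ 1)).
exists d' => // y y01 /(hd' y y01) yx; apply: hd => //.
by apply: (le_lt_trans yx); rewrite ltr_pdivrMr // ltr_pMr // ltr1n.
Qed.

Lemma curve_comp_ccont (F : R[i] -> R[i]) :
  (forall t, 0 <= t <= 1 -> ccont F (gamma t)) -> unif_cont01 (F \o gamma).
Proof.
move=> h; apply: curve_comp => t t01 e e0; have [d d0 hd] := h t t01 e e0.
by exists d => // s _; exact: hd.
Qed.

Lemma unif_cont01_bounded (V : normedModType R[i]) (G : R -> V) : unif_cont01 G ->
  exists2 B : R, 0 <= B & forall t, 0 <= t <= 1 -> nrm (G t) <= B.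
Proof.
move=> hG.
suff [d d0 hd] : exists2 d : R, 0 < d & forall x, `[0, 1]%classic x ->
    0 <= x <= 1 -> 0 < d -> nrm (G x) <= d^-1.
  exists d^-1; first by rewrite invr_ge0 ltW.
  by move=> x xab; apply: hd; rewrite //= in_itv.
apply: compact_uniform; first exact: segment_compact.
  move=> d d' x dd' h xab d'0; have d0 := lt_le_trans d'0 dd'.
  by apply: (le_trans (h xab d0)); rewrite lef_pV2.
move=> x /=; rewrite in_itv /= => xab; have [d d0 hd] := hG 1 ltr01.
have c0 : 0 < nrm (G x) + 1 by rewrite ltr_wpDl // nrm_ge0.
exists (nrm (G x) + 1)^-1; first by rewrite invr_gt0.
apply/nbhs_ballP; exists d => //= y; rewrite -ball_normE /ball_ /= distrC => yx y01 _.
rewrite invrK -[G y](subrK (G x)) (le_trans (nrmD _ _)) // addrC lerD2l.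
exact: hd.
Qed.

Lemma curve_bounded : exists2 B : R, 0 <= B & forall t, 0 <= t <= 1 -> nrm (gamma t) <= B.
Proof.
apply: unif_cont01_bounded; apply: (@curve_comp_ccont id) => t _.
exact: cdiff_ccont (cdiff_id _).
Qed.

Definition curve_far z (d : R) := forall t, 0 <= t <= 1 -> d <= nrm (gamma t - z).

Lemma off_curve_far z : ~ (gamma @` `[0, 1]) z -> exists2 d : R, 0 < d & curve_far z d.
Proof.
move=> hz.
have neq t : 0 <= t <= 1 -> gamma t != z.
  by move=> t01; apply/eqP => tz; apply: hz; exists t => //=; rewrite in_itv.
have [B B0 hB] : exists2 B : R, 0 <= B & forall t, 0 <= t <= 1 -> nrm (gamma t - z)^-1 <= B.
  apply: unif_cont01_bounded; apply: (@curve_comp_ccont (fun v => (v - z)^-1)) => t t01.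
  exact: ccont_inv_sub (neq t t01).
have B1 : 0 < B + 1 by rewrite ltr_wpDl.
exists (B + 1)^-1; first by rewrite invr_gt0.
move=> t t01; rewrite -[leRHS]invrK lef_pV2 ?posrE ?invr_gt0 ?nrm_gt0 ?subr_eq0 ?neq //.
by rewrite -nrmV (le_trans (hB t t01)) // lerDl.
Qed.

Lemma far_off_curve z (d : R) : 0 < d -> curve_far z d -> ~ (gamma @` `[0, 1]) z.
Proof.
move=> d0 h [t /=]; rewrite in_itv /= => t01 tz; have := h t t01.
by rewrite tz subrr nrm0 leNgt d0.
Qed.

Lemma far_neq_curve z (d t : R) : 0 < d -> curve_far z d -> 0 <= t <= 1 -> gamma t != z.
Proof.
move=> d0 h t01; apply: contraTneq (h t t01) => ->; by rewrite subrr nrm0 -ltNge.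
Qed.

Lemma kernel_uc z (d : R) : 0 < d -> curve_far z d -> unif_cont01 ((fun v => (v - z)^-1) \o gamma).
Proof.
move=> d0 h; apply: curve_comp_ccont => t t01; apply: ccont_inv_sub; exact: far_neq_curve h t01.
Qed.

Lemma kernel_integral z (d : R) : 0 < d -> curve_far z d ->
  exists x : R[i], is_curve_integral gamma (fun v => (v - z)^-1) x.
Proof.
move=> d0 h; apply: (curve_integral_exists hW); first exact: complex_seq_complete.
exact: kernel_uc h.
Qed.

(** The Riemann sums of a function with a primitive telescope up to an error that is
    small compared with the variation of the curve. *)
Lemma curve_FTC (F Q : R[i] -> R[i]) :
  (forall e : R, 0 < e -> exists2 d : R, 0 < d & forall s t u, 0 <= s <= 1 -> 0 <= t <= 1 ->
     0 <= u <= 1 -> `|s - u| < d -> `|t - u| < d ->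
     nrm (Q (gamma t) - Q (gamma s) - (gamma t - gamma s) * F (gamma u)) <= e * nrm (gamma t - gamma s)) ->
  is_curve_integral gamma F (Q (gamma 1) - Q (gamma 0)).
Proof.
move=> h e e0; have W0 := dominates_ge0 hW.
have K0 : 0 < W 1 - W 0 + 1 by rewrite ltr_wpDl.
have [d d0 hd] := h _ (divr_gt0 e0 K0).
exists d => // s tau hs ht; rewrite nrm_lt.
have hp := subdivision_pt hs; have [p0 pn pS] := hp.
have -> : Q (gamma 1) - Q (gamma 0) =
   \sum_(0 <= i < size s) (Q (gamma (subdiv_pt s i.+1)) - Q (gamma (subdiv_pt s i))).
  by rewrite (telescope_sumr (fun i => Q (gamma (subdiv_pt s i)))) // pn p0.
rewrite -sumrB; apply: (le_lt_trans (nrm_sum _ _ _)).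
apply: (@le_lt_trans _ _ (\sum_(0 <= i < size s) e / (W 1 - W 0 + 1) * (W (subdiv_pt s i.+1) - W (subdiv_pt s i)))).
  rewrite big_nat [leRHS]big_nat; apply: ler_sum => i /andP[_ lis].
  have [t1 t2 t3] := ht i lis.
  have b0 := subdivision_ge0 hp (ltnW lis); have b1 := subdivision_le1 hp lis.
  have c0 := pS i lis.
  apply: (le_trans (hd _ _ (tau i) _ _ _ _ _)).
  - by apply/andP; split; lra.
  - by apply/andP; split; lra.
  - by apply/andP; split; lra.
  - by rewrite ltr_norml; apply/andP; split; lra.
  - by rewrite ltr_norml; apply/andP; split; lra.
  - by apply: ler_wpM2l; [rewrite divr_ge0 ?ltW|apply: hW].
rewrite -mulr_sumr telescope_sumr // pn p0 mulrAC ltr_pdivrMr // ltr_pM2l //.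
by rewrite ltrDl.
Qed.

Lemma kernel2_integral z (d : R) : 0 < d -> curve_far z d -> gamma 0 = gamma 1 ->
  is_curve_integral gamma (fun v => (v - z)^-2) 0.
Proof.
move=> d0 h g01.
have := @curve_FTC (fun v => (v - z)^-2) (fun v => - (v - z)^-1).
rewrite g01 subrr; apply=> e e0.
have [d1 d10 hd1] := kernel_uc d0 h (divr_gt0 (mulr_gt0 e0 d0) (ltr0Sn _ 1)).
exists d1 => // s t u s01 t01 u01 su tu.
have ns : gamma s - z != 0 by rewrite subr_eq0; exact: far_neq_curve h s01.
have nt : gamma t - z != 0 by rewrite subr_eq0; exact: far_neq_curve h t01.
have nu : gamma u - z != 0 by rewrite subr_eq0; exact: far_neq_curve h u01.
have -> : - (gamma t - z)^-1 - - (gamma s - z)^-1 - (gamma t - gamma s) * (gamma u - z)^-2 =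
  (gamma t - gamma s) * (((gamma s - z)^-1 - (gamma u - z)^-1) * (gamma t - z)^-1
     + (gamma u - z)^-1 * ((gamma t - z)^-1 - (gamma u - z)^-1)).
  by field; rewrite ns nt nu.
rewrite nrmM mulrC ler_wpM2r ?nrm_ge0 //.
have bd x : 0 <= x <= 1 -> nrm (gamma x - z)^-1 <= d^-1.
  by move=> x01; rewrite nrmV lef_pV2 ?posrE ?(lt_le_trans d0) ?h.
have -> : e = e * d / 2 * d^-1 + d^-1 * (e * d / 2) by field; rewrite gt_eqF.
rewrite (le_trans (nrmD _ _)) // lerD // nrmM; apply: ler_pM; rewrite ?nrm_ge0 ?bd //; exact: hd1.
Qed.

(** The integral of (v - z)^-1 has derivative in z the integral of (v - z)^-2,
    which is zero on a closed curve; hence it is constant along the segment. *)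
Lemma kernel_integral_segment z w (d : R) (x : R[i]) : gamma 0 = gamma 1 -> 0 < d ->
  (forall t, 0 <= t <= 1 -> curve_far (z + t%:C * (w - z)) d) ->
  is_curve_integral gamma (fun v => (v - z)^-1) x ->
  is_curve_integral gamma (fun v => (v - w)^-1) x.
Proof.
move=> g01 d0 hp hx.
pose p (t : R) := z + t%:C * (w - z).
have ex t : exists y : R[i], 0 <= t <= 1 -> is_curve_integral gamma (fun v => (v - p t)^-1) y.
  have [t01|t01] := boolP (0 <= t <= 1); last by exists 0.
  by have [y hy] := kernel_integral d0 (hp t t01); exists y.
have [phi hphi] := choice ex.
pose C := (W 1 - W 0) * (nrm (w - z) ^+ 2 / d ^+ 3).
have C0 : 0 <= C by rewrite mulr_ge0 ?(dominates_ge0 hW) // divr_ge0 ?exprn_ge0 ?nrm_ge0 ?(ltW d0).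
have p1 : p 1 = w by rewrite /p rmorph1 mul1r addrC subrK.
have p0 : p 0 = z by rewrite /p rmorph0 mul0r addr0.
have E : phi 1 = phi 0.
  apply: (quad_const C0) => s t s01 t01.
  have H := curve_integralD (curve_integralD (hphi t t01) (curve_integralZ (-1) (hphi s s01)))
    (curve_integralZ (- (p t - p s)) (kernel2_integral d0 (hp s s01) g01)).
  rewrite scaler0 addr0 scaleN1r in H.
  have -> : C * (t - s) ^+ 2 = (W 1 - W 0) * (nrm (p t - p s) ^+ 2 / d ^+ 3).
    have -> : p t - p s = (t - s)%:C * (w - z) by rewrite /p rmorphB; ring.
    by rewrite nrmM nrm_real exprMn -normrX ger0_norm ?sqr_ge0 // /C; ring.
  apply: (curve_integral_bound hW _ H).
    by rewrite divr_ge0 ?exprn_ge0 ?nrm_ge0 ?(ltW d0).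
  move=> u u01; have := kernel_expand d0 (hp s s01 u u01) (hp t t01 u u01).
  apply: le_trans; rewrite le_eqVlt; apply/orP; left; apply/eqP; congr nrm.
  by rewrite /p /GRing.scale /=; ring.
have l01 : (0 : R) <= 1 by [].
have h0 := hphi 0; rewrite lexx l01 p0 in h0.
have h1 := hphi 1; rewrite lexx l01 p1 E in h1.
by rewrite (curve_integral_unique hx (h0 isT)); exact: h1.
Qed.

(** The curve together with the points around which it winds: the compact set on
    which Runge's theorem is applied. *)
Definition windset : set R[i] := ~` curve_outside gamma.

Lemma outsideP z : curve_outside gamma z <->
  (~ (gamma @` `[0, 1]) z /\ is_curve_integral gamma (fun v => (v - z)^-1) 0).
Proof. by rewrite /curve_outside /winding_number /= mulr0z mulr0. Qed.

Hypothesis closed_curve : gamma 0 = gamma 1.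

Lemma windset_closed : is_closed windset.
Proof.
move=> z /contrapT/outsideP[hz hI]; have [d d0 hd] := off_curve_far hz.
exists (d / 2); first by rewrite divr_gt0.
move=> w wz; apply; apply/outsideP.
have far t : 0 <= t <= 1 -> curve_far (z + t%:C * (w - z)) (d / 2).
  move=> /andP[t0 t1] u u01; have := hd u u01; have := nrm_trans (z + t%:C * (w - z)) (gamma u) z.
  have -> : z + t%:C * (w - z) - z = t%:C * (w - z) by ring.
  rewrite nrmM nrm_real ger0_norm //; have : t * nrm (w - z) <= nrm (w - z) by rewrite ler_piMl ?nrm_ge0.
  lra.
have d20 : 0 < d / 2 by rewrite divr_gt0.
split; last exact: kernel_integral_segment far hI.
have := far 1; rewrite lexx ler01 rmorph1 mul1r addrC subrK => /(_ isT).
exact: far_off_curve.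
Qed.

(** Moving z to infinity along a ray does not change its winding number, while the
    integral that defines it tends to zero. *)
Lemma windset_bounded : exists2 B : R, 0 <= B & forall z, windset z -> nrm z <= B.
Proof.
have [B B0 hB] := curve_bounded; exists (B + 1); first by rewrite addr_ge0.
move=> z; apply: contra_notT; rewrite -ltNge => zB; apply/outsideP.
have far (M : R) : 0 <= M -> curve_far (z + M%:C * z) (M + 1).
  move=> M0 t t01; have := hB t t01.
  have -> : z + M%:C * z = (1 + M)%:C * z by rewrite rmorphD rmorph1 mulrDl mul1r.
  have := nrm_subl ((1 + M)%:C * z) (gamma t); rewrite cnrmC nrmM nrm_real.
  have M10 : 0 <= 1 + M by rewrite addr_ge0.
  rewrite ger0_norm // => h1 h2; have : (1 + M) * (B + 1) <= (1 + M) * nrm z.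
    by rewrite ler_wpM2l // ltW.
  have : 0 <= M * B by rewrite mulr_ge0.
  by move: h1 h2; nra.
have far0 : curve_far z 1.
  by have := far 0 (lexx 0); rewrite rmorph0 mul0r addr0 add0r.
split; first exact: far_off_curve ltr01 far0.
have [x hx] := kernel_integral ltr01 far0.
suff <- : x = 0 by [].
apply: nrm_le0 => e e0; have W0 := dominates_ge0 hW.
have aux (s M : R) : z + s%:C * (z + M%:C * z - z) = z + (s * M)%:C * z.
  by rewrite rmorphM; ring.
pose M := (W 1 - W 0) / e.
have M0 : 0 <= M by rewrite divr_ge0 // ltW.
have hxM : is_curve_integral gamma (fun v => (v - (z + M%:C * z))^-1) x.
  apply: (@kernel_integral_segment z _ 1 x closed_curve ltr01 _ hx) => t /andP[t0 t1].
  rewrite aux.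
  move=> u u01; apply: (le_trans _ (far (t * M) _ u u01)); first by rewrite lerDr mulr_ge0.
  exact: mulr_ge0.
have M1 : 0 < M + 1 by rewrite ltr_wpDl.
apply: (@le_trans _ _ ((W 1 - W 0) * (M + 1)^-1)).
  apply: (curve_integral_bound hW _ hxM); first by rewrite invr_ge0 ltW.
  move=> t t01; rewrite nrmV lef_pV2 ?posrE ?far //.
  by apply: lt_le_trans M1 _; exact: far.
rewrite ler_pdivrMr // mulrDr mulr1 /M mulrCA divff ?gt_eqF // mulr1.
by rewrite lerDl ltW.
Qed.

Lemma windset_margin (G : set R[i]) : open G -> ~` G `<=` curve_outside gamma ->
  exists2 d : R, 0 < d & forall z w, windset z -> nrm (w - z) < d -> G w.
Proof.
move=> Go hG; have [B B0 hB] := windset_bounded.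
suff [d d0 hd] : exists2 d : R, 0 < d & forall p : R * R, (`[- B, B] `*` `[- B, B])%classic p ->
    windset (p.1 +i* p.2) -> forall w, nrm (w - (p.1 +i* p.2)) < d -> G w.
  exists d => // -[a b] w Kz; apply: (hd (a, b)) => //=.
  rewrite /= !in_itv /= -!ler_norml.
  by rewrite (le_trans (nrm_Re (a +i* b)) (hB _ Kz)) (le_trans (nrm_Im (a +i* b)) (hB _ Kz)).
apply: compact_uniform.
- by apply: compact_setX; exact: segment_compact.
- by move=> d d' p dd' h Kp w wd; apply: h Kp w (lt_le_trans wd dd').
move=> [a b] _.
have near (r : R) : 0 < r -> nbhs (a, b) [set p : R * R | nrm (p.1 +i* p.2 - a +i* b) < r].
  move=> r0; have r2 : 0 < r / 2 by rewrite divr_gt0.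
  apply/nbhs_ballP; exists (r / 2) => //= -[a' b'] [/=]; rewrite -!ball_normE /ball_ /= => h1 h2.
  rewrite (le_lt_trans (nrm_ReIm _)) //= [ltRHS]splitr.
  by rewrite ltrD // distrC.
have [Kp|nKp] := pselect (windset (a +i* b)); last first.
  have [r r0 hr] := windset_closed nKp.
  by exists 1 => //; apply: filterS (near r r0) => -[a' b'] /= /hr.
have Gp : G (a +i* b) by apply: contrapT => nG; apply: Kp; exact: hG.
have : nbhs (a +i* b) G by exact: open_nbhs_nbhs.
move=> /nbhs_nrmP[r r0 hr].
have r2 : 0 < r / 2 by rewrite divr_gt0.
exists (r / 2) => //; apply: filterS (near _ r2) => -[a' b'] /= h _ w hw.
apply: hr; rewrite (le_lt_trans (nrm_trans (a' +i* b') _ _)) // [ltRHS]splitr ltrD //.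
Qed.

(** For a simple fraction 1 / (q - w), partial fractions reduce the claim to the
    winding numbers 1 of t and 0 of q. The general case follows by approximating h on
    windset gamma, which contains both the curve and t. *)
Lemma curve_Cauchy (G : set R[i]) (h : R[i] -> R[i]) (t : R[i]) :
  open G -> ~` G `<=` curve_outside gamma ->
  (forall z, G z -> exists l, cdiff h z l) -> curve_inside gamma t ->
  is_curve_integral gamma (fun w => h w / (w - t)) (two_pi_i R * h t).
Proof.
move=> Go hG hh [ht hI]; rewrite mulr1 in hI.
have [d d0 hd] := off_curve_far ht.
have [B B0 hB] := windset_bounded.
have [del del0 hdel] := windset_margin Go hG.
have sub z : windset z -> G z.
  by move=> Kz; apply: (hdel z z Kz); rewrite subrr nrm0.
have curveK s : 0 <= s <= 1 -> windset (gamma s).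
  by move=> s01 /outsideP[+ _]; apply; exists s => //=; rewrite in_itv.
have Kt : windset t.
  move=> /outsideP[_ h0]; have := curve_integral_unique hI h0.
  move=> /(congr1 (@complex.Im R)) /= /eqP; rewrite mulf_eq0 pnatr_eq0 /=.
  by rewrite gt_eqF // pi_gt0.
have ap := Runge B0 del0 hB windset_closed hdel hh.
have [x hx] : exists x : R[i], is_curve_integral gamma (fun w => h w / (w - t)) x.
  apply: (curve_integral_exists hW); first exact: complex_seq_complete.
  apply: curve_comp_ccont => s s01; apply: ccontM.
    by have [l /cdiff_ccont] := hh _ (sub _ (curveK s s01)).
  by apply: ccont_inv_sub; exact: far_neq_curve hd s01.
suff <- : x = two_pi_i R * h t by [].
apply: nrm_eq_eps => e e0.
have W0 := dominates_ge0 hW.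
pose C := (W 1 - W 0) / d + nrm (two_pi_i R).
have C0 : 0 <= C by rewrite addr_ge0 ?nrm_ge0 // divr_ge0 // ltW.
have C1 : 0 < C + 1 by rewrite ltr_wpDl.
have e1 : 0 < e / (C + 1) by rewrite divr_gt0.
have [s hs hr] := ap _ e1.
pose r z := \sum_(q <- s) q.2 / (q.1 - z).
have hrI : is_curve_integral gamma (fun w => r w / (w - t)) (two_pi_i R * r t).
  rewrite /r; elim: s hs {hr r} => [|q s IH] hs.
    rewrite big_nil mulr0; apply: curve_integral_ext (@curve_integral0 _ gamma _) => u _.
    by rewrite big_nil mul0r.
  have /IH{}IH : forall q, q \in s -> ~ windset q.1.
    by move=> q' q's; apply: hs; rewrite inE q's orbT.
  have /contrapT/outsideP[hq hqI] := hs q (mem_head _ _).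
  have [dq dq0 hdq] := off_curve_far hq.
  have qt : q.1 - t != 0.
    rewrite subr_eq0; apply/eqP => qt; apply: (hs q (mem_head _ _)).
    by rewrite qt.
  have H := curve_integralZ (q.2 / (q.1 - t)) (curve_integralD hI (curve_integralZ (-1) hqI)).
  rewrite scaler0 addr0 in H.
  rewrite big_cons mulrDr.
  have -> : two_pi_i R * (q.2 / (q.1 - t)) = q.2 / (q.1 - t) *: two_pi_i R.
    by rewrite /GRing.scale /=; ring.
  apply: curve_integral_ext (curve_integralD H IH) => u u01.
  rewrite big_cons mulrDl; congr (_ + _).
  have u1 : gamma u - t != 0 by rewrite subr_eq0; exact: far_neq_curve hd u01.
  have u2 : gamma u - q.1 != 0 by rewrite subr_eq0; exact: far_neq_curve hdq u01.
  have u3 : q.1 - gamma u != 0 by rewrite -opprB oppr_eq0.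
  rewrite /GRing.scale /=; field.
  by rewrite u1 u2 u3 qt.
have hdiff := curve_integralD hx (curve_integralZ (-1) hrI).
rewrite scaleN1r in hdiff.
have b1 : nrm (x - two_pi_i R * r t) <= (W 1 - W 0) * (e / (C + 1) / d).
  apply: (curve_integral_bound hW _ hdiff); first by rewrite divr_ge0 ?(ltW d0) ?(ltW e1).
  move=> u u01; rewrite scaleN1r -mulrBl nrmM nrmV.
  apply: ler_pM; rewrite ?nrm_ge0 ?invr_ge0 ?nrm_ge0 //; first by apply: hr; exact: curveK.
  by rewrite lef_pV2 ?posrE ?hd // (lt_le_trans d0) ?hd.
have b2 : nrm (two_pi_i R * r t - two_pi_i R * h t) <= nrm (two_pi_i R) * (e / (C + 1)).
  by rewrite -mulrBr nrmM ler_wpM2l ?nrm_ge0 // cnrmC; exact: hr.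
apply: (le_trans (nrm_trans _ _ _)); apply: (le_trans (lerD b1 b2)).
have -> : (W 1 - W 0) * (e / (C + 1) / d) + nrm (two_pi_i R) * (e / (C + 1)) = C * (e / (C + 1)).
  by rewrite /C; ring.
by rewrite mul_div_succ_le.
Qed.

End Winding.

(** * The norm of the algebra and the Neumann series *)

Section AlgNorm.
Context (R : realType) (A : banachStarAlgType R).
Implicit Types (x y a : A).

(** nspace A is a different type from A for the purpose of canonical structures;
    anrm states its norm on elements of the algebra. *)
Definition anrm x : R := nrm (x : nspace A).

Lemma anrm_ge0 x : 0 <= anrm x. Proof. exact: nrm_ge0. Qed.
Lemma anrm0 : anrm 0 = 0. Proof. exact: nrm0. Qed.
Lemma anrmN x : anrm (- x) = anrm x. Proof. exact: nrmN. Qed.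
Lemma anrmC x y : anrm (x - y) = anrm (y - x). Proof. exact: nrmC. Qed.
Lemma anrmD x y : anrm (x + y) <= anrm x + anrm y. Proof. exact: nrmD. Qed.
Lemma anrm_trans y x z : anrm (x - z) <= anrm (x - y) + anrm (y - z).
Proof. exact: nrm_trans. Qed.
Lemma anrmZ (k : R[i]) x : anrm (k *: x) = nrm k * anrm x. Proof. exact: nrmZ. Qed.
Lemma anrmM x y : anrm (x * y) <= anrm x * anrm y.
Proof.
have := @anormM R A x y; rewrite -[X in _ <= X * _]/(`|x : nspace A|).
rewrite -[X in _ <= _ * X]/(`|y : nspace A|) -[X in X <= _]/(`|(x * y : A) : nspace A|).
by rewrite !nrmE -rmorphM lecR.
Qed.
Lemma anrm_eq_eps x y : (forall e : R, 0 < e -> anrm (x - y) <= e) -> x = y.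
Proof. exact: nrm_eq_eps. Qed.
Lemma anrm_complete (u : nat -> A) :
  (forall e : R, 0 < e -> exists N, forall n m, (N <= n)%N -> (N <= m)%N -> anrm (u n - u m) <= e) ->
  exists l : A, forall e : R, 0 < e -> exists N, forall n, (N <= n)%N -> anrm (u n - l) <= e.
Proof. exact: nspace_seq_complete. Qed.

Lemma expr_small (q e : R) : 0 <= q -> q < 1 -> 0 < e -> exists N, forall n, (N <= n)%N -> q ^+ n <= e.
Proof.
move=> q0 q1 e0.
have /cvgrPdist_le/(_ e e0)[N _ hN] : (fun n => q ^+ n) @ \oo --> (0 : R).
  by apply: cvg_expr; rewrite ger0_norm.
exists N => n Nn; have := hN n Nn.
by rewrite /= sub0r normrN ger0_norm // exprn_ge0.
Qed.

Lemma anrmX_bound a n : anrm (a ^+ n) <= anrm 1 * anrm a ^+ n.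
Proof.
elim: n => [|n IH]; first by rewrite !expr0 mulr1.
rewrite exprSr (le_trans (anrmM _ _)) // exprSr mulrA ler_wpM2r ?anrm_ge0 //.
Qed.

(** The inverse is the sum of the geometric series. *)
Lemma Neumann a : anrm a < 1 -> 1 - a \is a GRing.unit.
Proof.
move=> a1; set q := anrm a; have q0 : 0 <= q by exact: anrm_ge0.
have q10 : 0 < 1 - q by rewrite subr_gt0.
pose C := anrm (1 : A); have C0 : 0 <= C by exact: anrm_ge0.
have C1 : 0 < C + 1 by rewrite ltr_wpDl.
pose s n := \sum_(0 <= i < n) a ^+ i.
have pw (e : R) : 0 < e -> exists N, forall n, (N <= n)%N -> anrm (a ^+ n) <= e.
  move=> e0; have [N hN] := expr_small q0 a1 (divr_gt0 e0 C1).
  exists N => n /hN h; apply: (le_trans (anrmX_bound a n)).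
  apply: (@le_trans _ _ (C * (e / (C + 1)))); first by apply: ler_wpM2l.
  by rewrite mul_div_succ_le.
have geo (m k : nat) : anrm (s (m + k)%N - s m) * (1 - q) <= C * (q ^+ m - q ^+ (m + k)).
  elim: k => [|k IH]; first by rewrite addn0 !subrr anrm0 mul0r mulr0.
  have -> : s (m + k.+1)%N - s m = (s (m + k)%N - s m) + a ^+ (m + k).
    by rewrite /s addnS big_nat_recr //= addrAC.
  have -> : C * (q ^+ m - q ^+ (m + k.+1)) = C * (q ^+ m - q ^+ (m + k)) + C * q ^+ (m + k) * (1 - q).
    by rewrite addnS exprSr; ring.
  apply: (le_trans (ler_wpM2r (ltW q10) (anrmD _ _))); rewrite [leLHS]mulrDl lerD //.
  by rewrite ler_wpM2r ?(ltW q10) //; exact: anrmX_bound.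
have geo' (m n : nat) : (m <= n)%N -> anrm (s n - s m) * (1 - q) <= C * q ^+ m.
  move=> mn; have := geo m (n - m)%N; rewrite subnKC // => /le_trans; apply.
  by rewrite ler_wpM2l // lerBlDr lerDl exprn_ge0.
have [l hl] : exists l : A, forall e : R, 0 < e -> exists N, forall n, (N <= n)%N -> anrm (s n - l) <= e.
  apply: anrm_complete => e e0.
  have [N hN] := expr_small q0 a1 (divr_gt0 (mulr_gt0 e0 q10) C1).
  have H n m : (N <= n)%N -> (n <= m)%N -> anrm (s m - s n) <= e.
    move=> /hN Nn nm; have := geo' n m nm; rewrite -ler_pdivlMr // => /le_trans; apply.
    rewrite ler_pdivrMr //; apply: (@le_trans _ _ (C * (e * (1 - q) / (C + 1)))).
      by rewrite ler_wpM2l.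
    by rewrite mul_div_succ_le ?mulr_gt0.
  exists N => n m Nn Nm; case: (leqP n m) => nm; first by rewrite anrmC H.
  by rewrite H // ltnW.
have sl n : (1 - a) * s n = 1 - a ^+ n.
  have cc : GRing.comm 1 a by exact/commr_sym/commr1.
  rewrite -[1 in RHS](expr1n _ n) (subrXX_comm _ cc) /s big_mkord.
  by congr (_ * _); apply: eq_bigr => i _; rewrite expr1n mul1r.
have sr n : s n * (1 - a) = 1 - a ^+ n.
  rewrite -sl /s mulr_suml mulr_sumr; apply: eq_bigr => i _.
  by rewrite mulrBr mulrBl mulr1 mul1r -exprSr -exprS.
have K0 : 0 < anrm (1 - a) + 1 by rewrite ltr_wpDl // anrm_ge0.
have lim (f : A -> A) : (forall x y, f (x - y) = f x - f y) ->
    (forall x, anrm (f x) <= anrm (1 - a) * anrm x) -> (forall n, f (s n) = 1 - a ^+ n) -> f l = 1.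
  move=> fB fN fs; apply: anrm_eq_eps => e e0; have e2 : 0 < e / 2 by rewrite divr_gt0.
  have [N1 h1] := hl _ (divr_gt0 e2 K0); have [N2 h2] := pw _ e2.
  pose n := maxn N1 N2.
  apply: (le_trans (anrm_trans (f (s n)) _ _)); rewrite [leRHS]splitr; apply: lerD.
    rewrite -fB; apply: (le_trans (fN _)); rewrite (anrmC l).
    apply: (@le_trans _ _ (anrm (1 - a) * (e / 2 / (anrm (1 - a) + 1)))).
      by rewrite ler_wpM2l ?anrm_ge0 // h1 // leq_maxl.
    by rewrite mul_div_succ_le.
  by rewrite fs addrC addKr anrmN h2 // leq_maxr.
apply/unitrP; exists l; split.
- apply: (lim (fun x => x * (1 - a))) => //; first by move=> x y; rewrite mulrBl.
  by move=> x; rewrite mulrC anrmM.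
- apply: (lim (fun x => (1 - a) * x)) => //; first by move=> x y; rewrite mulrBr.
  by move=> x; rewrite anrmM.
Qed.

Lemma unit_sub_scalar a (z : R[i]) : anrm a < nrm z -> a - z%:A \is a GRing.unit.
Proof.
move=> az; have z0 : z != 0.
  by apply: contraTneq az => ->; rewrite nrm0 -leNgt anrm_ge0.
have nz : 0 < nrm z by exact: nrm_gt0.
have -> : a - z%:A = (- z)%:A * (1 - z^-1 *: a).
  rewrite mulrBr mulr1 -scalerAl mul1r scalerA mulNr divff // scaleN1r opprK addrC.
  by rewrite scaleNr.
rewrite unitrMr.
  by apply: Neumann; rewrite anrmZ nrmV mulrC ltr_pdivrMr // mul1r.
apply/unitrP; exists (- z)^-1%:A.
by rewrite -!scalerAl !mul1r !scalerA mulVf ?divff ?oppr_eq0 // scale1r.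
Qed.

Lemma spectrum_bound a (z : R[i]) : spectrum a z -> nrm z <= anrm a.
Proof. by rewrite /spectrum /= leNgt => h; apply/negP => /unit_sub_scalar; apply/negP. Qed.

End AlgNorm.

(** * Positive functionals on a Hermitian algebra *)

Section Functional.
Context (R : realType) (A : banachStarAlgType R).
Implicit Types (x y a : A).

Lemma star0 : star (0 : A) = 0.
Proof. by have := starD (0 : A) 0; rewrite addr0 => /eqP; rewrite -subr_eq0 opprD addrA subrr sub0r oppr_eq0 => /eqP. Qed.

Lemma starN x : star (- x) = - star x.
Proof. by apply/eqP; rewrite -addr_eq0 -starD addNr star0. Qed.

Lemma starB x y : star (x - y) = star x - star y.
Proof. by rewrite starD starN. Qed.

Lemma star1 : star (1 : A) = 1.
Proof. by rewrite -[LHS]mulr1 -[X in _ * X]starK -starM mulr1 starK. Qed.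

Lemma star_scalar (k : R[i]) : star (k%:A : A) = (conjc k)%:A.
Proof. by rewrite starZ star1. Qed.

Lemma star_unit x : x \is a GRing.unit -> star x \is a GRing.unit.
Proof.
move=> ux; apply/unitrP; exists (star x^-1); split.
  by rewrite -starM mulrV // star1.
by rewrite -starM mulVr // star1.
Qed.

Lemma starV x : x \is a GRing.unit -> star x^-1 = (star x)^-1.
Proof.
move=> ux; apply: (mulrI (star_unit ux)).
by rewrite mulrV ?star_unit // -starM mulVr // star1.
Qed.

(** A continuous conjugate-linear map is bounded: rescale to a ball around zero. *)
Lemma star_bounded : exists2 C : R, 0 <= C & forall x, anrm (star x) <= C * anrm x.
Proof.
have /(_ [set y : nspace A | nrm y < 1]) := @star_continuous R A (0 : A).
have n0 : nbhs (star (0 : A) : nspace A) [set y : nspace A | nrm y < 1].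
  by apply/nbhs_nrmP; exists 1 => // y; rewrite star0 subr0.
move=> /(_ n0) /nbhs_nrmP[d d0 hd]; have d20 : 0 < d / 2 by rewrite divr_gt0.
exists (d / 2)^-1; first by rewrite invr_ge0 ltW.
move=> x; have [->|x0] := eqVneq x 0; first by rewrite star0 anrm0 mulr0.
have nx : 0 < anrm x by exact: (@nrm_gt0 _ (nspace A)).
pose r : R := d / 2 / anrm x.
have r0 : 0 < r by rewrite divr_gt0.
have /hd : nrm ((r%:C *: x : nspace A) - 0) < d.
  rewrite subr0 -/(anrm _) anrmZ nrm_real gtr0_norm // /r divfK ?gt_eqF //.
  by rewrite ltr_pdivrMr // ltr_pMr // ltr1n.
rewrite /= -/(anrm _) starZ conjc_real anrmZ nrm_real gtr0_norm // => h.
move: h; rewrite -ltr_pdivlMl // mulr1 /r invf_div => /ltW.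
by rewrite mulrC.
Qed.


Lemma half_double x : (2^-1 : R[i]) *: (x + x) = x.
Proof.
have -> : x + x = (1 + 1 : R[i]) *: x by rewrite scalerDl scale1r.
by rewrite scalerA mulVf ?scale1r // pnatr_eq0.
Qed.

Lemma sa_decomp x : exists a b, [/\ selfadjoint a, selfadjoint b, x = a + 'i *: b,
  star x = a - 'i *: b & forall C : R, anrm (star x) <= C * anrm x ->
    anrm a <= 2^-1 * (1 + C) * anrm x /\ anrm b <= 2^-1 * (1 + C) * anrm x].
Proof.
exists (2^-1 *: (x + star x)), ((- 'i / 2) *: (x - star x)); split.
- by rewrite /selfadjoint starZ starD starK conjc_inv conjc_nat addrC.
- rewrite /selfadjoint starZ starB starK -opprB scalerN -scaleNr; congr (_ *: _).
  have -> : (2 : R[i])^-1 = (2^-1 : R)%:C by rewrite fmorphV rmorph_nat.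
  by apply: complex_ReIm_inj => /=; ring.
- rewrite scalerA mulrA mulrN -expr2 sqr_i opprK mul1r -scalerDr addrACA subrr addr0.
  by rewrite half_double.
- rewrite scalerA mulrA mulrN -expr2 sqr_i opprK mul1r -scalerBr opprB [x + _]addrC addrACA subrr addr0.
  by rewrite half_double.
- move=> C hC.
  have n2 : nrm (2^-1 : R[i]) = 2^-1 by rewrite nrmV (nrm_nat _ 2).
  rewrite !anrmZ nrmM nrmN nrm_i mul1r n2 -!mulrA !ler_pM2l ?invr_gt0 //.
  by split; (apply: (le_trans (anrmD _ _))); rewrite ?anrmN [leRHS]mulrDl mul1r lerD2l.
Qed.

Context (psi : {scalar A}) (hA : hermitian_algebra A).
Hypotheses (psi_pos : positive_functional psi) (psi_norm : psi 1 = 1).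

Lemma psiZ (k : R[i]) x : psi (k *: x) = k * psi x.
Proof. exact: linearZ. Qed.

Lemma psiD x y : psi (x + y) = psi x + psi y.
Proof. exact: raddfD. Qed.

Lemma psiN x : psi (- x) = - psi x.
Proof. exact: raddfN. Qed.

Lemma psiB x y : psi (x - y) = psi x - psi y.
Proof. exact: raddfB. Qed.

Lemma psi_scalar (k : R[i]) : psi k%:A = k.
Proof. by rewrite psiZ psi_norm mulr1. Qed.

Lemma selfadjointD x y : selfadjoint x -> selfadjoint y -> selfadjoint (x + y).
Proof. by rewrite /selfadjoint starD => -> ->. Qed.

Lemma selfadjoint_real (r : R) : selfadjoint (r%:C%:A : A).
Proof. by rewrite /selfadjoint star_scalar conjc_real. Qed.

Lemma selfadjointN x : selfadjoint x -> selfadjoint (- x).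
Proof. by rewrite /selfadjoint starN => ->. Qed.

(** If t is the norm of x, then the spectra of t + x and t - x are nonnegative: they
    are real as A is Hermitian, and the spectrum of x is bounded by t. *)
Lemma psi_sa x : selfadjoint x -> exists2 r : R, psi x = r%:C & `|r| <= anrm x.
Proof.
move=> hx; set t := anrm x.
(* applied to x and to - x *)
have key y : selfadjoint y -> anrm y <= t -> 0 <= t%:C + psi y.
  move=> hy yt; rewrite -[t%:C]psi_scalar -psiD; apply: psi_pos; split.
    by apply: selfadjointD => //; exact: selfadjoint_real.
  move=> z hz; have hs : selfadjoint (t%:C%:A + y) by apply: selfadjointD => //; exact: selfadjoint_real.
  have /complex_realP[r zr] := hA hs hz.
  have : spectrum y (z - t%:C).
    have E : y - (z - t%:C)%:A = t%:C%:A + y - z%:A by rewrite scalerBl opprB addrCA addrA.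
    by rewrite /spectrum /= E.
  move=> /spectrum_bound; rewrite zr -rmorphB nrm_real ler0c => h.
  have := le_trans h yt; rewrite ler_norml => /andP[h1 _]; lra.
have h1 := key x hx (lexx _).
have h2 : 0 <= t%:C - psi x.
  by rewrite -psiN; apply: key; rewrite ?anrmN //; exact: selfadjointN.
exists (complex.Re (psi x)).
  apply: complex_ReIm_inj => //=; have := ger0_Im h1; rewrite raddfD /= add0r.
  by [].
move: h1 h2; rewrite !lecE !raddfD /= raddfN /= => /andP[_ h1] /andP[_ h2].
by rewrite ler_norml; apply/andP; split; lra.
Qed.

Lemma psi_star x : psi (star x) = conjc (psi x).
Proof.
have [a [b [ha hb -> -> _]]] := sa_decomp x.
have [r hr _] := psi_sa ha; have [s hs _] := psi_sa hb.
rewrite psiB psiD !psiZ hr hs.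
by apply: complex_ReIm_inj => /=; ring.
Qed.

Lemma psi_bounded : exists2 C : R, 0 <= C & forall x, nrm (psi x) <= C * anrm x.
Proof.
have [C C0 hC] := star_bounded.
exists (1 + C); first by rewrite addr_ge0.
move=> x; have [a [b [ha hb Ex _ H]]] := sa_decomp x.
have [h1 h2] := H C (hC x).
have [r hr ra] := psi_sa ha; have [s hs sb] := psi_sa hb.
rewrite {1}Ex psiD psiZ hr hs.
rewrite (le_trans (nrmD _ _)) // nrmM nrm_i mul1r !nrm_real.
by move: (le_trans ra h1) (le_trans sb h2); lra.
Qed.

(** If the spectrum were empty, then - x and x - 1 would be nonnegative for vacuous
    reasons, although their images under psi add up to - 1. This short argument replaces
    the theorem of Gelfand, which rests on Liouville's theorem. *)
Lemma spectrum_neq0 x : selfadjoint x -> exists t, spectrum x t.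
Proof.
move=> hx; apply: contrapT => h.
have ns t : x - t%:A \is a GRing.unit.
  by apply: contrapT => /negP hn; apply: h; exists t.
have p1 (k : R) : nonneg_elt (x + k%:C%:A).
  split; first by apply: selfadjointD => //; exact: selfadjoint_real.
  move=> z; rewrite /spectrum /= -addrA -scalerBl -opprB scaleNr.
  by rewrite ns.
have p2 : nonneg_elt (- x).
  split; first exact: selfadjointN.
  move=> z; rewrite /spectrum /= -opprD unitrN -[z]opprK scaleNr.
  by rewrite ns.
have h1 := psi_pos p2; have h2 := psi_pos (p1 (- 1)).
have := addr_ge0 h1 h2; rewrite psiN psiD psi_scalar addrA addNr add0r ler0c.
by rewrite lerNr oppr0 ler10.
Qed.

End Functional.

(** * Rational functions of a selfadjoint element *)

Section Rational.
Context (R : realType) (A : banachStarAlgType R) (c : A).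
Implicit Types (x y : A) (p q : {poly R[i]}) (r s : R[i] -> R[i]).

Let ev p : A := horner_alg c p.

Lemma evM p q : ev (p * q) = ev p * ev q. Proof. exact: rmorphM. Qed.
Lemma evD p q : ev (p + q) = ev p + ev q. Proof. exact: rmorphD. Qed.
Lemma evB p q : ev (p - q) = ev p - ev q. Proof. exact: rmorphB. Qed.
Lemma ev1 : ev 1 = 1. Proof. exact: rmorph1. Qed.
Lemma ev0 : ev 0 = 0. Proof. exact: rmorph0. Qed.
Lemma evZ (k : R[i]) p : ev (k *: p) = k *: ev p.
Proof. by rewrite -mul_polyC evM /ev horner_algC -scalerAl mul1r. Qed.

Lemma ev_comm p q : GRing.comm (ev p) (ev q).
Proof. by rewrite /GRing.comm -!evM mulrC. Qed.

Lemma evC (k : R[i]) : ev k%:P = k%:A. Proof. exact: horner_algC. Qed.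
Lemma evX : ev 'X = c. Proof. exact: horner_algX. Qed.

Lemma ev_XsubC (z : R[i]) : ev ('X - z%:P) = c - z%:A.
Proof. by rewrite evB evX evC. Qed.

Lemma ev_unit_root q : ev q \is a GRing.unit -> forall t, spectrum c t -> q.[t] != 0.
Proof.
move=> uq t ht; apply/negP => /factor_theorem[q' qE].
move: uq; rewrite qE evM unitrM_comm; last exact: ev_comm.
by rewrite ev_XsubC => /andP[_ u]; move: ht; rewrite /spectrum /= u.
Qed.

Lemma scalar_unit (k : R[i]) : k != 0 -> (k%:A : A) \is a GRing.unit.
Proof.
move=> k0; apply/unitrP; exists (k^-1)%:A.
by rewrite -!scalerAl !mul1r !scalerA mulVf ?divff // scale1r.
Qed.

Lemma ev_prod_unit (rs : seq R[i]) : (forall z, z \in rs -> ~ spectrum c z) ->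
  ev (\prod_(z <- rs) ('X - z%:P)) \is a GRing.unit.
Proof.
elim: rs => [|z rs IH] h; first by rewrite big_nil ev1 unitr1.
rewrite big_cons evM unitrM_comm; last exact: ev_comm.
rewrite IH ?andbT; last by move=> w wr; apply: h; rewrite inE wr orbT.
rewrite ev_XsubC; apply: contrapT => /negP nu; apply: (h z); rewrite ?mem_head //.
Qed.

Lemma ev_unit q : q != 0 -> (forall t, spectrum c t -> q.[t] != 0) -> ev q \is a GRing.unit.
Proof.
move=> q0 hq; have [rs qE] := closed_field_poly_normal q.
rewrite qE -mul_polyC evM unitrM_comm; last exact: ev_comm.
rewrite evC scalar_unit ?lead_coef_eq0 //= ev_prod_unit // => z zr hz.
have := hq z hz; rewrite qE hornerZ; have : root (\prod_(z <- rs) ('X - z%:P)) z by rewrite root_prod_XsubC.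
by move=> /rootP ->; rewrite mulr0 eqxx.
Qed.

(** y is the value at c of the rational function p / q, and r is a function that
    agrees with p / q on the spectrum of c. The symbol r is kept apart from p and q so
    that it can be manipulated as a plain function. *)
Definition rational_elt y r := exists p q : {poly R[i]},
  [/\ ev q \is a GRing.unit, y = ev p * (ev q)^-1 & forall t, spectrum c t -> r t = p.[t] / q.[t]].

Lemma rational_ext y r s : (forall t, spectrum c t -> r t = s t) ->
  rational_elt y r -> rational_elt y s.
Proof.
move=> rs [p [q [uq yE rE]]]; exists p, q; split => // t ht.
by rewrite -rs // rE.
Qed.

Lemma evV_comm p q : GRing.comm (ev p) (ev q)^-1.
Proof. exact/commrV/ev_comm. Qed.

Lemma evVM p q : ev p \is a GRing.unit -> ev q \is a GRing.unit ->
  (ev (p * q))^-1 = (ev p)^-1 * (ev q)^-1.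
Proof.
move=> up uq; rewrite evM invrM //.
by apply: commrV; apply/commr_sym; exact: evV_comm.
Qed.

Lemma evM_unit p q : ev p \is a GRing.unit -> ev q \is a GRing.unit -> ev (p * q) \is a GRing.unit.
Proof.
move=> up uq; rewrite evM unitrM_comm ?up ?uq //.
exact: ev_comm.
Qed.

Lemma rational_scalar (k : R[i]) : rational_elt k%:A (fun=> k).
Proof.
exists k%:P, 1; rewrite ev1 unitr1; split => //.
  by rewrite evC invr1 mulr1.
by move=> t _; rewrite hornerC hornerE divr1.
Qed.

Lemma rational_var : rational_elt c id.
Proof.
exists 'X, 1; rewrite ev1 unitr1; split => //.
  by rewrite evX invr1 mulr1.
by move=> t _; rewrite !hornerE divr1.
Qed.

Lemma rationalM x y r s : rational_elt x r -> rational_elt y s ->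
  rational_elt (x * y) (fun t => r t * s t).
Proof.
move=> [p [q [uq xE rE]]] [p' [q' [uq' yE sE]]].
exists (p * p'), (q * q'); split; first exact: evM_unit.
  rewrite evVM // xE yE evM !mulrA.
  congr (_ * _); rewrite -!mulrA; congr (_ * _).
  by apply/commr_sym; exact: evV_comm.
move=> t ht; rewrite rE // sE // !hornerM.
by field; rewrite !ev_unit_root.
Qed.

Lemma rationalD x y r s : rational_elt x r -> rational_elt y s ->
  rational_elt (x + y) (fun t => r t + s t).
Proof.
move=> [p [q [uq xE rE]]] [p' [q' [uq' yE sE]]].
exists (p * q' + p' * q), (q * q'); split; first exact: evM_unit.
  rewrite evD evVM // !evM mulrDl xE yE.
  have E1 : ev p * ev q' * ((ev q)^-1 * (ev q')^-1) = ev p * (ev q)^-1.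
    rewrite -mulrA [ev q' * (_ * _)]mulrA (evV_comm q' q) -mulrA mulrV // mulr1 //.
  have E2 : ev p' * ev q * ((ev q)^-1 * (ev q')^-1) = ev p' * (ev q')^-1.
    by rewrite -mulrA [ev q * (_ * _)]mulrA mulrV // mul1r.
  by rewrite E1 E2.
move=> t ht; rewrite rE // sE // hornerD !hornerM.
by field; rewrite !ev_unit_root.
Qed.

Lemma rationalZ (k : R[i]) y r : rational_elt y r -> rational_elt (k *: y) (fun t => k * r t).
Proof.
by move=> h; have := rationalM (rational_scalar k) h; rewrite -scalerAl mul1r.
Qed.

Lemma rational_sum (n : nat) (Y : nat -> A) (F : nat -> R[i] -> R[i]) :
  (forall i, (i < n)%N -> rational_elt (Y i) (F i)) ->
  rational_elt (\sum_(0 <= i < n) Y i) (fun t => \sum_(0 <= i < n) F i t).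
Proof.
elim: n => [|n IH] h.
  rewrite big_nil -(scale0r (1 : A)); apply: rational_ext (rational_scalar 0) => t _.
  by rewrite big_nil.
rewrite big_nat_recr //=.
apply: rational_ext (rationalD (IH _) (h n _)) => //; last by move=> i ?; apply: h; exact: ltnW.
by move=> t _; rewrite big_nat_recr.
Qed.

Lemma rational_resolvent z : ~ spectrum c z -> rational_elt (z%:A - c)^-1 (fun t => (z - t)^-1).
Proof.
move=> nz; have u : z%:A - c \is a GRing.unit.
  by rewrite -opprB unitrN; apply: contrapT => /negP.
have E : ev (z%:P - 'X) = z%:A - c by rewrite evB evX evC.
exists 1, (z%:P - 'X); rewrite E; split => //.
  by rewrite ev1 mul1r.
by move=> t _; rewrite !hornerE ?mul1r.
Qed.

(** The inclusion part of the spectral mapping theorem: if z is not a value of p / q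
    on the spectrum, then p - z q factors into linear factors X - a with a outside the
    spectrum, so its value at c is invertible. *)
Lemma rational_spectrum y r : (exists t, spectrum c t) -> rational_elt y r ->
  forall z, spectrum y z -> exists2 t, spectrum c t & z = r t.
Proof.
move=> [t0 ht0] [p [q [uq yE rE]]] z hz; apply: contrapT => hn.
have nz t : spectrum c t -> (p - z *: q).[t] != 0.
  move=> ht; apply/negP => /eqP; rewrite !hornerE => /eqP; rewrite subr_eq0 => /eqP pE.
  apply: hn; exists t => //; rewrite rE // pE mulfK //; exact: ev_unit_root.
have n0 : p - z *: q != 0.
  by have := nz t0 ht0; apply: contraNneq => ->; rewrite horner0.
have u := ev_unit n0 nz.
have E : y - z%:A = ev (p - z *: q) * (ev q)^-1.
  rewrite yE evB evZ mulrBl; congr (_ - _).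
  by rewrite -scalerAl mulrV.
by move: hz; rewrite /spectrum /= E unitrMr ?unitrV // uq.
Qed.

Hypothesis c_sa : selfadjoint c.
Hypothesis c_real : forall z, spectrum c z -> z \is Num.real.

Lemma star_ev p : star (ev p) = ev (map_poly (@conjc R) p).
Proof.
elim/poly_ind: p => [|p k IH].
  by rewrite rmorph0 ev0 star0.
rewrite [in RHS]rmorphD [in RHS]rmorphM /= map_polyX map_polyC /=.
rewrite !evD !evM !evX !evC starD starM IH c_sa star_scalar.
by congr (_ + _); rewrite -[c in LHS]evX -[c in RHS]evX; exact: ev_comm.
Qed.

(** The spectrum of c is real, so conjugating the coefficients conjugates the
    symbol. *)
Lemma rational_star y r : rational_elt y r -> rational_elt (star y) (fun t => conjc (r t)).
Proof.
move=> [p [q [uq yE rE]]].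
exists (map_poly (@conjc R) p), (map_poly (@conjc R) q); rewrite -!star_ev; split.
- exact: star_unit.
- by rewrite yE starM starV //; rewrite !star_ev; apply/commr_sym; exact: evV_comm.
- move=> t ht; have /complex_realP[u tu] := c_real ht.
  have tc : t = conjc t by rewrite tu conjc_real.
  have ht' : forall p0 : {poly R[i]}, (map_poly (@conjc R) p0).[t] = conjc p0.[t].
    by move=> p0; rewrite {1}tc (horner_map (@conjc R)).
  by rewrite rE // !ht' rmorphM fmorphV.
Qed.

End Rational.

(** * Positivity of the holomorphic functional calculus *)

Section Resolvent.
Context (R : realType) (A : banachStarAlgType R) (c : A).
Implicit Types (z w t : R[i]).

Definition resolvent z : A := (z%:A - c)^-1.

Lemma resolvent_unit z : ~ spectrum c z -> z%:A - c \is a GRing.unit.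
Proof. by move=> nz; rewrite -opprB unitrN; apply: contrapT => /negP. Qed.

Lemma resolvent_identity z w : ~ spectrum c z -> ~ spectrum c w ->
  resolvent w - resolvent z = (z - w) *: (resolvent w * resolvent z).
Proof.
move=> /resolvent_unit uz /resolvent_unit uw.
have -> : resolvent w - resolvent z = resolvent w * ((z%:A - c) - (w%:A - c)) * resolvent z.
  by rewrite mulrBr mulrBl /resolvent mulVr // mul1r -mulrA mulrV // mulr1.
have -> : z%:A - c - (w%:A - c) = (z - w)%:A by rewrite opprB addrA subrK scalerBl.
by rewrite -scalerAr mulr1 -scalerAl.
Qed.

(** Otherwise t - c, which is (z - c) (1 - (z - t) (z - c)^-1), would be invertible. *)
Lemma resolvent_dist z t : ~ spectrum c z -> spectrum c t -> 1 <= nrm (z - t) * anrm (resolvent z).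
Proof.
move=> nz st; rewrite leNgt; apply/negP => h; have uz := resolvent_unit nz.
have u1 : 1 - (z - t) *: resolvent z \is a GRing.unit by apply: Neumann; rewrite anrmZ.
have E : t%:A - c = (z%:A - c) * (1 - (z - t) *: resolvent z).
  by rewrite mulrBr mulr1 -scalerAr mulrV // scalerBl opprB [RHS]addrC addrA subrK.
by move: st; rewrite /spectrum /= -opprB unitrN E unitrMr // u1.
Qed.

End Resolvent.

Section Positivity.
Context (R : realType) (A : banachStarAlgType R) (psi : {scalar A}) (c : A).
Hypotheses (hA : hermitian_algebra A) (psi_pos : positive_functional psi) (psi_norm : psi 1 = 1).
Hypothesis c_sa : selfadjoint c.
Implicit Types (x y : A) (r h : R[i] -> R[i]).

Let ne : exists t, spectrum c t := spectrum_neq0 psi_pos psi_norm c_sa.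

(** By the spectral mapping theorem, y is a nonnegative element. *)
Lemma rational_pos y r : rational_elt c y r -> selfadjoint y ->
  (forall t, spectrum c t -> 0 <= r t) -> 0 <= psi y.
Proof.
move=> hy ys hr; apply: psi_pos; split=> // z hz.
by have [t ht ->] := rational_spectrum ne hy hz; exact: hr.
Qed.

(** The selfadjoint part of y has the real part of r as its symbol. *)
Lemma rational_Re_ge y r (e : R) : rational_elt c y r ->
  (forall t, spectrum c t -> - e <= complex.Re (r t)) -> - e <= complex.Re (psi y).
Proof.
move=> hy hr.
have hs := rational_star c_sa (hA c_sa) hy.
have psis := psi_star hA psi_pos psi_norm y.
have re := rational_scalar c e%:C.
have h2 : (2^-1 : R[i]) = (2^-1 : R)%:C by rewrite fmorphV rmorph_nat.
have : 0 <= psi (2^-1 *: (y + star y) + e%:C%:A).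
  apply: (rational_pos (rationalD (rationalZ 2^-1 (rationalD hy hs)) re)).
    apply: selfadjointD; last exact: selfadjoint_real.
    by rewrite /selfadjoint starZ starD starK conjc_inv conjc_nat addrC.
  move=> t /hr h1; rewrite h2 lecE /=; case: (r t) h1 => a b /= h1.
  by apply/andP; split; [apply/eqP; ring|lra].
rewrite (psiD psi) (psi_scalar psi_norm) (psiZ psi) (psiD psi) psis h2 lecE /=.
by case: (psi y) => a b /= /andP[_]; lra.
Qed.

Lemma rational_near_pos y r (e : R) : rational_elt c y r ->
  (forall t, spectrum c t -> exists2 u : R[i], 0 <= u & nrm (u - r t) <= e) ->
  - e <= complex.Re (psi y) /\ `|complex.Im (psi y)| <= e.
Proof.
move=> hy hr.
have bnd t : spectrum c t -> - e <= complex.Re (r t) /\ `|complex.Im (r t)| <= e.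
  move=> /hr[u u0 ur]; have h1 := le_trans (nrm_Re _) ur; have h2 := le_trans (nrm_Im _) ur.
  move: h1 h2; rewrite !raddfB /= (ger0_Im u0) sub0r normrN => h1 h2; split=> //.
  by move: u0; rewrite lecE /= => /andP[_ u0]; move: h1; rewrite ler_norml => /andP[]; lra.
split; first by apply: rational_Re_ge hy _ => t /bnd[].
rewrite ler_norml; apply/andP; split.
  have := @rational_Re_ge _ _ e (rationalZ (- 'i) hy); rewrite (psiZ psi).
  have -> (z : R[i]) : complex.Re (- 'i * z) = complex.Im z by case: z => a b /=; ring.
  apply=> t /bnd[_]; rewrite ler_norml => /andP[h _].
  by case: (r t) h => a b /= h; lra.
have := @rational_Re_ge _ _ e (rationalZ 'i hy); rewrite (psiZ psi).
have -> (z : R[i]) : complex.Re ('i * z) = - complex.Im z by case: z => a b /=; ring.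
rewrite lerN2; apply=> t /bnd[_]; rewrite ler_norml => /andP[_ h].
by case: (r t) h => a b /= h; lra.
Qed.

(** x is a limit of rational functions of c whose symbols converge to h uniformly on
    the spectrum. This is all that is retained of the relation between h and h(c). *)
Definition sym_approx x h := forall e : R, 0 < e -> exists y r,
  [/\ rational_elt c y r, anrm (x - y) <= e & forall t, spectrum c t -> nrm (h t - r t) <= e].

Lemma approx_rational y r : rational_elt c y r -> sym_approx y r.
Proof. by move=> h e e0; exists y, r; split=> // [|t _]; rewrite subrr ?anrm0 ?nrm0 ltW. Qed.

Lemma approxD x x' h h' : sym_approx x h -> sym_approx x' h' -> sym_approx (x + x') (fun t => h t + h' t).
Proof.
move=> H H' e e0; have e2 : 0 < e / 2 by rewrite divr_gt0.
have [y [r [h1 h2 h3]]] := H _ e2; have [y' [r' [h1' h2' h3']]] := H' _ e2.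
exists (y + y'), (fun t => r t + r' t); split; first exact: rationalD.
  by rewrite opprD addrACA (le_trans (anrmD _ _)) // [leRHS]splitr lerD.
by move=> t ht; rewrite opprD addrACA (le_trans (nrmD _ _)) // [leRHS]splitr lerD ?h3 ?h3'.
Qed.

Lemma approxM_bounded u s x h (B : R) : rational_elt c u s -> 0 <= B -> anrm u <= B ->
  (forall t, spectrum c t -> nrm (s t) <= B) -> sym_approx x h -> sym_approx (u * x) (fun t => s t * h t).
Proof.
move=> hu B0 uB sB H e e0; have B1 : 0 < B + 1 by rewrite ltr_wpDl.
have [y [r [h1 h2 h3]]] := H _ (divr_gt0 e0 B1).
have le : B * (e / (B + 1)) <= e by rewrite mul_div_succ_le.
exists (u * y), (fun t => s t * r t); split; first exact: rationalM.
  by rewrite -mulrBr (le_trans (anrmM _ _)) // (le_trans _ le) // ler_pM ?anrm_ge0.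
by move=> t ht; rewrite -mulrBr nrmM (le_trans _ le) // ler_pM ?nrm_ge0 ?sB ?h3.
Qed.

Lemma approxZ (k : R[i]) x h : sym_approx x h -> sym_approx (k *: x) (fun t => k * h t).
Proof.
move=> H; have -> : k *: x = k%:A * x by rewrite -scalerAl mul1r.
apply: (approxM_bounded (B := nrm k * (anrm (1 : A) + 1)) (rational_scalar c k)) H.
- by rewrite mulr_ge0 ?nrm_ge0 // addr_ge0 ?anrm_ge0.
- by rewrite anrmZ ler_wpM2l ?nrm_ge0 // lerDl.
- by move=> t _; rewrite ler_peMr ?nrm_ge0 // lerDr anrm_ge0.
Qed.

Lemma approx_mul_var x h : sym_approx x h -> sym_approx (c * x) (fun t => t * h t).
Proof.
apply: (@approxM_bounded _ _ _ _ (anrm c) (rational_var c)) => //; first exact: anrm_ge0.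
by move=> t; exact: spectrum_bound.
Qed.

(** psi is bounded, and it is nonnegative up to a small error on the approximants. *)
Theorem approx_pos x h : sym_approx x h -> (forall t, spectrum c t -> 0 <= h t) -> 0 <= psi x.
Proof.
move=> H hh; have [C C0 hC] := psi_bounded hA psi_pos psi_norm.
have C1 : 0 < C + 1 by rewrite ltr_wpDl.
have key (e : R) : 0 < e -> - e <= complex.Re (psi x) /\ `|complex.Im (psi x)| <= e.
  move=> e0; have [y [r [h1 h2 h3]]] := H _ (divr_gt0 e0 C1).
  have [s1 /[!ler_norml] /andP[s2 s3]] :
      - (e / (C + 1)) <= complex.Re (psi y) /\ `|complex.Im (psi y)| <= e / (C + 1).
    by apply: (rational_near_pos h1) => t ht; exists (h t); [exact: hh|exact: h3].
  have d : nrm (psi x - psi y) <= C * (e / (C + 1)).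
    by rewrite -(psiB psi) (le_trans (hC _)) // ler_wpM2l.
  have := le_trans (nrm_Re _) d; have := le_trans (nrm_Im _) d; rewrite !raddfB /=.
  have E : C * (e / (C + 1)) + e / (C + 1) = e by field; rewrite gt_eqF.
  rewrite !ler_norml => /andP[i1 i2] /andP[r1 r2].
  by split; [|apply/andP; split]; lra.
rewrite lecE /=; apply/andP; split.
  rewrite -normr_eq0 eq_le normr_ge0 andbT; apply/ler_addgt0Pr => e /key[_].
  by rewrite add0r.
by apply/ler_addgt0Pr => e /key[h1 _]; rewrite -lerBlDr sub0r.
Qed.

End Positivity.

Section HolCalc.
Context (R : realType) (A : banachStarAlgType R) (c : A).
Context (gamma : R -> R[i]) (W : R -> R) (G : set R[i]).
Hypothesis hW : dominates gamma W.
Hypothesis G_open : open G.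
Hypothesis enc : encloses gamma G (spectrum c).
Implicit Types (z w t : R[i]) (h : R[i] -> R[i]).

Let gamma_cont : {within `[0, 1], continuous gamma}. Proof. by case: enc => -[]. Qed.

Lemma curve_off_spectrum u : 0 <= u <= 1 -> ~ spectrum c (gamma u).
Proof.
move=> u01 hs; case: enc => _ _ /(_ _ hs)[hn _] _; apply: hn.
by exists u => //=; rewrite in_itv.
Qed.

Definition nresolvent z : nspace A := resolvent c z.

Lemma resolvent_unif_cont : unif_cont01 (nresolvent \o gamma).
Proof.
apply: (curve_comp gamma_cont) => u u01 e e0; set N := anrm (resolvent c (gamma u)).
have N0 : 0 <= N by exact: anrm_ge0.
have N1 : 0 < N + 1 by rewrite ltr_wpDl.
exists (Num.min (2^-1 / (N + 1)) (e / (2 * (N + 1) ^+ 2))).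
  by rewrite min_gt0 // divr_gt0 // ?invr_gt0 // mulr_gt0 // exprn_gt0.
move=> s s01; rewrite lt_min => /andP[]; set d := nrm _.
rewrite ltr_pdivlMr // ltr_pdivlMr ?mulr_gt0 ?exprn_gt0 // => d1 d2.
have d0 : 0 <= d by exact: nrm_ge0.
have E := resolvent_identity (curve_off_spectrum u01) (curve_off_spectrum s01).
rewrite /nresolvent -/(anrm _) E anrmZ cnrmC -/d.
set M := anrm (resolvent c (gamma s)).
have M0 : 0 <= M by exact: anrm_ge0.
have MN : M <= N + d * (M * N).
  rewrite -[X in X <= _]/(anrm _) -[resolvent c (gamma s)](subrK (resolvent c (gamma u))).
  rewrite (le_trans (anrmD _ _)) // addrC lerD2l E anrmZ cnrmC ler_wpM2l //.
  exact: anrmM.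
apply: (@le_trans _ _ (d * (M * N))); first by rewrite ler_wpM2l // anrmM.
have dN : d * N <= 2^-1 by rewrite (le_trans _ (ltW d1)) // ler_wpM2l // lerDl.
have M2 : M <= 2 * N.
  have : d * N * M <= 2^-1 * M by rewrite ler_wpM2r.
  have -> : d * N * M = d * (M * N) by ring.
  lra.
apply: (@le_trans _ _ (d * (2 * (N + 1) ^+ 2))); last exact: ltW.
rewrite ler_wpM2l //; apply: (@le_trans _ _ (2 * N * N)); first by rewrite ler_wpM2r.
by nra.
Qed.

Lemma unif_cont01_scale (V : normedModType R[i]) (u : R -> R[i]) (v : R -> V) :
  unif_cont01 u -> unif_cont01 v -> unif_cont01 (fun x => u x *: v x).
Proof.
move=> hu hv e e0.
have [B B0 hB] := unif_cont01_bounded hu; have [K K0 hK] := unif_cont01_bounded hv.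
have B1 : 0 < B + 1 by rewrite ltr_wpDl.
have K1 : 0 < K + 1 by rewrite ltr_wpDl.
have e2 : 0 < e / 2 by rewrite divr_gt0.
have [d1 d10 h1] := hu _ (divr_gt0 e2 K1); have [d2 d20 h2] := hv _ (divr_gt0 e2 B1).
exists (Num.min d1 d2); first by rewrite min_gt0.
move=> x y x01 y01; rewrite lt_min => /andP[/(h1 _ _ x01 y01) a1 /(h2 _ _ x01 y01) a2].
have -> : u x *: v x - u y *: v y = (u x - u y) *: v x + u y *: (v x - v y).
  by rewrite scalerBl scalerBr addrA subrK.
rewrite (le_trans (nrmD _ _)) // !nrmZ [leRHS]splitr lerD //.
  apply: (@le_trans _ _ (e / 2 / (K + 1) * (K + 1))); last by rewrite divfK // gt_eqF.
  by apply: ler_pM; rewrite ?nrm_ge0 // (le_trans (hK _ x01)) // lerDl.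
apply: (@le_trans _ _ ((B + 1) * (e / 2 / (B + 1)))); last by rewrite mulrC divfK // gt_eqF.
by apply: ler_pM; rewrite ?nrm_ge0 // (le_trans (hB _ y01)) // lerDl.
Qed.

(** The distance from a curve integral to a uniform Riemann sum is controlled by the
    modulus of continuity of the integrand alone. Applied to all the functions
    h w / (w - t) with t in the spectrum, this makes their Riemann sums converge
    uniformly in t. *)
Lemma integral_unif_error (V : normedModType R[i]) (F : R[i] -> V) (x : V) (d e : R) n :
  is_curve_integral gamma F x -> 0 <= e -> n.+1%:R^-1 < d / 2 ->
  (forall s u, 0 <= s <= 1 -> 0 <= u <= 1 -> `|s - u| < d -> nrm (F (gamma s) - F (gamma u)) <= e) ->
  nrm (x - rs_sum gamma (F \o gamma) (size (unif_part R n)) (subdiv_pt (unif_part R n)) (subdiv_pt (unif_part R n)))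
    <= (W 1 - W 0) * e.
Proof.
move=> hx e0 nd hF; have n0 : 0 < (n.+1%:R : R)^-1 by rewrite invr_gt0 ltr0n.
have d20 : 0 < d / 2 by exact: lt_trans nd.
set S := rs_sum _ _ _ _ _.
apply/ler_addgt0Pr => e' e'0; have [d' d'0 hd'] := hx _ e'0.
have [N hN] := @archi_inv R (Num.min d' (d / 2)) (min_gt0 d'0 d20).
have := hN N (leqnn _); rewrite lt_min => /andP[Nd' Nd].
have := hd' _ _ (itv_partition_unif R N) (unif_fine Nd').
pose S' := rs_sum gamma (F \o gamma) (size (unif_part R N)) (subdiv_pt (unif_part R N)) (subdiv_pt (unif_part R N)).
rewrite nrm_lt -/S' => xS'.
have cmp : nrm (S - S') <= (W 1 - W 0) * e.
  apply: (@rs_sum_compare R gamma W hW V (F \o gamma) _ _ _ _ _ _ (d / 2) (d / 2) d e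
    (subdivision_pt (itv_partition_unif R n)) (subdivision_pt (itv_partition_unif R N)) _ e0 _ (unif_fine Nd) hF).
  - by rewrite -splitr.
  - by move=> i /(unif_fine nd)[-> -> /ltW ->].
rewrite (le_trans (nrm_trans S' _ _)) // addrC lerD //; first by rewrite nrmC.
exact: ltW.
Qed.

Lemma hol_exists h : (forall z, G z -> exists l, cdiff h z l) ->
  exists y : nspace A, is_curve_integral gamma (fun z => h z *: (z%:A - c)^-1 : nspace A) y.
Proof.
move=> hh; apply: (curve_integral_exists hW); first exact: nspace_seq_complete.
apply: (unif_cont01_scale _ resolvent_unif_cont).
apply: (curve_comp_ccont gamma_cont) => u u01.
have Gu : G (gamma u).
  by case: enc => _ sub _ _; apply: sub; exists u => //=; rewrite in_itv.
by have [l /cdiff_ccont] := hh _ Gu.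
Qed.

Lemma two_pi_i_neq0 : two_pi_i R != 0.
Proof.
apply/eqP => /(congr1 (@complex.Im R)) /= /eqP; rewrite mulf_eq0 pnatr_eq0 /=.
by rewrite gt_eqF // pi_gt0.
Qed.

(** A Riemann sum of the integral that defines h(c) is a rational function of c. Its
    symbol at t is the Riemann sum of the Cauchy integral of h at t, which converges to
    h t by curve_Cauchy, uniformly on the spectrum. *)
Theorem hol_approx h (y : nspace A) : (forall z, G z -> exists l, cdiff h z l) ->
  is_curve_integral gamma (fun z => h z *: (z%:A - c)^-1 : nspace A) y ->
  sym_approx c ((two_pi_i R)^-1 *: (y : A)) h.
Proof.
move=> hh hy.
have [[gc g01 _] sub ins out] := enc.
have hG u : 0 <= u <= 1 -> G (gamma u).
  by move=> u01; apply: sub; exists u => //=; rewrite in_itv.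
have ch : unif_cont01 (h \o gamma).
  by apply: (curve_comp_ccont gc) => u u01; have [l /cdiff_ccont] := hh _ (hG u u01).
have cg : unif_cont01 (id \o gamma).
  by apply: (curve_comp_ccont gc) => u u01; exact: cdiff_ccont (cdiff_id _).
have [B B0 hB] := unif_cont01_bounded ch.
have [K K0 hK] := unif_cont01_bounded resolvent_unif_cont.
have Wge := dominates_ge0 hW.
have kb u t : 0 <= u <= 1 -> spectrum c t -> gamma u - t != 0 /\ nrm (gamma u - t)^-1 <= K.
  move=> u01 ht; have := resolvent_dist (curve_off_spectrum u01) ht.
  have Ku : anrm (resolvent c (gamma u)) <= K by exact: hK.
  move=> H; have n0 : gamma u - t != 0.
    by apply: contraTneq H => ->; rewrite nrm0 mul0r -ltNge.
  split=> //; rewrite nrmV -[leLHS]mul1r ler_pdivrMr ?nrm_gt0 //.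
  apply: (le_trans H); rewrite mulrC ler_wpM2r ?nrm_ge0 //.
move=> e e0; pose P := nrm (two_pi_i R)^-1.
have P0 : 0 <= P by exact: nrm_ge0.
pose D := (W 1 - W 0) * P.
have D0 : 0 <= D by rewrite mulr_ge0.
have D1 : 0 < D + 1 by rewrite ltr_wpDl.
pose e1 := e / (D + 1).
have e10 : 0 < e1 by rewrite divr_gt0.
have De : D * e1 <= e by rewrite mul_div_succ_le.
have [d1 d10 hd1] := unif_cont01_scale ch resolvent_unif_cont e10.
have BK : 0 <= B * K ^+ 2 by rewrite mulr_ge0 // exprn_ge0.
have BK1 : 0 < B * K ^+ 2 + 1 by rewrite ltr_wpDl.
have K1 : 0 < K + 1 by rewrite ltr_wpDl.
have e12 : 0 < e1 / 2 by rewrite divr_gt0.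
have [d2 d20 hd2] := cg _ (divr_gt0 e12 BK1).
have [d3 d30 hd3] := ch _ (divr_gt0 e12 K1).
(* K bounds the resolvent on the curve, hence also 1 / |gamma u - t| for t in the
   spectrum: the modulus of continuity of the integrand does not depend on t *)
have eqc t s u : spectrum c t -> 0 <= s <= 1 -> 0 <= u <= 1 -> `|s - u| < Num.min d2 d3 ->
    nrm (h (gamma s) / (gamma s - t) - h (gamma u) / (gamma u - t)) <= e1.
  move=> ht s01 u01; rewrite lt_min => /andP[/(hd2 s u s01 u01) a2 /(hd3 s u s01 u01) a3].
  have [ns ks] := kb s t s01 ht; have [nu ku] := kb u t u01 ht.
  have -> : h (gamma s) / (gamma s - t) - h (gamma u) / (gamma u - t) =
     h (gamma s) * ((gamma s - t)^-1 * (gamma u - t)^-1) * - (gamma s - gamma u)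
     + (h (gamma s) - h (gamma u)) * (gamma u - t)^-1 by field; rewrite ns nu.
  rewrite (le_trans (nrmD _ _)) // [leRHS]splitr lerD //.
    rewrite 3!nrmM nrmN; apply: (@le_trans _ _ (B * K ^+ 2 * (e1 / 2 / (B * K ^+ 2 + 1)))).
      apply: ler_pM; rewrite ?mulr_ge0 ?nrm_ge0 //; apply: ler_pM; rewrite ?mulr_ge0 ?nrm_ge0 ?expr2 //.
        exact: hB.
      by apply: ler_pM; rewrite ?nrm_ge0.
    by rewrite mul_div_succ_le.
  rewrite nrmM; apply: (@le_trans _ _ (e1 / 2 / (K + 1) * K)).
    by apply: ler_pM; rewrite ?nrm_ge0.
  by rewrite mulrAC -mulrA ger_pMr // ler_pdivrMr // mul1r lerDl.
pose d := Num.min d1 (Num.min d2 d3).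
have d0 : 0 < d by rewrite !min_gt0.
have [n hn] := @archi_inv R (d / 2) (divr_gt0 d0 (ltr0Sn _ 1)).
have nd := hn n (leqnn _).
pose p := subdiv_pt (unif_part R n).
pose Y := \sum_(0 <= i < n.+1) (gamma (p i.+1) - gamma (p i)) *: (h (gamma (p i)) *: resolvent c (gamma (p i))).
pose r t := \sum_(0 <= i < n.+1) (gamma (p i.+1) - gamma (p i)) * (h (gamma (p i)) * (gamma (p i) - t)^-1).
have hp := subdivision_pt (itv_partition_unif R n).
have p01 i : (i < n.+1)%N -> 0 <= p i <= 1.
  move=> lin; have lin' : (i <= size (unif_part R n))%N by rewrite size_unif ltnW.
  by rewrite (subdivision_ge0 hp lin') (subdivision_le1 hp lin').
exists ((two_pi_i R)^-1 *: Y), (fun t => (two_pi_i R)^-1 * r t); split.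
- apply: rationalZ; apply: rational_sum => i lin; do 2 apply: rationalZ.
  by apply: rational_resolvent; apply: curve_off_spectrum; exact: p01.
- rewrite -scalerBr anrmZ -/P.
  apply: (@le_trans _ _ (P * ((W 1 - W 0) * e1))); last by rewrite mulrA [P * _]mulrC.
  rewrite ler_wpM2l //.
  have := @integral_unif_error _ _ _ d e1 n hy (ltW e10) nd.
  rewrite /rs_sum size_unif; apply => s u s01 u01 su; apply: hd1 => //.
  by apply: (lt_le_trans su); rewrite ge_min lexx.
- move=> t ht.
  have hC := curve_Cauchy gc hW g01 G_open out hh (ins t ht).
  have := @integral_unif_error _ _ _ d e1 n hC (ltW e10) nd.
  rewrite /rs_sum size_unif => H.
  have -> : h t - (two_pi_i R)^-1 * r t = (two_pi_i R)^-1 * (two_pi_i R * h t - r t).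
    by field; exact: two_pi_i_neq0.
  rewrite nrmM -/P; apply: (@le_trans _ _ (P * ((W 1 - W 0) * e1))); last by rewrite mulrA [P * _]mulrC.
  rewrite ler_wpM2l //; apply: H => s u s01 u01 su; apply: eqc => //.
  by apply: (lt_le_trans su); rewrite ge_min lexx orbT.
Qed.

End HolCalc.

(** The value chosen in the definition of hol_calc may come from any enclosing curve;
    hol_approx applies to all of them. *)
Theorem hol_calc_approx (R : realType) (A : banachStarAlgType R) (c : A) (G : set R[i])
  (h : R[i] -> R[i]) : open G -> (exists gamma : R -> R[i], encloses gamma G (spectrum c)) ->
  (forall z, G z -> exists l, cdiff h z l) -> sym_approx c (hol_calc G h c) h.
Proof.
move=> Go [gamma enc] hh; rewrite /hol_calc.
set P := [set x : A | _].
have [x0 hx0] : exists x, P x.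
  have [[_ _ /rectifiable_dominates[W hW]] _ _ _] := enc.
  have [y hy] := hol_exists hW enc hh.
  by exists ((two_pi_i R)^-1 *: (y : A)), gamma, y.
have := @xgetPex _ (0 : A) P (ex_intro _ x0 hx0); set x := xget _ _.
move=> [gamma' [y [enc' hy] ->]].
have [[_ _ /rectifiable_dominates[W hW]] _ _ _] := enc'.
exact (hol_approx hW Go enc' hh hy).
Qed.

(** * Taylor's inequality and the two estimates *)

Section Interface.
Context (R : realType).
Implicit Types (f H : R[i] -> R[i]) (z w : R[i]).

Lemma derivable_cdiff f z : derivable f z 1 -> cdiff f z (derive1 f z).
Proof.
move=> hf e e0; rewrite derive1E.
have : nbhs ('D_1 f z : R[i]) [set y : R[i] | nrm (y - 'D_1 f z) < e] by apply/nbhs_nrmP; exists e.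
move=> /hf /nbhs_nrmP[d d0 hd]; exists d => // w wz.
have [->|nwz] := eqVneq w z; first by rewrite !subrr mul0r subr0 nrm0 mulr0.
have wz0 : w - z != 0 by rewrite subr_eq0.
have := hd (w - z); rewrite subr0 => /(_ wz wz0) /=.
rewrite /GRing.scale /= mulr1 subrK => h.
have -> : f w - f z - (w - z) * 'D_1 f z = ((w - z)^-1 * (f w - f z) - 'D_1 f z) * (w - z).
  by field.
by rewrite nrmM ler_wpM2r ?nrm_ge0 // ltW.
Qed.

Lemma cdiff_derive1 f z (l : R[i]) : cdiff f z l -> derive1 f z = l.
Proof.
move=> hf; apply: cvg_lim => //.
move=> P /nbhs_nrmP[e e0 hP]; have e20 : 0 < e / 2 by rewrite divr_gt0.
have [d d0 hd] := hf _ e20.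
apply/nbhs_nrmP; exists d => // h; rewrite subr0 => hh h0; apply: hP.
have := hd (h + z); rewrite addrK => /(_ hh) H.
have nh : 0 < nrm h by exact: nrm_gt0.
have -> : h^-1 *: (f (h + z) - f z) - l = (f (h + z) - f z - h * l) * h^-1.
  by rewrite /GRing.scale /=; field.
rewrite nrmM nrmV ltr_pdivrMr //; apply: le_lt_trans H _.
by rewrite ltr_pM2r // ltr_pdivrMr // ltr_pMr // ltr1n.
Qed.

(** Two applications of the mean value theorem: g b is g2 d (c - a) (b - a), with c
    between a and b. *)
Lemma real_taylor_ge0 (m M a b : R) (g g1 g2 : R -> R) :
  (forall x, m <= x <= M -> is_derive x 1 g (g1 x)) ->
  (forall x, m <= x <= M -> is_derive x 1 g1 (g2 x)) ->
  (forall x, m <= x <= M -> 0 <= g2 x) ->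
  m <= a <= M -> m <= b <= M -> g a = 0 -> g1 a = 0 -> 0 <= g b.
Proof.
move=> dg dg1 g20 ha hb ga g1a.
have mvt (u v : R -> R) x y : (forall x, m <= x <= M -> is_derive x 1 u (v x)) ->
    m <= x <= M -> m <= y <= M -> x < y ->
    exists2 c, x < c < y & u y - u x = v c * (y - x).
  move=> uv /andP[mx xM] /andP[my yM] xy.
  have sub t : x <= t <= y -> m <= t <= M.
    by move=> /andP[xt ty]; rewrite (le_trans mx xt) (le_trans ty yM).
  have [t||c] := @MVT R u v x y xy.
  - by rewrite in_itv /= => /andP[/ltW h1 /ltW h2]; apply: uv; apply: sub; rewrite h1.
  - apply: continuous_in_subspaceT => t; rewrite inE /= in_itv /= => /sub/uv[h _].
    exact/differentiable_continuous/derivable1_diffP.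
  by rewrite in_itv /= => hc E; exists c.
have sub c x y : m <= x <= M -> m <= y <= M -> x < c < y -> m <= c <= M.
  by move=> /andP[? ?] /andP[? ?] /andP[? ?]; apply/andP; split; lra.
case: (ltgtP a b) => [ab|ba|<-]; last by rewrite ga.
- have [c hc E] := mvt g g1 a b dg ha hb ab.
  have hc' := sub _ _ _ ha hb hc; have /andP[ac cb] := hc.
  have [d hd E1] := mvt g1 g2 a c dg1 ha hc' ac.
  have := g20 d (sub _ _ _ ha hc' hd).
  move: E E1; rewrite ga g1a !subr0 => -> -> g2d.
  by rewrite !mulr_ge0 // subr_ge0 ltW.
- have [c hc E] := mvt g g1 b a dg hb ha ba.
  have hc' := sub _ _ _ hb ha hc; have /andP[bc ca] := hc.
  have [d hd E1] := mvt g1 g2 c a dg1 hc' ha ca.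
  have := g20 d (sub _ _ _ hc' ha hd).
  move: E E1; rewrite ga g1a !sub0r => /eqP; rewrite eqr_oppLR => /eqP -> /eqP; rewrite eqr_oppLR => /eqP -> g2d.
  by rewrite -mulNr opprK !mulr_ge0 // subr_ge0 ltW.
Qed.

Lemma cdiff_is_derive (p : R[i] -> R) H (l : R[i]) (x : R) :
  (forall z w, p (z - w) = p z - p w) -> (forall z, `|p z| <= nrm z) ->
  (forall (r : R) z, p (r%:C * z) = r * p z) ->
  cdiff H x%:C l -> is_derive x 1 (fun x : R => p (H x%:C)) (p l).
Proof.
move=> pB pN pZ hH; apply: real_is_derive => e e0; have [d d0 hd] := hH e e0.
exists d => // h hh; have := hd (x + h)%:C.
have -> : (x + h)%:C - x%:C = h%:C by rewrite rmorphD addrC addKr.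
rewrite nrm_real => /(_ hh); apply: le_trans.
by rewrite -pB -pZ -pB.
Qed.

(** The order of R[i] requires the real part of H to be nonnegative and its
    imaginary part to vanish; the latter is nonnegative together with its opposite. The
    function H itself need not be real on the interval. *)
Lemma complex_taylor_ge0 (m M a b : R) (H H1 H2 : R[i] -> R[i]) :
  (forall x : R, m <= x <= M -> cdiff H x%:C (H1 x%:C)) ->
  (forall x : R, m <= x <= M -> cdiff H1 x%:C (H2 x%:C)) ->
  (forall x : R, m <= x <= M -> 0 <= H2 x%:C) ->
  m <= a <= M -> m <= b <= M -> H a%:C = 0 -> H1 a%:C = 0 -> 0 <= H b%:C.
Proof.
move=> dH dH1 H20 ha hb Ha H1a.
have G (p : R[i] -> R) : (forall z w, p (z - w) = p z - p w) -> (forall z, `|p z| <= nrm z) ->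
    (forall (r : R) z, p (r%:C * z) = r * p z) -> (forall z, 0 <= z -> 0 <= p z) -> 0 <= p (H b%:C).
  move=> pB pN pZ p0; have p00 : p 0 = 0 by rewrite -(subrr 0) pB subrr.
  apply: (@real_taylor_ge0 m M a b (fun x => p (H x%:C)) (fun x => p (H1 x%:C)) (fun x => p (H2 x%:C))) => //.
  - by move=> x hx; exact: (cdiff_is_derive pB pN pZ (dH x hx)).
  - by move=> x hx; exact: (cdiff_is_derive pB pN pZ (dH1 x hx)).
  - by move=> x hx; apply: p0; exact: H20.
  - by rewrite Ha.
  - by rewrite H1a.
have hRe : 0 <= complex.Re (H b%:C).
  apply: (G (@complex.Re R)); [by move=> z w; rewrite raddfB|exact: nrm_Re| |].
    by move=> r [x y] /=; ring.
  by move=> z; rewrite lecE /= => /andP[].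
have hIm : 0 <= complex.Im (H b%:C).
  apply: (G (@complex.Im R)); [by move=> z w; rewrite raddfB|exact: nrm_Im| |].
    by move=> r [x y] /=; ring.
  by move=> z /ger0_Im ->.
have hIm' : 0 <= - complex.Im (H b%:C).
  apply: (G (fun z => - complex.Im z)).
  - by move=> z w; rewrite raddfB /= opprB; ring.
  - by move=> z; rewrite normrN; exact: nrm_Im.
  - by move=> r [x y] /=; ring.
  - by move=> z /ger0_Im ->; rewrite oppr0.
rewrite lecE hRe andbT eq_le -oppr_ge0 hIm'.
by rewrite hIm.
Qed.

(** The sign s makes one statement out of the lower bound (s = 1) and of the upper
    bound (s = -1) on the remainder of the first order expansion of f. *)
Lemma taylor_bound (m M a b : R) (f f1 f2 : R[i] -> R[i]) (s q : R) :
  (forall x : R, m <= x <= M -> cdiff f x%:C (f1 x%:C)) ->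
  (forall x : R, m <= x <= M -> cdiff f1 x%:C (f2 x%:C)) ->
  (forall x : R, m <= x <= M -> 0 <= s%:C * (f2 x%:C - q%:C)) ->
  m <= a <= M -> m <= b <= M ->
  0 <= s%:C * (f b%:C - f a%:C - f1 a%:C * (b%:C - a%:C) - 2^-1 * q%:C * (b%:C - a%:C) ^+ 2).
Proof.
move=> df df1 hq ha hb.
pose H z := s%:C * (f z + (- f a%:C + (- f1 a%:C * (z - a%:C) + - (2^-1 * q%:C) * ((z - a%:C) * (z - a%:C))))).
pose H1 z := s%:C * (f1 z + (- f1 a%:C + - q%:C * (z - a%:C))).
have := @complex_taylor_ge0 m M a b H H1 (fun z => s%:C * (f2 z - q%:C)).
have -> : H b%:C = s%:C * (f b%:C - f a%:C - f1 a%:C * (b%:C - a%:C) - 2^-1 * q%:C * (b%:C - a%:C) ^+ 2).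
  by rewrite /H; ring.
apply=> //.
- move=> x hx; apply: cdiffZ.
  have := cdiffD (df x hx) (cdiffD (cdiff_cst (- f a%:C) x%:C) (cdiffD
    (cdiffZ (- f1 a%:C) (cdiff_sub_cst a%:C x%:C))
    (cdiffZ (- (2^-1 * q%:C)) (cdiffM (cdiff_sub_cst a%:C x%:C) (cdiff_sub_cst a%:C x%:C))))).
  congr cdiff; by field.
- move=> x hx; apply: cdiffZ.
  have := cdiffD (df1 x hx) (cdiffD (cdiff_cst (- f1 a%:C) x%:C)
    (cdiffZ (- q%:C) (cdiff_sub_cst a%:C x%:C))).
  congr cdiff; by ring.
- by rewrite /H; ring.
- by rewrite /H1; ring.
Qed.

End Interface.

Theorem corollary3 (R : realType) (A : banachStarAlgType R) (psi : {scalar A})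
  (G : set R[i]) (f : R[i] -> R[i]) (I : set R) (m M k K : R) (c : A)
  (hA : hermitian_algebra A)
  (psi_pos : positive_functional psi) (psi_norm : psi 1 = 1)
  (G_open : open G) (f_analytic : analytic_on G f)
  (I_itv : is_interval I) (I_sub_G : forall t, I t -> G t%:C)
  (m_lt_M : m < M) (mM_sub_I : forall t, m <= t <= M -> I t)
  (k_ge0 : 0 <= k) (k_lt_K : k < K)
  (f''_bounds : forall t, m <= t <= M -> k%:C <= derive1n 2 f t%:C <= K%:C)
  (c_sa : selfadjoint c)
  (c_spec : forall z, spectrum c z -> m%:C <= z <= M%:C)
  (psi_f'c : psi (hol_calc G (derive1 f) c) <> 0) :
  let x0 : R[i] := psi (c * hol_calc G (derive1 f) c) / psi (hol_calc G (derive1 f) c) in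
  m%:C <= x0 <= M%:C ->
  let D : R[i] := psi ((c - x0%:A) ^+ 2) in
  let S1 : R[i] := f x0 - psi (hol_calc G f c) in
  let S2 : R[i] := derive1 f x0 * x0 - psi c * derive1 f x0 - f x0 + psi (hol_calc G f c) in
  (real_le S1 (2^-1 * K%:C * D) /\ real_le (2^-1 * k%:C * D) S1) /\
  (real_le S2 (2^-1 * K%:C * D) /\ real_le (2^-1 * k%:C * D) S2).
Proof.
move=> x0 hx0 D S1 S2.
(* without an enclosing curve hol_calc would be zero by default, against psi_f'c *)
have enc : exists gamma : R -> R[i], encloses gamma G (spectrum c).
  apply: contrapT => nenc; apply: psi_f'c.
  rewrite /hol_calc xgetPN ?raddf0 // => x [gamma [y [enc _] _]].
  by apply: nenc; exists gamma.
set f1 := derive1 f in x0 hx0 D S1 S2 psi_f'c *.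
have df z : G z -> cdiff f z (f1 z) by move=> /f_analytic/derivable_cdiff.
have df1 z : G z -> cdiff f1 z (derive1n 2 f z).
  move=> Gz; have /nbhs_nrmP[r r0 hr] : nbhs z G by exact: open_nbhs_nbhs.
  have [l hl] := analytic_deriv r0 (fun w wr => df w (hr w wr)).
  by rewrite (_ : derive1n 2 f z = l) //; exact: cdiff_derive1 hl.
have apf : sym_approx c (hol_calc G f c) f.
  by apply: hol_calc_approx => // z /df h; exists (f1 z).
have apf1 : sym_approx c (hol_calc G f1 c) f1.
  by apply: hol_calc_approx => // z /df1 h; exists (derive1n 2 f z).
set F := hol_calc G f c in S1 S2 apf *.
set F1 := hol_calc G f1 c in x0 hx0 D S1 S2 psi_f'c apf1 *.
have toR z : m%:C <= z <= M%:C -> exists2 b : R, m <= b <= M & z = b%:C.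
  move=> /andP[h1 h2]; move: (h1) (h2); rewrite !lecE /= => /andP[/eqP i1 r1] /andP[/eqP i2 r2].
  by exists (complex.Re z); rewrite ?r1 //; apply: complex_ReIm_inj.
(* from here on x0 is a real number b of [m, M], known only through x0F1 *)
have [b hb xb] := toR _ hx0.
have x0F1 : x0 * psi F1 = psi (c * F1) by rewrite /x0 divfK //; exact/eqP.
clearbody x0; subst x0; set x0 : R[i] := b%:C in hx0 D S1 S2 x0F1 *.
have rsq := rationalM (rationalD (rational_var c) (rational_scalar c (- x0)))
                      (rationalD (rational_var c) (rational_scalar c (- x0))).
have sqE : (c + (- x0)%:A) * (c + (- x0)%:A) = (c - x0%:A) ^+ 2 by rewrite scaleNr expr2.
rewrite sqE in rsq; have apsq := approx_rational rsq.
have dfr (x : R) : m <= x <= M -> cdiff f x%:C (f1 x%:C).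
  by move=> hx; apply: df; apply: I_sub_G; exact: mM_sub_I.
have df1r (x : R) : m <= x <= M -> cdiff f1 x%:C (derive1n 2 f x%:C).
  by move=> hx; apply: df1; apply: I_sub_G; exact: mM_sub_I.
have pos := approx_pos hA psi_pos psi_norm c_sa.
have D0 : 0 <= D.
  apply: pos apsq _ => t /c_spec/toR[a _ ->].
  by rewrite -rmorphN -rmorphD -rmorphM ler0c -expr2 sqr_ge0.
(* substitute c for t in the expansion of f at t, evaluated at x0; the linear terms
   cancel by x0F1 *)
have key1 (s q : R) : (forall x : R, m <= x <= M -> 0 <= s%:C * (derive1n 2 f x%:C - q%:C)) ->
    0 <= s%:C * (S1 - 2^-1 * q%:C * D).
  move=> hq.
  have H := approxZ s%:C (approxD (approx_rational (rational_scalar c (f x0)))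
    (approxD (approxZ (-1) apf) (approxD (approxZ (- x0) apf1) (approxD (approx_mul_var apf1)
      (approxZ (- (2^-1 * q%:C)) apsq))))).
  have := pos _ _ H _.
  rewrite !(psiZ psi) !(psiD psi) !(psiZ psi) psi_norm mulr1 -/D -x0F1.
  have -> : f x0 + (-1 * psi F + (- x0 * psi F1 + (x0 * psi F1 + - (2^-1 * q%:C) * D))) =
     S1 - 2^-1 * q%:C * D by rewrite /S1; ring.
  apply=> t /c_spec/toR[a ha ->].
  have := taylor_bound dfr df1r hq ha hb.
  by congr (0 <= _ * _); rewrite /x0; ring.
(* substitute c for t in the expansion of f at x0, evaluated at t *)
have key2 (s q : R) : (forall x : R, m <= x <= M -> 0 <= s%:C * (derive1n 2 f x%:C - q%:C)) ->
    0 <= s%:C * (S2 - 2^-1 * q%:C * D).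
  move=> hq.
  have H := approxZ s%:C (approxD (approx_rational (rational_scalar c (f1 x0 * x0 - f x0)))
    (approxD apf (approxD (approxZ (- f1 x0) (approx_rational (rational_var c)))
      (approxZ (- (2^-1 * q%:C)) apsq)))).
  have := pos _ _ H _.
  rewrite !(psiZ psi) !(psiD psi) !(psiZ psi) psi_norm mulr1 -/D.
  have -> : f1 x0 * x0 - f x0 + (psi F + (- f1 x0 * psi c + - (2^-1 * q%:C) * D)) =
     S2 - 2^-1 * q%:C * D by rewrite /S2; ring.
  apply=> t /c_spec/toR[a ha ->].
  have := taylor_bound dfr df1r hq hb ha.
  by congr (0 <= _ * _); rewrite /x0; ring.
have lo x : m <= x <= M -> 0 <= 1%:C * (derive1n 2 f x%:C - k%:C).
  by move=> /f''_bounds/andP[h _]; rewrite rmorph1 mul1r subr_ge0.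
have hi x : m <= x <= M -> 0 <= (-1)%:C * (derive1n 2 f x%:C - K%:C).
  by move=> /f''_bounds/andP[_ h]; rewrite rmorphN rmorph1 mulN1r opprB subr_ge0.
have realqD q : 2^-1 * q%:C * D \is Num.real.
  rewrite !realM ?(ger0_real D0) ?realV ?realn //.
  by apply/complex_realP; exists q.
have concl S : 0 <= 1%:C * (S - 2^-1 * k%:C * D) -> 0 <= (-1)%:C * (S - 2^-1 * K%:C * D) ->
    real_le S (2^-1 * K%:C * D) /\ real_le (2^-1 * k%:C * D) S.
  rewrite rmorph1 mul1r rmorphN rmorph1 mulN1r opprB => h1 h2.
  have Sr : S \is Num.real.
    by rewrite -[S](subrK (2^-1 * k%:C * D)) realD ?(ger0_real h1).
  by split; split=> //; rewrite -subr_ge0.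
by split; apply: concl; [exact: key1|exact: key1|exact: key2|exact: key2].
Qed.
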